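(* Let $\delta_{s,h}=\theta h$ with $\theta>0$, $h>0$, let $f\in L^2(Q)$, and let $u\in V^{\Delta_x}_{0,\underline{0}}$ be the solution of $\partial_t u-\Delta_x u=f$ in $Q$, $u=0$ on $\Sigma$, $u=0$ on $\Sigma_0$. Let $v\in V^{\Delta_x}_{0,\underline{0}}$ and $\boldsymbol{y}\in H^{\mathrm{div}_x,0}(Q)$, and put $e:=u-v$, $\mathbf r_{\rm eq}:=f-\partial_t v+\mathrm{div}_x\boldsymbol y$, $\mathbf r_{\rm d}:=\boldsymbol y-\nabla_x v$. Then for all $\gamma\in[\tfrac12,+\infty)$ and $\alpha_1,\alpha_2>0$, $$(2-\tfrac1\gamma)\big(\|\nabla_x e\|_Q^2+\delta_{s,h}\|\partial_t e\|_Q^2\big)+\delta_{s,h}\|\nabla_x e\|_{\Sigma_T}^2+\|e\|_{\Sigma_T}^2\le\gamma\Big((1+\alpha_1)\|\mathbf r_{\rm d}\|_Q^2+(1+\tfrac1{\alpha_1})C_{\rm F}^2\|\mathbf r_{\rm eq}\|_Q^2+\delta_{s,h}\big((1+\alpha_2)\|\mathrm{div}_x\mathbf r_{\rm d}\|_Q^2+(1+\tfrac1{\alpha_2})\|\mathbf r_{\rm eq}\|_Q^2\big)\Big).$$ In particular, for $\gamma=1$, $$\|\nabla_x e\|_Q^2+\delta_{s,h}\|\partial_t e\|_Q^2+\|e\|_{\Sigma_T}^2+\delta_{s,h}\|\nabla_x e\|_{\Sigma_T}^2\le(1+\alpha_1)\|\mathbf r_{\rm d}\|_Q^2+(1+\tfrac1{\alpha_1})C_{\rm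 F}^2\|\mathbf r_{\rm eq}\|_Q^2+\delta_{s,h}\big((1+\alpha_2)\|\mathrm{div}_x\mathbf r_{\rm d}\|_Q^2+(1+\tfrac1{\alpha_2})\|\mathbf r_{\rm eq}\|_Q^2\big),$$ and the best (i.e. right-hand side minimising) constants $\alpha_1,\alpha_2>0$ in the last estimate are $$\alpha_1^*=\frac{C_{\rm F}\|\mathbf r_{\rm eq}\|_Q}{\|\mathbf r_{\rm d}\|_Q},\qquad \alpha_2^*=\frac{\|\mathbf r_{\rm eq}\|_Q}{\|\mathrm{div}_x\mathbf r_{\rm d}\|_Q},$$ whenever these quotients are well-defined positive numbers.
   Context: $\Omega\subset\mathbb R^d$, $d\in\{1,2,3\}$, is a bounded Lipschitz domain, $0<T<+\infty$, $Q:=\Omega\times(0,T)$, $\Sigma:=\partial\Omega\times(0,T)$, $\Sigma_0:=\Omega\times\{0\}$, $\Sigma_T:=\Omega\times\{T\}$. $\nabla_x$, $\mathrm{div}_x$, $\Delta_x$ are the gradient, divergence and Laplacian in the spatial variables, and $\partial_t$ is the time derivative. $\|\cdot\|_Q$ and $\|\cdot\|_{\Sigma_T}$ are the $L^2(Q)$ and $L^2(\Sigma_T)$ norms (also for vector-valued functions). $H^1_0(Q):=\{u\in H^1(Q): u=0\text{ on }\Sigma\}$ and $V^{\Delta_x}_{0,\underline 0}:=\{u\in H^1_0(Q): \Delta_x u\in L^2(Q),\ u=0\text{ on }\Sigma_0\}$. $H^{\mathrm{div}_x,0}(Q):=\{\boldsymbol y\in[L^2(Q)]^d:\mathrm{div}_x\boldsymbol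 y\in L^2(Q)\}$. $C_{\rm F}>0$ is the constant in the Friedrichs inequality $\|w\|_Q\le C_{\rm F}\|\nabla_x w\|_Q$ for all $w\in L^2(Q)$ with $\nabla_x w\in[L^2(Q)]^d$ and $w=0$ on $\Sigma$. The parameter $\delta_{s,h}=\theta h$ is a positive number, where $\theta$ is a positive constant and $h$ is the (global) mesh size of a discretisation; only its positivity matters here. For $w\in V^{\Delta_x}_{0,\underline 0}$ the map $t\mapsto w(\cdot,t)$ is continuous with values in $H^1_0(\Omega)$, so $\|\nabla_x w\|_{\Sigma_T}$ is meaningful. For $f\in L^2(Q)$ and zero initial data the problem is uniquely solvable in $V^{\Delta_x}_{0,\underline 0}$. *)

(* Defs.v *)
From HB Require Import structures.
From mathcomp Require Import all_boot all_order all_algebra.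
From mathcomp Require Import all_classical all_reals all_analysis.
Set Implicit Arguments. Unset Strict Implicit. Unset Printing Implicit Defensive.
Import Order.TTheory GRing.Theory Num.Theory numFieldNormedType.Exports.
Local Open Scope classical_set_scope. Local Open Scope ring_scope.

(* The sigma-algebra of R^n generated by the coordinates, as for tuples. *)
Section measurable_rV.
Context {d} {T : measurableType d}.
Variable n : nat.

Let coors : 'I_n -> 'rV[T]_n -> T := fun i x => x ord0 i.

Let rV_set0 : g_sigma_preimage coors set0.
Proof. exact: sigma_algebra0. Qed.

Let rV_setC A : g_sigma_preimage coors A -> g_sigma_preimage coors (~` A).
Proof. exact: sigma_algebraC. Qed.

Let rV_bigcup (F : _^nat) : (forall i, g_sigma_preimage coors (F i)) ->
  g_sigma_preimage coors (\bigcup_i (F i)).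
Proof. exact: sigma_algebra_bigcup. Qed.

HB.instance Definition _ := @isMeasurable.Build (measure_tuple_display d)
  'rV[T]_n (g_sigma_preimage coors) rV_set0 rV_setC rV_bigcup.

Lemma measurable_rV_coord (i : 'I_n) :
  measurable_fun [set: 'rV[T]_n] (fun x => x ord0 i).
Proof.
move=> _ Y mY; rewrite setTI; apply: sub_sigma_algebra => /=.
rewrite -bigcup_seq/=; exists i => /=; first by rewrite mem_index_enum.
by exists Y => //; rewrite setTI.
Qed.

Lemma measurable_fun_rVP d1 (T1 : measurableType d1) (f : T1 -> 'rV[T]_n) :
  measurable_fun [set: T1] f <->
  forall i, measurable_fun [set: T1] (fun x => f x ord0 i).
Proof.
split=> [mf i|mf].
  apply: (@measurableT_comp _ _ _ _ _ _ (fun x : 'rV[T]_n => x ord0 i)) => //.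
  exact: measurable_rV_coord.
apply: (iffRL (iff_trans _ (iff_refl (g_sigma_preimage
    (fun i => coors i \o f) `<=` measurable)))).
- rewrite g_sigma_preimage_comp; split=> [hf A [/= C preC <-]|prefS].
    exact: hf.
  by move=> _ A mA; apply: prefS; exists A.
- apply: smallest_sub; first exact: sigma_algebra_measurable.
  rewrite -bigcup_seq/=; apply: bigcup_sub => i _ A [B mB <-]; exact: mf.
Qed.

End measurable_rV.

Section lebesgue_rV.
Variable R : realType.

Definition rV_rcons n (p : 'rV[R]_n * measurableTypeR R) : 'rV[R]_n.+1 :=
  \row_i (if unlift ord_max i is Some j then p.1 ord0 j else p.2).

Definition rV_unrcons n (x : 'rV[R]_n.+1) : 'rV[R]_n * measurableTypeR R :=
  (\row_j x ord0 (lift ord_max j), x ord0 ord_max).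

Lemma rV_rconsK n : cancel (@rV_rcons n) (@rV_unrcons n).
Proof.
case=> v t; rewrite /rV_unrcons; congr pair; last by rewrite mxE unlift_none.
by apply/rowP => j; rewrite !mxE liftK.
Qed.

Lemma measurable_rV_rcons n : measurable_fun setT (@rV_rcons n).
Proof.
apply/measurable_fun_rVP => i.
case: (unliftP ord_max i) => [j ->|->].
  rewrite (_ : (fun _ => _) = (fun x : 'rV[R]_n => x ord0 j) \o fst).
    by apply: measurableT_comp => //; exact: measurable_rV_coord.
  by apply/funext => x /=; rewrite mxE liftK.
rewrite (_ : (fun _ => _) = snd) //.
by apply/funext => x /=; rewrite mxE unlift_none.
Qed.

Lemma measurable_rV_unrcons n : measurable_fun setT (@rV_unrcons n).
Proof.
apply/measurable_fun_pairP; split; last exact: measurable_rV_coord.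
apply/measurable_fun_rVP => i.
rewrite (_ : (fun _ => _) = (fun x : 'rV[R]_n.+1 => x ord0 (lift ord_max i))).
  exact: measurable_rV_coord.
by apply/funext => x /=; rewrite mxE.
Qed.

Section step.
Context (n : nat) (m : {sigma_finite_measure set 'rV[R]_n -> \bar R}).

Definition lebesgue_rV_step : set 'rV[R]_n.+1 -> \bar R :=
  pushforward (m \x @lebesgue_measure R)%E (@rV_rcons n).

Let step0 : lebesgue_rV_step set0 = 0%E.
Proof. by rewrite /lebesgue_rV_step /pushforward preimage_set0 measure0. Qed.

Let step_ge0 A : (0 <= lebesgue_rV_step A)%E.
Proof. by rewrite /lebesgue_rV_step /pushforward; exact: measure_ge0. Qed.

Let step_sigma_additive : semi_sigma_additive lebesgue_rV_step.
Proof.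
move=> F mF tF mUF; rewrite /lebesgue_rV_step /pushforward preimage_bigcup.
apply: measure_semi_sigma_additive.
- by move=> k; rewrite -[X in measurable X]setTI; exact: measurable_rV_rcons.
- apply/trivIsetP => /= i j _ _ ij; rewrite -preimage_setI.
  by move/trivIsetP : tF => /(_ _ _ _ _ ij) ->//; rewrite preimage_set0.
- rewrite -preimage_bigcup -[X in measurable X]setTI.
  exact: measurable_rV_rcons.
Qed.

HB.instance Definition _ := isMeasure.Build _ _ _ lebesgue_rV_step
  step0 step_ge0 step_sigma_additive.

Let step_sigma_finite : sigma_finite setT lebesgue_rV_step.
Proof.
have /sigma_finiteP[F [TF ndF Foo]] := sigma_finiteT m.
have /sigma_finiteP[G [TG ndG Goo]] := sigma_finiteT (@lebesgue_measure R).
exists (fun k => @rV_unrcons n @^-1` (F k `*` G k)).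
  rewrite -preimage_bigcup (_ : \bigcup_k _ = setT) ?preimage_setT//.
  rewrite -subTset => -[x y] _.
  have [i _ Fx] : (\bigcup_i F i) x by rewrite -TF.
  have [j _ Gy] : (\bigcup_i G i) y by rewrite -TG.
  exists (maxn i j) => //; split.
    by move: x Fx; exact/subsetPset/ndF/leq_maxl.
  by move: y Gy; exact/subsetPset/ndG/leq_maxr.
move=> k; have [mF Fk] := Foo k; have [mG Gk] := Goo k; split.
  rewrite -[X in measurable X]setTI; apply: measurable_rV_unrcons => //.
  exact: measurableX.
rewrite /lebesgue_rV_step /pushforward -comp_preimage.
rewrite (_ : _ \o _ = id); last by rewrite funeqE => p /=; rewrite rV_rconsK.
by rewrite preimage_id product_measure1E// lte_mul_pinfty// ge0_fin_numE.
Qed.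

HB.instance Definition _ := Measure_isSigmaFinite.Build _ _ _ lebesgue_rV_step
  step_sigma_finite.

End step.

(* Lebesgue measure on R^n: the n-fold product of the one-dimensional one,
   transported along R^n x R -> R^(n+1). *)
Fixpoint lebesgue_rV n : {sigma_finite_measure set 'rV[R]_n -> \bar R} :=
  match n with
  | 0 => \d_(0 : 'rV[R]_0)
  | n'.+1 => lebesgue_rV_step (lebesgue_rV n')
  end.
End lebesgue_rV.

Section sobolev.
Context (R : realType) (n : nat).
Local Notation mu := (lebesgue_rV R n).
Implicit Types (D : set 'rV[R]_n) (u g phi : 'rV[R]_n -> R) (i : 'I_n).

Definition unit_rV i : 'rV[R]_n := delta_mx ord0 i.

Definition inL2 D u : Prop := u \_ D \in Lfun mu 2%:E.

Definition L2norme D u : \bar R := 'N[mu]_2%:E [EFin \o (u \_ D)].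

Definition L2norm D u : R := fine (L2norme D u).

Definition pderiv i phi : 'rV[R]_n -> R := fun x => 'D_(unit_rV i) phi x.

Fixpoint Ck (k : nat) phi : Prop :=
  continuous phi /\
  if k is k'.+1 then
    forall i, (forall x, derivable phi x (unit_rV i)) /\ Ck k' (pderiv i phi)
  else True.

Definition smooth phi : Prop := forall k, Ck k phi.

Definition test_fun D phi : Prop :=
  smooth phi /\
  exists K, [/\ compact K, K `<=` D & forall x, ~ K x -> phi x = 0].

Definition is_wderiv D i u g : Prop :=
  inL2 D g /\
  forall phi, test_fun D phi ->
    \int[mu]_(x in D) (u x * pderiv i phi x) =
    - \int[mu]_(x in D) (g x * phi x).

(* The weak partial derivative is only determined up to a null set: one
   representative is chosen, and the value is [cst 0] when [u] has no weak
   derivative in L^2(D). *)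
Definition wderiv D i u : 'rV[R]_n -> R := xget (cst 0) (is_wderiv D i u).

(* Anisotropic Sobolev space: only the derivatives in the directions of [S]
   are required.  [S := setT] gives H^1(D). *)
Definition sobolev D (S : set 'I_n) u : Prop :=
  inL2 D u /\ forall i, S i -> exists g, is_wderiv D i u g.

(* "u = 0 on Gamma", for a part [Gamma] of the boundary of [D] and
   [u \in sobolev D S]: [u] is the limit, in the norm of [sobolev D S], of
   smooth functions vanishing near [Gamma]. The L^2 norms are kept in
   [\bar R], so that convergence to [0] entails finiteness. *)
Definition zero_on D (S : set 'I_n) (Gamma : set 'rV[R]_n) u : Prop :=
  exists phi : nat -> 'rV[R]_n -> R,
    [/\ forall k, smooth (phi k),
        forall k, exists U, [/\ open U, Gamma `<=` U &
                                forall x, U x -> phi k x = 0],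
        (fun k => L2norme D (phi k \- u)) @ \oo --> 0%E &
        forall i, S i ->
          (fun k => L2norme D (pderiv i (phi k) \- wderiv D i u)) @ \oo
            --> 0%E].

Definition boundary D : set 'rV[R]_n := closure D `\` interior D.

Definition H10 D u : Prop := sobolev D setT u /\ zero_on D setT (boundary D) u.

Definition L2normv m D (y : 'rV[R]_n -> 'rV[R]_m) : R :=
  Num.sqrt (\sum_(i < m) L2norm D (fun x => y x ord0 i) ^+ 2).

Definition grad D u : 'rV[R]_n -> 'rV[R]_n := fun x => \row_i wderiv D i u x.

Definition dot (x y : 'rV[R]_n) : R := \sum_(i < n) x ord0 i * y ord0 i.

(* Near each boundary point, after a choice of "vertical" unit direction [nu],
   the domain is the strict epigraph of a Lipschitz function of the component
   orthogonal to [nu]. *)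
Definition lipschitz_domain D : Prop :=
  [/\ open D, D !=set0, connected D, bounded_set D &
      forall x, boundary D x ->
        exists (nu : 'rV[R]_n) (g : 'rV[R]_n -> R) (L r : R),
          [/\ dot nu nu = 1, 0 < r,
              forall a b, `|g a - g b| <= L * `|a - b| &
              forall z, `|z - x| < r ->
                (D z <-> g (z - dot z nu *: nu) < dot z nu)]].

End sobolev.

Section spacetime.
Context (R : realType) (d : nat).
Local Notation mu := (lebesgue_rV R d.+1).
Implicit Types (Omega : set 'rV[R]_d) (T : R) (u v w f g : 'rV[R]_d.+1 -> R).
Implicit Types (y : 'rV[R]_d.+1 -> 'rV[R]_d).

(* Space-time points are the vectors of R^(d+1); the last coordinate is time. *)
Definition spacetime (A : set 'rV[R]_d) (I : set R) : set 'rV[R]_d.+1 :=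
  @rV_unrcons R d @^-1` (A `*` I).

Definition cylinder Omega T := spacetime Omega `]0, T[.
Definition lateral Omega T := spacetime (boundary Omega) `]0, T[.
Definition bottom Omega := spacetime Omega [set 0].

Definition xdir (i : 'I_d) : 'I_d.+1 := lift ord_max i.
Definition tdir : 'I_d.+1 := ord_max.

Definition dt Omega T u : 'rV[R]_d.+1 -> R := wderiv (cylinder Omega T) tdir u.

Definition gradx Omega T u : 'rV[R]_d.+1 -> 'rV[R]_d :=
  fun z => \row_i wderiv (cylinder Omega T) (xdir i) u z.

Definition is_divx Omega T y g : Prop :=
  let Q := cylinder Omega T in
  inL2 Q g /\
  forall phi, test_fun Q phi ->
    \int[mu]_(z in Q) (\sum_(i < d) y z ord0 i * pderiv (xdir i) phi z) =
    - \int[mu]_(z in Q) (g z * phi z).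

Definition divx Omega T y : 'rV[R]_d.+1 -> R :=
  xget (cst 0) (is_divx Omega T y).

Definition lapx Omega T u : 'rV[R]_d.+1 -> R := divx Omega T (gradx Omega T u).

Definition in_Hdivx Omega T y : Prop :=
  (forall i, inL2 (cylinder Omega T) (fun z => y z ord0 i)) /\
  exists g, is_divx Omega T y g.

Definition in_H10Q Omega T u : Prop :=
  let Q := cylinder Omega T in
  sobolev Q setT u /\ zero_on Q setT (lateral Omega T) u.

Definition in_V Omega T u : Prop :=
  [/\ in_H10Q Omega T u,
      exists g, is_divx Omega T (gradx Omega T u) g &
      zero_on (cylinder Omega T) setT (bottom Omega) u].

Definition heat_solution Omega T f u : Prop :=
  in_V Omega T u /\
  {ae mu, forall z, cylinder Omega T z ->
     dt Omega T u z - lapx Omega T u z = f z}.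

(* The boundary condition is understood in the norm of the space at hand, which
   involves no time derivative. *)
Definition friedrichs Omega T (C : R) : Prop :=
  let Q := cylinder Omega T in
  forall w, sobolev Q (range xdir) w ->
    zero_on Q (range xdir) (lateral Omega T) w ->
    L2norm Q w <= C * L2normv Q (gradx Omega T w).

(* [W] is the representative of [w] that is continuous on [0, T] with values in
   H^1_0(Omega); the restrictions of [w] and of its spatial gradient to
   Omega x {t} are [W t] and [grad Omega (W t)]. *)
Definition H10_continuous_rep Omega T w (W : R -> 'rV[R]_d -> R) : Prop :=
  [/\ forall t, t \in `[0, T] -> H10 Omega (W t),
      forall s, s \in `[0, T] ->
        (fun t => L2norme Omega (W t \- W s)) @ within `[0, T] (nbhs s)
          --> 0%E /\
        (forall i, (fun t => L2norme Omega
                      (wderiv Omega i (W t) \- wderiv Omega i (W s)))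
                   @ within `[0, T] (nbhs s) --> 0%E) &
      {ae @lebesgue_measure R, forall t, t \in `]0, T[ ->
        {ae lebesgue_rV R d, forall x, Omega x ->
           W t x = w (rV_rcons (x, t))}}].

End spacetime.

Definition majorant (R : realType) (CF delta nd ndiv neq a1 a2 : R) : R :=
  (1 + a1) * nd ^+ 2 + (1 + a1^-1) * CF ^+ 2 * neq ^+ 2 +
  delta * ((1 + a2) * ndiv ^+ 2 + (1 + a2^-1) * neq ^+ 2).

(* Main.v *)
Require Import Defs.
From HB Require Import structures.
From mathcomp Require Import all_boot all_order all_algebra.
From mathcomp Require Import all_classical all_reals all_analysis.
From mathcomp Require Import measurable_realfun.
From mathcomp Require Import ring lra.
Import Order.TTheory GRing.Theory Num.Theory numFieldNormedType.Exports.
Local Open Scope classical_set_scope.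
Local Open Scope ring_scope.

Set Implicit Arguments.
Unset Strict Implicit.
Unset Printing Implicit Defensive.

(** Let [e = u - v], let [l] be the difference of the two Laplacians, and let
    [E T] be the final value of the error.  Subtracting the two problems gives
    [dt e - l = r_eq - div r_d] almost everywhere in [Q].  Testing this with [e]
    and with [dt e], and writing the products of [l] and [div r_d] with [e] as
    products of gradients, gives the two energy identities

    <dt e, e> + |grad e|^2 = <r_eq, e> + <r_d, grad e>,
    |dt e|^2 - <l, dt e> = <r_eq, dt e> - <div r_d, dt e>.

    Once it is known that

    |E T|^2 / 2 <= <dt e, e>   and   |grad (E T)|^2 / 2 <= - <l, dt e>,

    the majorant is the first identity plus [delta] times the second, estimated by
    the inequalities of Cauchy-Schwarz, Friedrichs and Young
    ([majorant_of_energies]).  As a function of one weight it has the form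
    [c + k (a A^2 + B^2 / a)], with its minimum at [a = B / A]
    ([balanced_weight_minimal]).

    The two trace inequalities carry the difficulty: [dt e] has no spatial
    gradient in L^2, so that the second one cannot be obtained by differentiating
    [|grad e|^2] in time.  Instead [dt e] is replaced by the backward difference
    quotient [dq h e], in which [e] is extended by zero to negative times.

    - [dq h e] tends to [dt e] in L^2(Q), because [e] is a limit of smooth
      functions that vanish at time 0 and [dq h] is bounded by the time derivative
      on such functions ([dq_norm_le], [diffquot_cvg]).
    - Translation in time commutes with spatial derivatives and keeps the lateral
      boundary condition, so that [- <l, dq h e>] is the sum of the
      [<e_i, dq h e_i>] over the spatial derivatives [e_i] ([ibp_dq]).
    - From [a (a - b) >= (a^2 - b^2) / 2], [<w, dq h w>] is at least [1 / (2 h)]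
      times the integral of [w^2] over the last [h] units of time, hence at least
      [1 / h] times the integral of [w phi] there, minus [|phi|^2 / 2], for every
      continuous [phi] of the space variables ([dq_energy_ge]).
    - These averages of [e phi] tend to [<E T, phi>], by continuity of [E] at [T]
      ([trace_avg]); for [w = e_i] the derivative is first moved to [phi]
      ([grad_trace]).  It remains to let [phi] tend to [E T] or to its derivatives
      ([energy_trace], [energy_grad_trace]).

    Two tools rest on explicit smooth functions made from exp(-1/x).  The
    fundamental lemma of the calculus of variations makes weak derivatives unique,
    so that the derivatives of [e] are the differences of those of [u] and [v].
    The defining identity of the weak divergence, known for test functions with
    compact support in [Q], extends to smooth functions that vanish only near the
    lateral boundary, on any time interval ([ibp_strip]). *)

(** * Functions of class C^k *)

Section Ck_calculus.
Context (R : realType) (n : nat).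
Implicit Types (f g : 'rV[R]_n -> R) (i : 'I_n).

Lemma Ck_cont k f : Ck k f -> continuous f.
Proof. by case: k => [|k] []. Qed.

Lemma CkS k f : Ck k.+1 f ->
  forall i, (forall x, derivable f x (unit_rV R i)) /\ Ck k (pderiv i f).
Proof. by case. Qed.

Lemma Ck_le k f : Ck k.+1 f -> Ck k f.
Proof.
elim: k f => [|k IH] f; first by case.
by move=> [cf df]; split => // i; have [? /IH] := df i.
Qed.

Lemma pderivD f g i : (forall x, derivable f x (unit_rV R i)) ->
  (forall x, derivable g x (unit_rV R i)) ->
  pderiv i (f + g) = pderiv i f + pderiv i g.
Proof. by move=> df dg; apply/funext => x; rewrite /pderiv deriveD. Qed.

Lemma pderivB f g i : (forall x, derivable f x (unit_rV R i)) ->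
  (forall x, derivable g x (unit_rV R i)) ->
  pderiv i (f - g) = pderiv i f - pderiv i g.
Proof. by move=> df dg; apply/funext => x; rewrite /pderiv deriveB. Qed.

Lemma pderivM f g i : (forall x, derivable f x (unit_rV R i)) ->
  (forall x, derivable g x (unit_rV R i)) ->
  pderiv i (f * g) = f * pderiv i g + g * pderiv i f.
Proof. by move=> df dg; apply/funext => x; rewrite /pderiv deriveM. Qed.

Lemma pderivV f i : (forall x, f x != 0) ->
  (forall x, derivable f x (unit_rV R i)) ->
  pderiv i (fun x => (f x)^-1) =
  - (pderiv i f * ((fun x => (f x)^-1) * (fun x => (f x)^-1))).
Proof.
move=> f0 df; apply/funext => x; rewrite /pderiv deriveV//=.
by rewrite /GRing.scale/= mulNr mulrC expr2 invfM.
Qed.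

Lemma Ck_cst k (c : R) : Ck k (cst c : 'rV[R]_n -> R).
Proof.
elim: k c => [|k IH] c; first by split => //; exact: cst_continuous.
split; first exact: cst_continuous.
move=> i; split; first by move=> x; exact: derivable_cst.
rewrite (_ : pderiv i _ = cst 0)//.
by apply/funext => x; rewrite /pderiv derive_cst.
Qed.

Lemma CkD k f g : Ck k f -> Ck k g -> Ck k (f + g).
Proof.
elim: k f g => [|k IH] f g Cf Cg.
  by split => // x; apply: continuousD; [exact: (Ck_cont Cf)|exact: (Ck_cont Cg)].
split; first by move=> x; apply: continuousD; [exact: (Ck_cont Cf)|exact: (Ck_cont Cg)].
move=> i; have [df /IH Cdf] := CkS Cf i; have [dg Cdg] := CkS Cg i.
split; first by move=> x; exact: derivableD.
by rewrite pderivD//; exact: Cdf.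
Qed.

Lemma CkM k f g : Ck k f -> Ck k g -> Ck k (f * g).
Proof.
elim: k f g => [|k IH] f g Cf Cg.
  by split => // x; apply: continuousM; [exact: (Ck_cont Cf)|exact: (Ck_cont Cg)].
split; first by move=> x; apply: continuousM; [exact: (Ck_cont Cf)|exact: (Ck_cont Cg)].
move=> i; have [df Cdf] := CkS Cf i; have [dg Cdg] := CkS Cg i.
split; first by move=> x; exact: derivableM.
by rewrite pderivM//; apply: CkD; apply: IH => //; exact: Ck_le.
Qed.

Lemma CkN k f : Ck k f -> Ck k (- f).
Proof.
move=> Cf; rewrite (_ : - f = cst (-1) * f); first exact: CkM (Ck_cst _ _) Cf.
by apply/funext => x; rewrite !fctE mulN1r.
Qed.

Lemma CkB k f g : Ck k f -> Ck k g -> Ck k (f - g).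
Proof. by move=> Cf /CkN; exact: CkD. Qed.

Lemma CkV k f : (forall x, f x != 0) -> Ck k f -> Ck k (fun x => (f x)^-1).
Proof.
move=> f0; elim: k => [|k IH] Cf.
  by split => // x; apply: continuousV => //; exact: (Ck_cont Cf).
split; first by move=> x; apply: continuousV => //; exact: (Ck_cont Cf).
move=> i; have [df Cdf] := CkS Cf i.
split; first by move=> x; exact: derivableV.
by rewrite pderivV//; apply/CkN/CkM => //; apply: CkM; apply/IH/Ck_le.
Qed.

Lemma Ck_prod (J : Type) (s : seq J) (P : pred J) k (F : J -> 'rV[R]_n -> R) :
  (forall j, Ck k (F j)) -> Ck k (\prod_(i <- s | P i) F i).
Proof.
move=> CF; elim/big_ind : _ => //; last by move=> f g; exact: CkM.
exact: (@Ck_cst k 1).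
Qed.

Lemma near_eq_continuous f g (x : 'rV[R]_n) :
  (\forall z \near x, f z = g z) -> {for x, continuous g} ->
  {for x, continuous f}.
Proof.
move=> fg cg; rewrite /prop_for /continuous_at (nbhs_singleton fg).
apply: (cvg_trans (@near_eq_cvg _ _ (nbhs x) _ g f _)) cg.
by apply: filterS fg => z ->.
Qed.

(** Extensions by zero are defined by cases; near each point only one case occurs,
    and that suffices for smoothness. *)
Lemma Ck_local k f :
  (forall x : 'rV[R]_n, exists g, Ck k g /\ \forall z \near x, f z = g z) ->
  Ck k f.
Proof.
move=> H; have cf : continuous f.
  move=> x; have [g [Cg fg]] := H x.
  exact: near_eq_continuous fg (Ck_cont Cg (x := x)).
elim: k f H cf => [|k IH] f H cf; first by [].
split=> // i; split.
  move=> x; have [g [Cg fg]] := H x.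
  apply: (near_eq_derivable (f := g)); first by apply: filterS fg => z ->.
  exact: (CkS Cg i).1.
have Hp (x : 'rV[R]_n) :
    exists g, Ck k g /\ \forall z \near x, pderiv i f z = g z.
  have [g [Cg fg]] := H x; exists (pderiv i g); split; first exact: (CkS Cg i).2.
  have {}fg := near_join fg.
  by apply: filterS fg => z fg; exact: near_eq_derive.
apply: IH => // x; have [g [Cg fg]] := Hp x.
exact: near_eq_continuous fg (Ck_cont Cg (x := x)).
Qed.

Lemma smooth_cont f : smooth f -> continuous f.
Proof. by move/(_ 0); exact: Ck_cont. Qed.

Lemma smooth_derivable f i x : smooth f -> derivable f x (unit_rV R i).
Proof. by move/(_ 1) => /CkS /(_ i)[]. Qed.

Lemma smooth_pderiv f i : smooth f -> smooth (pderiv i f).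
Proof. by move=> + k => /(_ k.+1) /CkS /(_ i)[]. Qed.

Lemma smoothB f g : smooth f -> smooth g -> smooth (f - g).
Proof. by move=> sf sg k; exact: CkB. Qed.

Lemma smoothM f g : smooth f -> smooth g -> smooth (f * g).
Proof. by move=> sf sg k; exact: CkM. Qed.

End Ck_calculus.

(** * Affine changes of variables and bump functions *)

Section derive_comp_affine.
Context (R : realType) (V W : normedModType R) (L : V -> W) (f : W -> R).
Variables (z v : V) (w : W).
Hypothesis HL : forall h : R, L (h *: v + z) = h *: w + L z.

(** A directional derivative only sees a line.  If [L] maps the line through [z]
    in the direction [v] affinely to a line in the direction [w], the two difference
    quotients are the same function, and no chain rule is needed; [w = 0] is
    allowed. *)
Lemma derivable_comp_affine : derivable f (L z) w -> derivable (f \o L) z v.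
Proof.
rewrite /derivable; set F := fun h => _; set G := fun h => _.
suff -> : G = F by [].
by apply/funext => h; rewrite /G /F /= /shift/= HL.
Qed.

Lemma derive_comp_affine : 'D_v (f \o L) z = 'D_w f (L z).
Proof.
rewrite /derive; set F := fun h => _; set G := fun h => _.
suff -> : G = F by [].
by apply/funext => h; rewrite /G /F /= /shift/= HL.
Qed.

End derive_comp_affine.
Arguments derive_comp_affine {R V W L f z v w} HL.
Arguments derivable_comp_affine {R V W L f z v w} HL.

Section bump.
Context (R : realType).
Implicit Types (k m : nat) (x : R).

(** The functions x^-k exp(-1/x) extended by zero, for all [k] together: the
    derivative of one of them is a linear combination of two others, so that
    smoothness follows by induction. *)
Definition expinv k x : R := if 0 < x then x^-1 ^+ k * expR (- x^-1) else 0.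

Lemma expinv_ge0 k x : 0 <= expinv k x.
Proof.
rewrite /expinv; case: ifP => // x0.
by rewrite mulr_ge0 ?expR_ge0// exprn_ge0// invr_ge0 ltW.
Qed.

Lemma expinv_gt0 k x : 0 < x -> 0 < expinv k x.
Proof. by move=> x0; rewrite /expinv x0 mulr_gt0 ?expR_gt0// exprn_gt0// invr_gt0. Qed.

Lemma expinv_le0 k x : x <= 0 -> expinv k x = 0.
Proof. by move=> x0; rewrite /expinv ltNge x0. Qed.

(** Compare with the term of order [k + 2] in the series of exp(1/x).  The factor
    [x ^+ 2] is what makes the derivative at 0 vanish. *)
Lemma expinv_le k x : expinv k x <= (k.+2)`!%:R * x ^+ 2.
Proof.
rewrite /expinv; case: ifP => [x0|_]; last by rewrite mulr_ge0 ?sqr_ge0.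
have k0 : (0 : R) < (k.+2)`!%:R by rewrite ltr0n fact_gt0.
have H : x^-1 ^+ k.+2 / (k.+2)`!%:R <= expR (x^-1).
  apply: le_trans (expR_ge1Dxn k.+1 _); first by rewrite lerDr.
  by rewrite invr_ge0 ltW.
have -> : (k.+2)`!%:R * x ^+ 2 = x^-1 ^+ k / (x^-1 ^+ k.+2 / (k.+2)`!%:R).
  have := lt0r_neq0 (exprn_gt0 k x0); have := lt0r_neq0 k0.
  rewrite (_ : x^-1 ^+ k.+2 = (x ^+ k)^-1 * x^-1 ^+ 2); last first.
    by rewrite -exprVn -exprD addn2.
  rewrite exprVn.
  move: (_%:R) (x ^+ k) => a X a0 X0; have xn0 := lt0r_neq0 x0.
  by field; rewrite a0 X0 xn0.
apply: ler_wpM2l; first by rewrite exprn_ge0// invr_ge0 ltW.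
rewrite expRN lef_pV2 ?posrE ?expR_gt0//.
by rewrite divr_gt0// exprn_gt0// invr_gt0.
Qed.

Lemma is_derive_expinv k x :
  is_derive x 1 (expinv k) (expinv k.+2 x - k%:R * expinv k.+1 x).
Proof.
have [x0|x0|->] := ltgtP x 0.
- rewrite !expinv_le0 ?(ltW x0)// mulr0 subr0.
  apply: (@near_eq_is_derive _ _ _ (cst 0)).
  near=> y; rewrite expinv_le0//; apply: ltW; near: y.
  by apply: open_nbhs_nbhs; split; [exact: open_lt|].
- have xn0 : x != 0 by rewrite gt_eqF.
  suff : is_derive x 1 (fun y : R => y^-1 ^+ k * expR (- y^-1))
                       (expinv k.+2 x - k%:R * expinv k.+1 x).
    apply: near_eq_is_derive.
    near=> y; rewrite /expinv ifT//; near: y.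
    by apply: open_nbhs_nbhs; split; [exact: open_gt|].
  rewrite /expinv x0.
  have dV : is_derive x 1 (fun y : R => y^-1) (- x^-1 ^+ 2).
    apply: DeriveDef; first exact: derivableV.
    by rewrite deriveV// derive_id /GRing.scale/= mulr1 exprVn.
  have dE : is_derive x 1 (fun y : R => expR (- y^-1)) (expR (- x^-1) * x^-1 ^+ 2).
    apply: (is_derive_eq (@is_derive1_comp _ expR (fun y => - y^-1) _ _ _ _ (is_deriveN dV))).
    by rewrite opprK.
  have dX := is_deriveX k dV.
  rewrite (_ : (fun y => _) =
      (fun y : R => y^-1) ^+ k * (fun y => expR (- y^-1))); last first.
    by apply/funext => y; rewrite mulrfctE exprfctE.
  apply: (is_derive_eq (is_deriveM dX dE)).
  rewrite exprfctE /GRing.scale/= {dX}; move: (expR _) => E.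
  case: k => [|k]; first by rewrite !expr0 /=; ring.
  by rewrite !exprS /=; move: (x^-1 ^+ k) => X; ring.
- rewrite !expinv_le0// mulr0 subr0.
  have Hcvg : h^-1 *: ((expinv k \o shift 0) (h *: 1) - expinv k 0) @[h --> 0^'] --> (0 : R).
    apply/cvgr0Pnorm_le => e e0.
    set C : R := (k.+2)`!%:R.
    have C0 : 0 < C by rewrite ltr0n fact_gt0.
    near=> h; rewrite /= (expinv_le0 _ (lexx 0)) subr0 /shift/= addr0.
    rewrite /GRing.scale/= mulr1 normrM normfV.
    have h0 : 0 < `|h| by rewrite normr_gt0; near: h; exact: nbhs_dnbhs_neq.
    rewrite ler_pdivrMl// ger0_norm ?expinv_ge0//.
    apply: le_trans (expinv_le _ _) _.
    rewrite -real_normK ?num_real// expr2 mulrA -[leRHS]mulrC ler_pM2r//.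
    rewrite -ler_pdivlMl//.
    near: h; apply: dnbhs0_le; rewrite mulr_gt0// invr_gt0//.
  by apply: DeriveDef; [exact: (cvgP _ Hcvg)|exact: (cvg_lim _ Hcvg)].
Unshelve. all: by end_near. Qed.

End bump.

Section Ck_affine.
Context (R : realType).

Lemma pderiv_comp m n (L : 'rV[R]_m -> 'rV[R]_n) (f : 'rV[R]_n -> R) j i :
  (forall (h : R) z, L (h *: unit_rV R j + z) = h *: unit_rV R i + L z) ->
  pderiv j (f \o L) = pderiv i f \o L.
Proof. by move=> HL; apply/funext => z; rewrite /pderiv (derive_comp_affine (w := unit_rV R i)). Qed.

Lemma pderiv_comp0 m n (L : 'rV[R]_m -> 'rV[R]_n) (f : 'rV[R]_n -> R) j :
  (forall (h : R) z, L (h *: unit_rV R j + z) = L z) ->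
  pderiv j (f \o L) = cst 0.
Proof.
move=> HL; apply/funext => z; rewrite /pderiv (derive_comp_affine (w := 0)) ?derive0//.
by move=> h; rewrite HL scaler0 add0r.
Qed.

(** The hypothesis says that each coordinate direction is mapped to a coordinate
    direction or collapsed, which covers translations and coordinate projections. *)
Lemma Ck_comp m n (L : 'rV[R]_m -> 'rV[R]_n) (f : 'rV[R]_n -> R) k :
  continuous L ->
  (forall j, (exists i, forall (h : R) z,
                L (h *: unit_rV R j + z) = h *: unit_rV R i + L z) \/
             forall (h : R) z, L (h *: unit_rV R j + z) = L z) ->
  Ck k f -> Ck k (f \o L).
Proof.
move=> cL HL; elim: k f => [|k IH] f Cf.
  by split => // x; apply: continuous_comp; [exact: cL|exact: (Ck_cont Cf)].
split; first by move=> x; apply: continuous_comp; [exact: cL|exact: (Ck_cont Cf)].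
move=> j; case: (HL j) => [[i Hi]|H0].
- have [df Cdf] := CkS Cf i; split; last by rewrite (pderiv_comp _ Hi); exact: IH.
  by move=> x; apply: (derivable_comp_affine (w := unit_rV R i)).
- split; last by rewrite (pderiv_comp0 _ H0); exact: Ck_cst.
  move=> x; apply: (derivable_comp_affine (w := 0)); last exact: derivable0.
  by move=> h; rewrite H0 scaler0 add0r.
Qed.

Lemma continuous_rowP m n (L : 'rV[R]_m -> 'rV[R]_n) :
  (forall i, continuous (fun z => L z ord0 i)) -> continuous L.
Proof.
move=> cL z; apply/(@cvgrPdist_lt _ _ _ (nbhs z) (nbhs_filter z)) => e e0.
have : \forall y \near z, forall i, `|L z ord0 i - L y ord0 i| < e.
  apply: (@filter_forall _ _ _ (nbhs z) (nbhs_filter z)) => i.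
  by have /(@cvgrPdist_lt _ _ _ (nbhs z) (nbhs_filter z)) := cL i z; exact.
apply: filterS => y Hy; rewrite [ltLHS]mx_normrE.
by apply/bigmax_ltP; split => // -[i j] _ /=; rewrite ord1 !mxE.
Qed.

Lemma is_derive_scale (f : R -> R) (x c df : R) :
  is_derive x 1 f df -> is_derive x c f (c * df).
Proof.
move=> H; have /derivable1_diffP dfx : derivable f x 1 by [].
apply: DeriveDef; first exact/diff_derivable.
by rewrite deriveE// -[in 'd f x c](mulr1 c) [c * 1]/(c *: 1) linearZ/= -deriveE// derive_val.
Qed.

Lemma Ck_expinv_coord n k p (i : 'I_n) (s c : R) :
  Ck k (fun z : 'rV[R]_n => expinv p (s * z ord0 i + c)).
Proof.
have HL j (z : 'rV[R]_n) (h : R) : s * (h *: unit_rV R j + z) ord0 i + c =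
    h *: (s * (j == i)%:R) + (s * z ord0 i + c).
  by rewrite !mxE /= /GRing.scale/= eq_sym; ring.
have Hd q j z : is_derive z (unit_rV R j) (fun z : 'rV[R]_n => expinv q (s * z ord0 i + c))
   (s * (j == i)%:R * (expinv q.+2 (s * z ord0 i + c) - q%:R * expinv q.+1 (s * z ord0 i + c))).
  have H := is_derive_scale (s * (j == i)%:R) (is_derive_expinv q (s * z ord0 i + c)).
  apply: DeriveDef.
    exact: (derivable_comp_affine (f := expinv q)
      (L := fun z : 'rV[R]_n => s * z ord0 i + c) (HL j z) (ex_derive (is_derive := H))).
  rewrite (derive_comp_affine
    (L := fun z : 'rV[R]_n => s * z ord0 i + c) (f := expinv q) (HL j z)).
  by rewrite derive_val.
have cont q : continuous (fun z : 'rV[R]_n => expinv q (s * z ord0 i + c)).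
  move=> z; apply: (@continuous_comp _ _ _ (fun z : 'rV[R]_n => s * z ord0 i + c) (expinv q)).
    apply: continuousD; last exact: cst_continuous.
    by apply: continuousM; [exact: cst_continuous|exact: coord_continuous].
  apply: differentiable_continuous; apply/derivable1_diffP.
  by have := is_derive_expinv q (s * z ord0 i + c).
elim: k p => [|k IH] p; first by split.
split => // j; split; first by move=> x; exact: ex_derive.
rewrite (_ : pderiv j _ = cst (s * (j == i)%:R) *
    ((fun z : 'rV[R]_n => expinv p.+2 (s * z ord0 i + c)) -
     cst p%:R * (fun z : 'rV[R]_n => expinv p.+1 (s * z ord0 i + c)))); last first.
  by apply/funext => z; rewrite /pderiv derive_val.
apply: CkM; first exact: Ck_cst.
by apply: CkB => //; apply: CkM => //; exact: Ck_cst.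
Qed.

(** For [b >= 0] these functions vanish where [b] does and increase with [m] to 1
    elsewhere: a smooth approximation, from inside, of the indicator function of an
    open set. *)
Definition cutoff n (b : 'rV[R]_n -> R) (m : nat) (z : 'rV[R]_n) : R :=
  1 - (1 + m%:R * b z)^-1.

Section cutoff.
Context (n : nat) (b : 'rV[R]_n -> R).
Hypothesis b0 : forall z, 0 <= b z.

Let den_gt0 m z : 0 < 1 + m%:R * b z.
Proof. by rewrite ltr_pwDl// mulr_ge0. Qed.

Lemma smooth_cutoff m : smooth b -> smooth (cutoff b m).
Proof.
move=> sb k; rewrite (_ : cutoff b m = cst 1 - (fun z => ((cst 1 + cst m%:R * b) z)^-1)).
  apply: CkB; first exact: Ck_cst.
  apply: CkV; first by move=> z; rewrite gt_eqF//; exact: den_gt0.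
  by apply: CkD; [exact: Ck_cst|apply: CkM => //; exact: Ck_cst].
by apply/funext.
Qed.

Lemma cutoff_ge0 m z : 0 <= cutoff b m z.
Proof. by rewrite subr_ge0 invf_le1 ?den_gt0// lerDl mulr_ge0. Qed.

Lemma cutoff_le1 m z : cutoff b m z <= 1.
Proof. by rewrite gerBl invr_ge0 ltW ?den_gt0. Qed.

Lemma cutoff0 m z : b z = 0 -> cutoff b m z = 0.
Proof. by move=> bz; rewrite /cutoff bz mulr0 addr0 invr1 subrr. Qed.

Lemma cutoff_cvg z : 0 < b z -> cutoff b m z @[m --> \oo] --> (1 : R).
Proof.
move=> bz; rewrite -[X in _ --> X](subr0 1); apply: cvgB; first exact: cvg_cst.
apply/gtr0_cvgV0; first by apply: nearW => m; exact: den_gt0.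
apply/cvgryPge => A; near=> m.
apply: (@le_trans _ _ (m%:R * b z)); last by rewrite lerDr.
rewrite -ler_pdivrMr//; near: m; exact: nbhs_infty_ger.
Unshelve. all: by end_near. Qed.

End cutoff.
End Ck_affine.

(** * Topology and measurability of R^n *)

Section borel_rV.
Context (R : realType) (n : nat).
Implicit Types (z : 'rV[R]_n).

Lemma rV_coord_le z i : `|z ord0 i| <= `|z|.
Proof.
rewrite [leRHS]mx_normrE; apply/bigmax_geP; right => /=.
by exists (ord0, i).
Qed.

Lemma rV_norm_lt z (e : R) : 0 < e -> (forall i, `|z ord0 i| < e) -> `|z| < e.
Proof.
move=> e0 H; rewrite [ltLHS]mx_normrE; apply/bigmax_ltP; split => // -[i j] _ /=.
by rewrite ord1.
Qed.

Lemma bounded_closure (A : set 'rV[R]_n) : bounded_set A -> bounded_set (closure A).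
Proof.
move=> [N [_ /(_ (N + 1))]]; rewrite ltrDl => /(_ ltr01) HN.
exists (N + 1); split; first exact: num_real.
move=> M MN x Ax; apply: le_trans (ltW MN).
suff : closure A `<=` [set x : 'rV[R]_n | `|x| <= N + 1] by exact.
have cl : closed [set x : 'rV[R]_n | `|x| <= N + 1].
  apply: (@closed_comp _ _ (fun x : 'rV[R]_n => `|x|) [set t | t <= N + 1]).
    by move=> y _; exact: norm_continuous.
  exact: closed_le.
by rewrite ((closure_id _).1 cl); apply: closure_subset => y /HN.
Qed.

Lemma closure_open_boundary (A : set 'rV[R]_n) z : open A ->
  closure A z -> ~ A z -> boundary A z.
Proof.
by move=> oA cz nz; split => // iz; apply: nz; move: iz; rewrite (interior_id _).1.
Qed.

Lemma measurable_rectangle (A : 'I_n -> set R) :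
  (forall i, measurable (A i)) -> measurable [set z : 'rV[R]_n | forall i, A i (z ord0 i)].
Proof.
move=> mA; rewrite [X in measurable X](_ : _ = \bigcap_(i in [set: 'I_n])
   ((fun z : 'rV[R]_n => z ord0 i) @^-1` A i)); last first.
  by apply/seteqP; split => z /= H i; [move=> _|]; exact: H.
apply: fin_bigcap_measurable; first exact: finite_finset.
move=> i _; rewrite -[X in measurable X]setTI.
by apply: measurable_rV_coord => //; exact: mA.
Qed.

Definition cube (p : 'rV[rat]_n * nat) : set 'rV[R]_n :=
  [set z | forall i, `|z ord0 i - ratr (p.1 ord0 i)| < p.2.+1%:R^-1].

Lemma measurable_cube p : measurable (cube p).
Proof.
apply: (@measurable_rectangle
  (fun i => [set t | `|t - ratr (p.1 ord0 i)| < p.2.+1%:R^-1])) => i.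
rewrite (_ : mkset _ = ball (ratr (p.1 ord0 i) : R) p.2.+1%:R^-1).
  exact: measurable_ball.
by apply/seteqP; split => t /=; rewrite -ball_normE/= distrC.
Qed.

(** The closed cube, of which [cube p] is the interior, is kept inside [U]: it
    serves as the compact support of a test function. *)
Lemma open_cube (U : set 'rV[R]_n) z : open U -> U z ->
  exists p, cube p z /\
    [set y : 'rV[R]_n | forall i, `|y ord0 i - ratr (p.1 ord0 i)| <= p.2.+1%:R^-1] `<=` U.
Proof.
move=> oU Uz.
have : nbhs z U by exact: open_nbhs_nbhs.
move/nbhs_ballP => [e /= e0 eU].
have [k ke] : exists k, k.+1%:R^-1 < e / 2 :> R.
  have e20 : 0 < e / 2 by rewrite divr_gt0.
  have := near_infty_natSinv_lt (PosNum e20).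
  by move=> [k _ /(_ k (leqnn k))] H; exists k.
have k0 : 0 < k.+1%:R^-1 :> R by rewrite invr_gt0.
have H i : exists q : rat, `|z ord0 i - ratr q| < k.+1%:R^-1.
  have [|q] := @rat_in_itvoo R (z ord0 i - k.+1%:R^-1) (z ord0 i + k.+1%:R^-1).
    by rewrite ltrD2l gtrN.
  rewrite in_itv/= => /andP[q1 q2]; exists q.
  by rewrite distrC ltr_distl q1 q2.
have [c Hc] := choice H.
exists (\row_i c i, k); split; first by move=> i /=; rewrite mxE.
move=> y /= Hy; apply: eU; rewrite -ball_normE/=.
apply: rV_norm_lt => // i; rewrite !mxE.
have {Hy} := Hy i; rewrite /= mxE => Hy.
rewrite (le_lt_trans (ler_distD (ratr (c i)) _ _))//.
rewrite [ltRHS]splitr; apply: ltrD; first exact: lt_trans (Hc i) ke.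
by rewrite distrC (le_lt_trans Hy).
Qed.

(** The sigma-algebra on R^n is generated by the coordinates; it contains the open
    sets because the rational cubes form a countable base. *)
Lemma open_bigcup_cube (U : set 'rV[R]_n) : open U ->
  U = \bigcup_p (if `[< cube p `<=` U >] then cube p else set0).
Proof.
move=> oU; apply/seteqP; split => [z Uz|z [p _]]; last first.
  by case: ifP => // /asboolP; apply.
have [p [pz pU]] := open_cube oU Uz; exists p => //; rewrite ifT//.
by apply/asboolP => y Hy; apply: pU => i; exact/ltW/Hy.
Qed.

Lemma open_measurable_rV (U : set 'rV[R]_n) : open U -> measurable U.
Proof.
move=> oU; rewrite (open_bigcup_cube oU).
apply: countable_bigcupT_measurable; first exact: countableP.
by move=> p; case: ifP => // _; exact: measurable_cube.
Qed.

Lemma continuous_measurable_rV (f : 'rV[R]_n -> R) :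
  continuous f -> measurable_fun setT f.
Proof.
move=> cf; apply: (measurability _ (RGenOpens.measurableE R)).
move=> _ [_ [a [b ->] <-]]; rewrite setTI; apply: open_measurable_rV.
apply: open_comp; last exact: interval_open.
by move=> x _; exact: cf.
Qed.

End borel_rV.

(** * Lebesgue measure on R^n *)

Section measure_preserving.
Context d1 d2 (X : measurableType d1) (Y : measurableType d2) (R : realType).
Variables (phi : X -> Y) (mu : {measure set X -> \bar R})
  (nu : {measure set Y -> \bar R}).
Hypothesis mphi : measurable_fun setT phi.
Hypothesis mpres : forall A, measurable A -> mu (phi @^-1` A) = nu A.

Lemma ge0_integral_mpres D (f : Y -> \bar R) :
  measurable D -> measurable_fun D f -> (forall y, D y -> 0 <= f y)%E ->
  (\int[nu]_(y in D) f y = \int[mu]_(x in phi @^-1` D) f (phi x))%E.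
Proof.
move=> mD mf f0; rewrite -(ge0_integral_pushforward mphi)//; last first.
  by move=> y; rewrite inE => /f0.
by apply: eq_measure_integral => A mA _; exact/esym/mpres.
Qed.

Lemma integrable_mpres D (f : Y -> \bar R) : measurable D ->
  nu.-integrable D f -> mu.-integrable (phi @^-1` D) (f \o phi).
Proof.
move=> mD /integrableP[mf fi]; apply/integrableP; split.
  apply: (measurable_comp mD) => //; first by move=> _ [x Dx <-].
  exact: measurable_funTS.
rewrite -(ge0_integral_mpres (f := fun y => `|f y|%E))//.
exact: measurableT_comp.
Qed.

Lemma integral_mpres D (f : Y -> \bar R) : measurable D ->
  measurable_fun D f ->
  (\int[nu]_(y in D) f y = \int[mu]_(x in phi @^-1` D) f (phi x))%E.
Proof.
move=> mD mf; rewrite integralE [in RHS]integralE.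
congr (_ - _)%E.
  by rewrite ge0_integral_mpres//; [rewrite [in RHS](funepos_comp f phi)|exact: measurable_funepos].
by rewrite ge0_integral_mpres//; [rewrite [in RHS](funeneg_comp f phi)|exact: measurable_funeneg].
Qed.

End measure_preserving.

Section lebesgue_rV_facts.
Context (R : realType).
Local Notation mu n := (lebesgue_rV R n).
Local Notation leb := (@lebesgue_measure R).

Lemma lebesgue_rVSE n (A : set 'rV[R]_n.+1) :
  mu n.+1 A = (mu n \x leb)%E (@rV_rcons R n @^-1` A).
Proof. by []. Qed.

Lemma integral_rcons n (F : 'rV[R]_n.+1 -> \bar R) : measurable_fun setT F ->
  (\int[mu n.+1]_z F z = \int[mu n \x leb]_p F (rV_rcons p))%E.
Proof. by move=> mF; apply: (integral_mpres (@measurable_rV_rcons R n)). Qed.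

Lemma fubini_rV n (F : 'rV[R]_n.+1 -> \bar R) :
  (mu n.+1).-integrable setT F ->
  (\int[mu n.+1]_z F z = \int[leb]_t \int[mu n]_x F (rV_rcons (x, t)))%E.
Proof.
move=> iF; rewrite integral_rcons; last exact: measurable_int iF.
rewrite -integral21_prod_meas1//.
by apply: (integrable_mpres (@measurable_rV_rcons R n) _ measurableT iF).
Qed.

Lemma lebesgue_rV_box n (M : R) :
  (mu n [set z : 'rV[R]_n | forall i, (`|z ord0 i| <= M)%R] < +oo)%E.
Proof.
elim: n => [|n IH].
  rewrite (_ : mkset _ = setT) ?diracT ?ltry//.
  by apply/seteqP; split => // z _ [].
have mI k : measurable [set z : 'rV[R]_k | forall i, `|z ord0 i| <= M].
  apply: (@measurable_rectangle R k (fun=> [set t | `|t| <= M])) => _.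
  rewrite (_ : mkset _ = `[- M, M]%classic) ?measurable_itv//.
  by apply/seteqP; split => t /=; rewrite in_itv/= ler_norml.
rewrite lebesgue_rVSE (_ : _ @^-1` _ =
  [set z : 'rV[R]_n | forall i, `|z ord0 i| <= M] `*` `[- M, M]%classic).
  rewrite product_measure1E//; last exact: mI.
  rewrite lte_mul_pinfty//; first by rewrite ge0_fin_numE.
  suff : (leb (`[(- M)%R, M]%classic : set R) < +oo)%E by [].
  by rewrite lebesgue_measure_itv/=; case: ifP; rewrite ?ltry.
apply/seteqP; split => [[x t] /= H|[x t] /= [Hx Ht] i].
  split; first by move=> i; have := H (lift ord_max i); rewrite mxE liftK.
  by have := H ord_max; rewrite mxE unlift_none in_itv/= ler_norml.
rewrite mxE; case: unliftP => [j _|_]; first exact: Hx.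
by move: Ht; rewrite /= in_itv/= -ler_norml.
Qed.

Lemma bounded_lebesgue_lty n (D : set 'rV[R]_n) : measurable D ->
  bounded_set D -> (mu n D < +oo)%E.
Proof.
move=> mD [M [_ /(_ (M + 1))]]; rewrite ltrDl => /(_ ltr01) HM.
apply: (le_lt_trans _ (lebesgue_rV_box n (M + 1))).
apply: le_measure; rewrite ?inE//.
  apply: (@measurable_rectangle R n (fun=> [set t | `|t| <= M + 1])) => _.
  rewrite (_ : mkset _ = `[- (M + 1), M + 1]%classic) ?measurable_itv//.
  by apply/seteqP; split => t /=; rewrite in_itv/= ler_norml.
by move=> z /HM /= zM i; apply: le_trans zM; exact: rV_coord_le.
Qed.

Lemma lebesgue_measure_shift (c : R) (A : set (measurableTypeR R)) :
  measurable A -> leb ((fun t => t - c) @^-1` A) = leb A.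
Proof.
move=> mA; have mc : measurable_fun setT ((fun t => t - c) : measurableTypeR R -> measurableTypeR R).
  exact: measurable_funB.
have -> : leb ((fun t => t - c) @^-1` A) =
  pushforward leb (fun t => t - c : measurableTypeR R) A by [].
apply/esym/lebesgue_measure_unique => //= _ [[a b]] _ <-.
rewrite /pushforward (_ : _ @^-1` _ = `]a + c, b + c]%classic).
  rewrite !lebesgue_measure_itv/= !lte_fin ltrD2r -!EFinB.
  by congr (if _ then _%:E else _); ring.
by apply/seteqP; split => t /=; rewrite !in_itv/= ltrBrDr lerBlDr.
Qed.

(** The last coordinate is time, so that [u \o tshift c] is [u] delayed by [c]. *)
Definition tshift n (c : R) (z : 'rV[R]_n.+1) : 'rV[R]_n.+1 :=
  z - c *: unit_rV R ord_max.

Lemma tshift_rcons n c x t : tshift c (@rV_rcons R n (x, t)) = rV_rcons (x, t - c).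
Proof.
apply/rowP => i; rewrite !mxE/=; case: unliftP => [j ->|->].
  by rewrite [_ == _]eq_sym (negbTE (neq_lift _ _)) mulr0 subr0.
by rewrite eqxx mulr1.
Qed.

Lemma continuous_tshift n c : continuous (@tshift n c).
Proof.
apply: continuous_rowP => i z.
rewrite (_ : (fun _ => _) = (fun z : 'rV[R]_n.+1 => z ord0 i - (c *: unit_rV R ord_max) ord0 i)).
  by apply: continuousB; [exact: coord_continuous|exact: cst_continuous].
by apply/funext => x; rewrite !mxE.
Qed.

Lemma measurable_tshift n c : measurable_fun setT (@tshift n c).
Proof.
apply/measurable_fun_rVP => i; apply: continuous_measurable_rV => z.
apply: (@continuous_comp _ _ _ (@tshift n c) (fun z => z ord0 i)).
  exact: continuous_tshift.
exact: coord_continuous.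
Qed.

(** Translation invariance on the line, applied on the fibre over each point of the
    remaining coordinates. *)
Lemma lebesgue_rV_tshift n c (A : set 'rV[R]_n.+1) : measurable A ->
  mu n.+1 (tshift c @^-1` A) = mu n.+1 A.
Proof.
move=> mA; rewrite !lebesgue_rVSE; apply: eq_integral => x _ /=.
have mB : measurable (@rV_rcons R n @^-1` A).
  by rewrite -[X in measurable X]setTI; exact: measurable_rV_rcons.
rewrite -[RHS](lebesgue_measure_shift c); last exact: measurable_xsection.
congr (leb _); apply/seteqP; split => t /=; rewrite /xsection/= !inE/=.
  by rewrite -tshift_rcons.
by rewrite -tshift_rcons.
Qed.

End lebesgue_rV_facts.

(** * The inner product of L^2 *)

(** The discriminant argument, shared by the Cauchy-Schwarz inequalities for
    scalar functions and for vector fields. *)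
Lemma quadratic_CS (R : realFieldType) (a b c : R) : 0 <= a -> 0 <= c ->
  (forall t, 0 <= a - 2 * t * b + t ^+ 2 * c) -> b ^+ 2 <= a * c.
Proof.
move=> a0 c0 Q.
have [c_eq0|cn0] := eqVneq c 0.
  have [->|bn0] := eqVneq b 0; first by rewrite expr0n/= mulr_ge0.
  (* here the quadratic is affine in t, and takes the value -1 *)
  have := Q ((a + 1) / (2 * b)).
  rewrite c_eq0 (_ : _ + _ = -1); first by rewrite ler0N1.
  by field.
have := Q (b / c).
have -> : a - 2 * (b / c) * b + (b / c) ^+ 2 * c = (a * c - b ^+ 2) / c by field.
by rewrite pmulr_lge0 ?invr_gt0 ?lt_def ?cn0// subr_ge0.
Qed.

Section inner_product.
Context (R : realType) (n : nat).
Local Notation mu := (lebesgue_rV R n).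
Variables (D : set 'rV[R]_n) (mD : measurable D).
Implicit Types (u v w : 'rV[R]_n -> R).

Definition ip (D : set 'rV[R]_n) u v : R := \int[mu]_(x in D) (u x * v x).

Lemma L2norme_sqr u :
  (L2norme D u `^ 2 = \int[mu]_(x in D) (u x ^+ 2)%:E)%E.
Proof.
rewrite /L2norme poweR_Lnorm// [RHS]integral_mkcond; apply: eq_integral => x _.
rewrite /= /restrict patchE; case: ifP => _ /=; last by rewrite normr0 powR0.
by rewrite powR_mulrn// real_normK// num_real.
Qed.

Lemma L2norme_lty u :
  (L2norme D u < +oo)%E <-> (\int[mu]_(x in D) (u x ^+ 2)%:E < +oo)%E.
Proof.
rewrite -L2norme_sqr; split; first exact: poweR_lty.
move=> vy; rewrite ltNge; apply/negP => v_oo.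
have {}v_oo : (L2norme D u = +oo)%E by apply/eqP; rewrite -leye_eq.
by move: vy; rewrite v_oo poweRyr ?pnatr_eq0// ltxx.
Qed.

Lemma inL2P u : inL2 D u <->
  measurable_fun D u /\ mu.-integrable D (fun x => (u x ^+ 2)%:E).
Proof.
rewrite /inL2 inE/=; split.
- move=> /andP[]; rewrite !inE/= => mu' fu.
  have {}mu' : measurable_fun D u by exact/(measurable_restrictT _ mD).
  split => //; apply/integrableP; split.
    by apply/measurable_EFinP; exact: measurable_funX.
  under eq_integral do rewrite gee0_abs ?lee_fin ?sqr_ge0//.
  exact/L2norme_lty.
- move=> [mu' /integrableP[_ iu]]; apply/andP; split; rewrite !inE/=.
    exact/(measurable_restrictT _ mD).
  apply/L2norme_lty; move: iu; under eq_integral do rewrite gee0_abs ?lee_fin ?sqr_ge0//.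
  by [].
Qed.

Lemma inL2_measurable u : inL2 D u -> measurable_fun D u.
Proof. by case/inL2P. Qed.

Lemma inL2_integrable u v : inL2 D u -> inL2 D v ->
  mu.-integrable D (fun x => (u x * v x)%:E).
Proof.
move=> /inL2P[mu' iu] /inL2P[mv iv].
apply: (@le_integrable _ _ _ mu D _ _ (fun x => (u x ^+ 2)%:E + (v x ^+ 2)%:E)%E) => //.
- by apply/measurable_EFinP; exact: measurable_funM.
- move=> x Dx /=; rewrite lee_fin normrM [leRHS]ger0_norm ?addr_ge0 ?sqr_ge0//.
  rewrite -(real_normK (num_real (u x))) -(real_normK (num_real (v x))).
  have := sqr_ge0 (`|u x| - `|v x|).
  have := mulr_ge0 (normr_ge0 (u x)) (normr_ge0 (v x)); nra.
- exact: integrableD.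
Qed.

Lemma inL2Z (c : R) u : inL2 D u -> inL2 D (fun x => c * u x).
Proof.
move=> /inL2P[mu' iu]; apply/inL2P; split; first exact: measurable_funM.
rewrite (_ : (fun x => _) = (fun x => (c ^+ 2)%:E * (u x ^+ 2)%:E)%E).
  exact: integrableZl.
by apply/funext => x; rewrite exprMn.
Qed.

Lemma inL2D u v : inL2 D u -> inL2 D v -> inL2 D (fun x => u x + v x).
Proof.
move=> Lu Lv; have /inL2P[mu' iu] := Lu; have /inL2P[mv iv] := Lv.
apply/inL2P; split; first exact: measurable_funD.
rewrite (_ : (fun x => _) = (fun x => ((u x ^+ 2)%:E + (v x ^+ 2)%:E) + 2%:E * (u x * v x)%:E)%E).
  apply: integrableD => //; first exact: integrableD.
  exact/integrableZl/inL2_integrable.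
by apply/funext => x; rewrite -EFinM -!EFinD; congr EFin; ring.
Qed.

Lemma inL2B u v : inL2 D u -> inL2 D v -> inL2 D (fun x => u x - v x).
Proof.
move=> Lu Lv; rewrite (_ : (fun x => _) = (fun x => u x + (-1) * v x)).
  by apply: inL2D => //; exact: inL2Z.
by apply/funext => x; rewrite mulN1r.
Qed.

Lemma inL2_0 : inL2 D (cst 0).
Proof.
apply/inL2P; split; first exact: measurable_cst.
rewrite (_ : (fun x => _) = cst 0%E); first exact: integrable0.
by apply/funext => x; rewrite expr0n.
Qed.

Lemma inL2_sum (I : Type) (s : seq I) (F : I -> 'rV[R]_n -> R) :
  (forall i, inL2 D (F i)) -> inL2 D (fun x => \sum_(i <- s) F i x).
Proof.
move=> LF; elim: s => [|i s IH].
  rewrite (_ : (fun _ => _) = cst 0); first exact: inL2_0.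
  by apply/funext => x; rewrite big_nil.
rewrite (_ : (fun _ => _) = (fun x => F i x + \sum_(j <- s) F j x)).
  exact: inL2D.
by apply/funext => x; rewrite big_cons.
Qed.

Lemma ipC u v : ip D u v = ip D v u.
Proof. by apply: eq_Rintegral => x _; rewrite mulrC. Qed.

Lemma ipDr w u v : inL2 D w -> inL2 D u -> inL2 D v ->
  ip D w (fun x => u x + v x) = ip D w u + ip D w v.
Proof.
move=> Lw Lu Lv; rewrite /ip -RintegralD//; try exact: inL2_integrable.
by apply: eq_Rintegral => x _; rewrite mulrDr.
Qed.

Lemma ipZr w (c : R) u : inL2 D w -> inL2 D u ->
  ip D w (fun x => c * u x) = c * ip D w u.
Proof.
move=> Lw Lu; rewrite /ip -RintegralZl//; last exact: inL2_integrable.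
by apply: eq_Rintegral => x _; rewrite mulrCA.
Qed.

Lemma ipBr w u v : inL2 D w -> inL2 D u -> inL2 D v ->
  ip D w (fun x => u x - v x) = ip D w u - ip D w v.
Proof.
move=> Lw Lu Lv; rewrite /ip -RintegralB//; try exact: inL2_integrable.
by apply: eq_Rintegral => x _; rewrite mulrBr.
Qed.

Lemma ipDl w u v : inL2 D w -> inL2 D u -> inL2 D v ->
  ip D (fun x => u x + v x) w = ip D u w + ip D v w.
Proof. by move=> *; rewrite ipC ipDr// !(ipC w). Qed.

Lemma ipZl w (c : R) u : inL2 D w -> inL2 D u ->
  ip D (fun x => c * u x) w = c * ip D u w.
Proof. by move=> *; rewrite ipC ipZr// (ipC w). Qed.

Lemma ipBl w u v : inL2 D w -> inL2 D u -> inL2 D v ->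
  ip D (fun x => u x - v x) w = ip D u w - ip D v w.
Proof. by move=> *; rewrite ipC ipBr// !(ipC w). Qed.

Lemma ip_ge0 u : 0 <= ip D u u.
Proof. by apply: Rintegral_ge0 => x _; rewrite -expr2 sqr_ge0. Qed.

Lemma L2norm_ge0 u : 0 <= L2norm D u.
Proof. by rewrite fine_ge0// Lnorm_ge0. Qed.

Lemma L2norm_sqr u : inL2 D u -> L2norm D u ^+ 2 = ip D u u.
Proof.
move=> /inL2P[mu' iu]; have H := L2norme_sqr u.
have uy : (L2norme D u < +oo)%E.
  apply/L2norme_lty; have /integrableP[_] := iu.
  by under eq_integral do rewrite gee0_abs ?lee_fin ?sqr_ge0//.
have u0 : (0 <= L2norme D u)%E by exact: Lnorm_ge0.
have fu : L2norme D u \is a fin_num by rewrite ge0_fin_numE.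
rewrite /ip /Rintegral; under eq_integral do rewrite -expr2.
rewrite -H /L2norm -(fineK fu) /= powR_mulrn//.
exact: fine_ge0.
Qed.

Lemma L2normE u : inL2 D u -> L2norm D u = Num.sqrt (ip D u u).
Proof. by move=> /L2norm_sqr <-; rewrite sqrtr_sqr ger0_norm// L2norm_ge0. Qed.

Lemma ip_CS u v : inL2 D u -> inL2 D v -> `|ip D u v| <= L2norm D u * L2norm D v.
Proof.
move=> Lu Lv; have Q (t : R) : 0 <= ip D u u - 2 * t * ip D u v + t ^+ 2 * ip D v v.
  have := ip_ge0 (fun x => u x - t * v x).
  have Ltv := inL2Z t Lv; have LB := inL2B Lu Ltv.
  by rewrite ipBl// !ipBr// !ipZl// ?ipZr// (ipC v u) => H; apply: le_trans H _; lra.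
have : ip D u v ^+ 2 <= (L2norm D u * L2norm D v) ^+ 2.
  rewrite exprMn !L2norm_sqr//; apply: quadratic_CS => //; exact: ip_ge0.
rewrite -[X in X <= _ -> _]real_normK ?num_real//.
by rewrite ler_pXn2r ?nnegrE ?mulr_ge0 ?L2norm_ge0.
Qed.

Lemma L2norm_triangle u v : inL2 D u -> inL2 D v ->
  L2norm D (fun x => u x + v x) <= L2norm D u + L2norm D v.
Proof.
move=> Lu Lv; have Luv := inL2D Lu Lv.
rewrite -(@ler_pXn2r _ 2) ?nnegrE ?addr_ge0 ?L2norm_ge0//.
rewrite sqrrD !L2norm_sqr// ipDl// !ipDr// (ipC v u).
have := ip_CS Lu Lv; have := ler_norm (ip D u v); lra.
Qed.

End inner_product.

(** * Norms and convergence in L^2 *)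

Section L2_convergence.
Context (R : realType) (n : nat).
Local Notation mu := (lebesgue_rV R n).
Variables (D : set 'rV[R]_n) (mD : measurable D).
Implicit Types (u v w : 'rV[R]_n -> R).

Lemma ae_ip u v w : inL2 D u -> inL2 D v -> inL2 D w ->
  {ae mu, forall x, D x -> u x = v x} -> ip D u w = ip D v w.
Proof.
move=> Lu Lv Lw uv; rewrite /ip /Rintegral; congr fine.
apply: ae_eq_integral => //.
- by apply: measurable_int; exact: (inL2_integrable mD Lu Lw).
- by apply: measurable_int; exact: (inL2_integrable mD Lv Lw).
- by apply: filterS uv => x uv /uv ->.
Qed.

Lemma ae_L2norm u v : inL2 D u -> inL2 D v ->
  {ae mu, forall x, D x -> u x = v x} -> L2norm D u = L2norm D v.
Proof.
move=> Lu Lv uv; rewrite !L2normE//; congr Num.sqrt.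
by rewrite (ae_ip Lu Lv Lu uv) ipC (ae_ip Lu Lv Lv uv).
Qed.

(** From extended to real norms: infinite values occur only finitely often, as the
    limit is finite. *)
Lemma L2norm_cvg (phi : nat -> 'rV[R]_n -> R) u :
  L2norme D (phi k \- u) @[k --> \oo] --> 0%E ->
  L2norm D (fun x => phi k x - u x) @[k --> \oo] --> 0.
Proof. by move=> /fine_cvgP[_]. Qed.

Lemma ip_cvg (phi : nat -> 'rV[R]_n -> R) u w :
  (forall k, inL2 D (phi k)) -> inL2 D u -> inL2 D w ->
  L2norm D (fun x => phi k x - u x) @[k --> \oo] --> 0 ->
  ip D (phi k) w @[k --> \oo] --> ip D u w.
Proof.
move=> Lphi Lu Lw H; apply/cvgrPdist_le => e e0.
have H0 : L2norm D (fun x => phi k x - u x) * L2norm D w @[k --> \oo] --> 0.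
  by rewrite -(mul0r (L2norm D w)); apply: cvgM => //; exact: cvg_cst.
near=> k; have L := inL2B mD (Lphi k) Lu.
rewrite distrC -(ipBl mD Lw (Lphi k) Lu); apply: le_trans (ip_CS mD L Lw) _.
apply: le_trans (ler_norm _) _; near: k; exact: cvgr0_norm_le.
Unshelve. all: by end_near. Qed.

Lemma inL2_bounded u (M : R) : (mu D < +oo)%E -> measurable_fun D u ->
  (forall x, D x -> `|u x| <= M) -> inL2 D u.
Proof.
move=> Doo mu' uM; apply/inL2P => //; split => //.
apply: (@le_integrable _ _ _ mu D _ _ (fun=> (M ^+ 2)%:E)) => //.
- by apply/measurable_EFinP; exact: measurable_funX.
- move=> x Dx /=; rewrite lee_fin !ger0_norm ?sqr_ge0//.
  have M0 := le_trans (normr_ge0 _) (uM _ Dx).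
  by rewrite -(real_normK (num_real (u x))) ler_pXn2r ?nnegrE ?uM.
- apply/integrableP; split; first exact: measurable_cst.
  by rewrite integral_cst//= lte_mul_pinfty// lee_fin.
Qed.

Lemma inL2_Mbounded u v (M : R) : inL2 D u -> measurable_fun D v ->
  (forall x, D x -> `|v x| <= M) -> inL2 D (fun x => v x * u x).
Proof.
move=> /(inL2P mD)[mu' iu] mv vM; apply/inL2P => //; split.
  exact: measurable_funM.
apply: (@le_integrable _ _ _ mu D _ _ (fun x => (M ^+ 2)%:E * (u x ^+ 2)%:E)%E) => //.
- by apply/measurable_EFinP; apply: measurable_funX; exact: measurable_funM.
- move=> x Dx /=; rewrite lee_fin [leRHS]ger0_norm; last by apply: mulr_ge0; exact: sqr_ge0.
  have M0 := le_trans (normr_ge0 _) (vM _ Dx).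
  rewrite [leLHS]ger0_norm ?sqr_ge0// exprMn; apply: ler_wpM2r; first exact: sqr_ge0.
  by rewrite -(real_normK (num_real (v x))) ler_pXn2r ?nnegrE ?vM.
- exact: integrableZl.
Qed.

Lemma inL2_S E u : measurable E -> E `<=` D -> inL2 D u -> inL2 E u.
Proof.
move=> mE ED /(inL2P mD)[mu' iu]; apply/inL2P => //; split.
  exact: measurable_funS mu'.
exact: integrableS iu.
Qed.

Lemma continuous_bounded_on u : bounded_set D -> continuous u ->
  exists M : R, forall x, closure D x -> `|u x| <= M.
Proof.
move=> bD cu.
have cD : compact (closure D).
  apply: bounded_closed_compact; last exact: closed_closure.
  exact: bounded_closure.
have : compact (u @` closure D).
  by apply: continuous_compact => //; exact: continuous_subspaceT.
move=> /compact_bounded[M [_ /(_ (M + 1))]]; rewrite ltrDl => /(_ ltr01) HM.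
by exists (M + 1) => x Dx; apply: HM; exists x.
Qed.

Lemma inL2_continuous u : bounded_set D -> continuous u -> inL2 D u.
Proof.
move=> bD cu; have [M HM] := continuous_bounded_on bD cu.
apply: (@inL2_bounded _ M); first exact: bounded_lebesgue_lty.
  by apply: measurable_funTS; exact: continuous_measurable_rV.
by move=> x Dx; apply: HM; exact: subset_closure.
Qed.

Lemma bounded_cvg_integral (F : 'rV[R]_n -> R) (a : nat -> 'rV[R]_n -> R)
    (b : 'rV[R]_n -> R) (M : R) :
  mu.-integrable D (EFin \o F) -> (forall k, measurable_fun D (a k)) ->
  measurable_fun D b ->
  (forall k x, D x -> `|a k x| <= M) ->
  (forall x, D x -> a k x @[k --> \oo] --> b x) ->
  \int[mu]_(x in D) (F x * a k x) @[k --> \oo] --> \int[mu]_(x in D) (F x * b x).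
Proof.
move=> iF ma mb aM ab; have mF : measurable_fun D F.
  by apply/measurable_EFinP; exact: (measurable_int mu).
have [|||||iFb _ H] := @dominated_convergence _ _ _ mu D mD
  (fun k x => (F x * a k x)%:E) (fun x => (F x * b x)%:E) (fun x => (`|F x| * M)%:E).
- by move=> k; apply/measurable_EFinP; exact: measurable_funM.
- by apply/measurable_EFinP; exact: measurable_funM.
- apply: nearW => x Dx; apply: cvg_EFin; first exact: nearW.
  by apply: cvgM; [exact: cvg_cst|exact: ab].
- rewrite (_ : (fun x => _) = (fun x => M%:E * `|(F x)%:E|)%E).
    by apply: integrableZl => //; exact: integrable_abse.
  by apply/funext => x /=; rewrite mulrC EFinM.
- by apply: nearW => x k Dx; rewrite /= lee_fin normrM ler_wpM2l// aM.
apply: fine_cvg; rewrite fineK; last exact: integrable_fin_num.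
exact: H.
Qed.
End L2_convergence.

Section L2_norm.
Context (R : realType) (n : nat) (D : set 'rV[R]_n).

Lemma eq_L2norm (u v : 'rV[R]_n -> R) :
  (forall x, D x -> u x = v x) -> L2norm D u = L2norm D v.
Proof.
move=> uv; rewrite /L2norm /L2norme (_ : u \_ D = v \_ D)//.
by apply/funext => x; rewrite !patchE; case: ifPn => // /set_mem /uv.
Qed.

Lemma eq_ip (u v w : 'rV[R]_n -> R) :
  (forall x, D x -> u x = v x) -> ip D u w = ip D v w.
Proof. by move=> uv; apply: eq_Rintegral => x /set_mem Dx; rewrite uv. Qed.

Hypothesis mD : measurable D.

Lemma L2normZ (c : R) u : inL2 D u -> L2norm D (fun x => c * u x) = `|c| * L2norm D u.
Proof.
move=> Lu; have Lcu := inL2Z mD c Lu.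
rewrite !L2normE// ipZl// ipZr// mulrA -expr2 sqrtrM ?sqr_ge0//.
by rewrite sqrtr_sqr.
Qed.

Lemma L2normN u : inL2 D u -> L2norm D (fun x => - u x) = L2norm D u.
Proof.
move=> Lu; rewrite -[RHS]mul1r -(normrN1 R) -L2normZ//.
by apply: eq_L2norm => x _; rewrite mulN1r.
Qed.

Lemma L2norm_dist u v : inL2 D u -> inL2 D v ->
  L2norm D (fun x => u x - v x) = L2norm D (fun x => v x - u x).
Proof.
move=> Lu Lv; rewrite -(L2normN (inL2B mD Lu Lv)).
by apply: eq_L2norm => x _; rewrite opprB.
Qed.

Lemma L2norm_le_dist w u v : inL2 D u -> inL2 D v -> inL2 D w ->
  L2norm D (fun x => u x - v x) <=
  L2norm D (fun x => u x - w x) + L2norm D (fun x => w x - v x).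
Proof.
move=> Lu Lv Lw.
rewrite (eq_L2norm (v := fun x => (u x - w x) + (w x - v x))); last first.
  by move=> x _; rewrite addrA subrK.
by apply: L2norm_triangle => //; exact: inL2B.
Qed.
End L2_norm.

Lemma Rintegral_sum d (T : measurableType d) (R : realType) (mu : {measure set T -> \bar R})
    (D : set T) (mD : measurable D) (I : Type) (s : seq I) (F : I -> T -> R) :
  (forall i, mu.-integrable D (EFin \o F i)) ->
  \int[mu]_(x in D) (\sum_(i <- s) F i x) = \sum_(i <- s) \int[mu]_(x in D) F i x.
Proof.
move=> iF.
suff [] : mu.-integrable D (EFin \o (fun x => \sum_(i <- s) F i x)) /\
  \int[mu]_(x in D) (\sum_(i <- s) F i x) = \sum_(i <- s) \int[mu]_(x in D) F i x by [].
elim: s => [|i s [IH1 IH2]].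
  split.
    rewrite (_ : _ \o _ = cst 0%E); first exact: integrable0.
    by apply/funext => x /=; rewrite big_nil.
  rewrite big_nil (eq_Rintegral _ (g := cst 0)).
    by rewrite Rintegral_cst// mul0r.
  by move=> x _; rewrite big_nil.
have E x : \sum_(j <- i :: s) F j x = F i x + \sum_(j <- s) F j x by rewrite big_cons.
split.
  rewrite (_ : _ \o _ = (fun x => (F i x)%:E + ((\sum_(j <- s) F j x)%R)%:E)%E).
    exact: (integrableD mD (iF i) IH1).
  by apply/funext => x /=; rewrite E EFinD.
rewrite big_cons -IH2 -RintegralD//.
by apply: eq_Rintegral => x _; rewrite E.
Qed.

Lemma cvg_sumr (R : realType) (I : Type) (s : seq I) (f : I -> nat -> R) (l : I -> R) :
  (forall i, f i k @[k --> \oo] --> l i) ->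
  \sum_(i <- s) f i k @[k --> \oo] --> \sum_(i <- s) l i.
Proof.
by move=> H; apply: (@cvg_big _ _ _ _ _ _ _ _ s f l) => //; exact: add_continuous.
Qed.

(** Expand the square of the norm of [phi j - w] and use weak convergence. *)
Lemma ipxx_cvg (R : realType) n (D : set 'rV[R]_n) (mD : measurable D)
    (phi : nat -> 'rV[R]_n -> R) w :
  (forall j, inL2 D (phi j)) -> inL2 D w ->
  L2norm D (fun z => phi j z - w z) @[j --> \oo] --> (0 : R) ->
  ip D (phi j) (phi j) @[j --> \oo] --> ip D w w.
Proof.
move=> Lphi Lw H.
have E j : ip D (phi j) (phi j) =
    L2norm D (fun z => phi j z - w z) ^+ 2 + (2 * ip D (phi j) w - ip D w w).
  have LB := inL2B mD (Lphi j) Lw.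
  rewrite L2norm_sqr// ipBl// !ipBr// (ipC _ w (phi j)); ring.
under eq_fun do rewrite E.
have C1 : L2norm D (fun z => phi j z - w z) ^+ 2 @[j --> \oo] --> (0 : R).
  rewrite -(mulr0 0); under eq_fun do rewrite expr2.
  exact: cvgM.
have C2 : 2 * ip D (phi j) w - ip D w w @[j --> \oo] --> 2 * ip D w w - ip D w w.
  apply: cvgB; last exact: cvg_cst.
  by apply: cvgM; [exact: cvg_cst|exact: ip_cvg].
have e0 : 0 + (2 * ip D w w - ip D w w) = ip D w w by ring.
by have H0 := cvgD C1 C2; rewrite e0 in H0; exact: H0.
Qed.

Section L2_vector.
Context (R : realType) (n : nat) (D : set 'rV[R]_n) (mD : measurable D).
Local Notation mu := (lebesgue_rV R n).

Lemma L2norm_cvgB (phi psi : nat -> 'rV[R]_n -> R) u v :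
  (forall j, inL2 D (phi j)) -> (forall j, inL2 D (psi j)) -> inL2 D u -> inL2 D v ->
  L2norm D (fun x => phi j x - u x) @[j --> \oo] --> (0 : R) ->
  L2norm D (fun x => psi j x - v x) @[j --> \oo] --> (0 : R) ->
  L2norm D (fun x => (phi j x - psi j x) - (u x - v x)) @[j --> \oo] --> (0 : R).
Proof.
move=> Lphi Lpsi Lu Lv c1 c2.
have c12 : L2norm D (fun x => phi j x - u x) + L2norm D (fun x => psi j x - v x)
    @[j --> \oo] --> (0 : R).
  by rewrite -(addr0 0); exact: cvgD.
apply: (squeeze_cvgr _ (cvg_cst 0) c12); apply: nearW => j; rewrite L2norm_ge0/=.
have L1 := inL2B mD (Lphi j) Lu; have L2 := inL2B mD (Lpsi j) Lv.
have L3 := inL2Z mD (-1) L2.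
rewrite (eq_L2norm (v := fun x => (phi j x - u x) + (-1) * (psi j x - v x))); last first.
  by move=> x _; ring.
apply: le_trans (L2norm_triangle mD L1 L3) _.
by rewrite L2normZ// normrN1 mul1r.
Qed.

Lemma L2norme_fine u : inL2 D u -> L2norme D u = (L2norm D u)%:E.
Proof.
move=> /(inL2P mD)[_ /integrableP[_ iu]]; rewrite fineK// ge0_fin_numE ?Lnorm_ge0//.
apply/(L2norme_lty D u)=> //; move: iu.
by under eq_integral do rewrite gee0_abs ?lee_fin ?sqr_ge0//.
Qed.

Lemma L2normv_sqr m (y : 'rV[R]_n -> 'rV[R]_m) : (forall i, inL2 D (fun x => y x ord0 i)) ->
  L2normv D y ^+ 2 = \sum_(i < m) ip D (fun x => y x ord0 i) (fun x => y x ord0 i).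
Proof.
move=> Ly; rewrite sqr_sqrtr; last by apply: sumr_ge0 => i _; exact: sqr_ge0.
by apply: eq_bigr => i _; rewrite L2norm_sqr.
Qed.

Lemma L2normv_ge0 m (y : 'rV[R]_n -> 'rV[R]_m) : 0 <= L2normv D y.
Proof. exact: sqrtr_ge0. Qed.

Lemma sum_ip_CS m (y w : 'rV[R]_n -> 'rV[R]_m) :
  (forall i, inL2 D (fun x => y x ord0 i)) -> (forall i, inL2 D (fun x => w x ord0 i)) ->
  \sum_(i < m) ip D (fun x => y x ord0 i) (fun x => w x ord0 i) <=
  L2normv D y * L2normv D w.
Proof.
move=> Ly Lw; apply: le_trans (ler_norm _) _.
rewrite -(@ler_pXn2r _ 2) ?nnegrE ?mulr_ge0 ?L2normv_ge0//.
rewrite real_normK ?num_real// exprMn !L2normv_sqr//.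
apply: quadratic_CS; [by apply: sumr_ge0 => i _; exact: ip_ge0..|].
move=> t; rewrite !mulr_sumr -sumrB -big_split/=; apply: sumr_ge0 => i _.
have := ip_ge0 D (fun x => y x ord0 i - t * w x ord0 i).
have Ltw := inL2Z mD t (Lw i); have LB := inL2B mD (Ly i) Ltw.
rewrite ipBl// !ipBr// !ipZl// ?ipZr// (ipC D (fun x => w x ord0 i)) => H.
by apply: le_trans H _; lra.
Qed.

Lemma eq_ae_L2normv m (y w : 'rV[R]_n -> 'rV[R]_m) :
  (forall i, inL2 D (fun x => y x ord0 i)) -> (forall i, inL2 D (fun x => w x ord0 i)) ->
  (forall i, {ae mu, forall x, D x -> y x ord0 i = w x ord0 i}) ->
  L2normv D y = L2normv D w.
Proof.
move=> Ly Lw H; congr Num.sqrt; apply: eq_bigr => i _; congr (_ ^+ 2).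
exact: (ae_L2norm mD).
Qed.

End L2_vector.

(** * The fundamental lemma of the calculus of variations *)

Section density.
Context d (T : measurableType d) (R : realType) (mu : {measure set T -> \bar R}).
Variables (f : T -> \bar R).
Hypotheses (mf : measurable_fun setT f) (f0 : forall x, (0 <= f x)%E).

(** Measurability and sign of [f] are arguments so that the measure structure can be
    attached to this constant. *)
Definition density_measure of measurable_fun setT f & (forall x, (0 <= f x)%E) :=
  fun A : set T => (\int[mu]_(x in A) f x)%E.

Let nu := density_measure mf f0.

Let nu0 : nu set0 = 0%E. Proof. by rewrite /nu /density_measure integral_set0. Qed.
Let nu_ge0 A : (0 <= nu A)%E. Proof. exact: integral_ge0. Qed.
Let nu_sigma_additive : semi_sigma_additive nu.
Proof.
move=> /= F mF tF mUF; rewrite /nu /density_measure; apply: cvg_toP.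
  apply: ereal_nondecreasing_is_cvgn => m n mn.
  by apply: lee_sum_nneg_natr => // k _ _; exact: integral_ge0.
by rewrite ge0_integral_bigcup//=; exact: measurable_funTS.
Qed.
HB.instance Definition _ := isMeasure.Build _ _ _ nu nu0 nu_ge0 nu_sigma_additive.
End density.

Section boxes.
Context (R : realType) (n : nat).
Local Notation mu := (lebesgue_rV R n).
Implicit Types (a b : 'rV[R]_n).

Definition obox a b : set 'rV[R]_n := [set z | forall i, a ord0 i < z ord0 i < b ord0 i].
Definition cbox a b : set 'rV[R]_n := [set z | forall i, a ord0 i <= z ord0 i <= b ord0 i].

Lemma measurable_obox a b : measurable (obox a b).
Proof.
apply: (@measurable_rectangle R n (fun i => [set t | a ord0 i < t < b ord0 i])) => i.
rewrite (_ : mkset _ = `]a ord0 i, b ord0 i[%classic); first exact: measurable_itv.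
by apply/seteqP; split => t /=; rewrite in_itv.
Qed.

Lemma oboxI a b a' b' : obox a b `&` obox a' b' =
  obox (\row_i Num.max (a ord0 i) (a' ord0 i)) (\row_i Num.min (b ord0 i) (b' ord0 i)).
Proof.
apply/seteqP; split => z /=.
  move=> [H H'] i; rewrite !mxE gt_max lt_min.
  by have /andP[-> ->] := H i; have /andP[-> ->] := H' i.
move=> H; split => i; have := H i; rewrite !mxE gt_max lt_min.
  by move=> /andP[/andP[-> _] /andP[-> _]].
by move=> /andP[/andP[_ ->] /andP[_ ->]].
Qed.

Definition boxes := [set obox p.1 p.2 | p in [set: 'rV[R]_n * 'rV[R]_n]].

Lemma boxes_obox a b : boxes (obox a b).
Proof. by exists (a, b). Qed.

Lemma boxes_setI : setI_closed boxes.
Proof. by move=> _ _ [[a b] _ <-] [[a' b'] _ <-]; rewrite oboxI; exact: boxes_obox. Qed.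

Lemma cube_obox (p : 'rV[rat]_n * nat) : (cube p : set 'rV[R]_n) =
  obox (\row_i (ratr (p.1 ord0 i) - p.2.+1%:R^-1)) (\row_i (ratr (p.1 ord0 i) + p.2.+1%:R^-1)).
Proof.
apply/seteqP; split => z H i; have := H i; rewrite /= !mxE ltr_distl.
  by [].
by [].
Qed.

(** Both inclusions go through the topology: boxes are measurable, and a coordinate
    preimage of an open interval is open, hence a countable union of cubes, which
    are boxes. *)
Lemma measurable_boxesE : @measurable _ 'rV[R]_n = <<s boxes >>.
Proof.
apply/seteqP; split; last first.
  apply: smallest_sub; first exact: sigma_algebra_measurable.
  by move=> _ [[a b] _ <-]; exact: measurable_obox.
apply: smallest_sub; first exact: smallest_sigma_algebra.
rewrite -bigcup_seq/=; apply: bigcup_sub => i _ A [B mB <-].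
have H : measurable_fun [set: g_sigma_algebraType boxes]
    (fun z : g_sigma_algebraType boxes => (z : 'rV[R]_n) ord0 i).
  apply: (measurability _ (RGenOpens.measurableE R)).
  move=> _ [_ [a [b ->] <-]]; rewrite setTI.
  set U := _ @^-1` _.
  have oU : open (U : set 'rV[R]_n).
    apply: (@open_comp _ _ (fun z : 'rV[R]_n => z ord0 i)); last exact: interval_open.
    by move=> x _; exact: coord_continuous.
  rewrite (open_bigcup_cube oU).
  apply: countable_bigcupT_measurable; first exact: countableP.
  move=> p; case: ifP => // _; apply: sub_sigma_algebra.
  by rewrite cube_obox; exact: boxes_obox.
exact: H.
Qed.

(** The positive and negative parts of [g] are the densities of two finite measures.
    They agree on boxes, which form a pi-system generating the sigma-algebra, hence
    everywhere; so [g] has integral zero over every measurable set. *)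
Lemma ae0_of_boxes (g : 'rV[R]_n -> R) : mu.-integrable setT (EFin \o g) ->
  (forall a b, \int[mu]_(x in obox a b) g x = 0) ->
  {ae mu, forall x, g x = 0}.
Proof.
move=> ig H; have mg : measurable_fun setT (EFin \o g) by exact: (measurable_int mu).
have mgp := measurable_funepos mg; have mgn := measurable_funeneg mg.
pose m1 := density_measure mu mgp (funepos_ge0 _).
pose m2 := density_measure mu mgn (funeneg_ge0 _).
have igA A : measurable A -> mu.-integrable A (EFin \o g).
  by move=> mA; exact: integrableS ig.
have fin1 A : measurable A -> m1 A \is a fin_num.
  by move=> mA; apply: integrable_pos_fin_num => //; exact: igA.
have fin2 A : measurable A -> m2 A \is a fin_num.
  by move=> mA; apply: integrable_neg_fin_num => //; exact: igA.
have E A : measurable A -> m1 A = m2 A.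
  apply: (@measure_unique _ _ _ boxes
    (fun k => obox (const_mx (- k%:R)) (const_mx k%:R)) measurable_boxesE boxes_setI _ _ m1 m2).
  - by move=> k; exact: boxes_obox.
  - rewrite -subTset => z _; exists (Num.bound `|z|) => // i.
    rewrite !mxE -ltr_norml (le_lt_trans (rV_coord_le _ _))//.
    by rewrite (le_lt_trans (ler_norm _))// normr_id archi_boundP.
  - move=> _ [[a b] _ <-] /=; have mB := measurable_obox a b.
    have := H a b; rewrite /Rintegral integralE -/(m1 _) -/(m2 _).
    rewrite fineB ?fin1 ?fin2// => /eqP; rewrite subr_eq0 => /eqP h.
    by have := fineK (fin1 _ mB); rewrite h fineK ?fin2.
  - by move=> k; rewrite -ge0_fin_numE// fin1//; exact: measurable_obox.
have : ae_eq mu setT (EFin \o g) (cst 0%E).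
  apply: integral_ae_eq => //.
  move=> A _ mA; rewrite integral0.
  rewrite integralE; have := E _ mA; rewrite /m1 /m2 /density_measure => ->.
  by rewrite subee//; exact: fin2.
by apply: filterS => x /(_ I) [].
Qed.

End boxes.

Section fundamental_lemma.
Context (R : realType) (n : nat).
Local Notation mu := (lebesgue_rV R n).
Implicit Types (a b : 'rV[R]_n).

(** The coefficients [1] and [- 1] give both factors the shape
    [expinv p (s * z ord0 i + c)] of [Ck_expinv_coord]. *)
Definition box_bump a b : 'rV[R]_n -> R :=
  \prod_(i < n) ((fun z : 'rV[R]_n => expinv 0 (1 * z ord0 i + - a ord0 i)) *
                 (fun z : 'rV[R]_n => expinv 0 (- 1 * z ord0 i + b ord0 i))).

Lemma smooth_box_bump a b : smooth (box_bump a b).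
Proof. by move=> k; apply: Ck_prod => i; apply: CkM; exact: Ck_expinv_coord. Qed.

Lemma box_bumpE a b z : box_bump a b z =
  \prod_(i < n) (expinv 0 (z ord0 i - a ord0 i) * expinv 0 (b ord0 i - z ord0 i)).
Proof.
rewrite /box_bump fct_prodE; by apply: eq_bigr => i _; rewrite mulrfctE mul1r mulN1r (addrC _ (b ord0 i)).
Qed.

Lemma box_bump_ge0 a b z : 0 <= box_bump a b z.
Proof. by rewrite box_bumpE; apply: prodr_ge0 => i _; rewrite mulr_ge0// expinv_ge0. Qed.

Lemma box_bump_gt0 a b z : obox a b z -> 0 < box_bump a b z.
Proof.
move=> H; rewrite box_bumpE; apply: prodr_gt0 => i _.
by have /andP[? ?] := H i; rewrite mulr_gt0// expinv_gt0// subr_gt0.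
Qed.

Lemma box_bump_out a b z : ~ obox a b z -> box_bump a b z = 0.
Proof.
move=> /existsNP[i /negP]; rewrite negb_and -!leNgt => H.
rewrite box_bumpE (bigD1 i)//=; case/orP : H => H.
  by rewrite (@expinv_le0 _ _ (_ - _)) ?subr_le0// !mul0r.
by rewrite (@expinv_le0 _ _ (b ord0 i - _)) ?subr_le0// mulr0 mul0r.
Qed.

Lemma compact_cbox a b : compact (cbox a b).
Proof.
have := @rV_compact R n (fun i => `[a ord0 i, b ord0 i]%classic)
  (fun i => @segment_compact R (a ord0 i) (b ord0 i)).
by congr compact; apply/seteqP; split => z H i; have := H i; rewrite /= in_itv.
Qed.

Variables (D : set 'rV[R]_n) (oD : open D) (bD : bounded_set D).
Let mD := open_measurable_rV oD.

Lemma integrable_inL2 (g : 'rV[R]_n -> R) : inL2 D g -> mu.-integrable D (EFin \o g).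
Proof.
move=> Lg; have L1 : inL2 D (cst 1).
  by apply: inL2_continuous => //; exact: cst_continuous.
have := inL2_integrable mD Lg L1.
by rewrite (_ : (fun x => _) = EFin \o g)//; apply/funext => x; rewrite mulr1.
Qed.

(** The cutoffs of [box_bump a b] are test functions, supported in the closed box,
    and tend boundedly to the indicator function of the open box. *)
Lemma integral_obox0 (g : 'rV[R]_n -> R) a b : inL2 D g -> cbox a b `<=` D ->
  (forall phi, test_fun D phi -> \int[mu]_(x in D) (g x * phi x) = 0) ->
  \int[mu]_(x in obox a b) g x = 0.
Proof.
move=> Lg abD H; have b0 := box_bump_ge0 a b.
have cut0 z m : ~ obox a b z -> cutoff (box_bump a b) m z = 0.
  by move=> /box_bump_out; exact: cutoff0.
have cbD : obox a b `<=` D.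
  by move=> z Hz; apply: abD => i; have /andP[/ltW -> /ltW ->] := Hz i.
have sc m := smooth_cutoff b0 m (smooth_box_bump a b).
have tc m : test_fun D (cutoff (box_bump a b) m).
  split; first exact: sc.
  exists (cbox a b); split => //; first exact: compact_cbox.
  move=> z nz; apply: cut0 => Hz; apply: nz => i.
  by have /andP[/ltW -> /ltW ->] := Hz i.
have mO : measurable_fun D (\1_(obox a b) : 'rV[R]_n -> R).
  by apply: measurable_funTS; apply: measurable_indic; exact: measurable_obox.
have Hc : \int[mu]_(x in D) (g x * cutoff (box_bump a b) m x) @[m --> \oo] -->
    \int[mu]_(x in D) (g x * \1_(obox a b) x).
  apply: (@bounded_cvg_integral R n D mD g (cutoff (box_bump a b)) _ 1) => //.
  - exact: integrable_inL2.
  - by move=> m; apply: measurable_funTS; apply: continuous_measurable_rV; exact: smooth_cont.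
  - by move=> m x _; rewrite ger0_norm ?cutoff_ge0// cutoff_le1.
  - move=> x _; rewrite indicE; have [xO|xO] := boolP (x \in obox a b).
      by apply: cutoff_cvg => //; apply: box_bump_gt0; exact/set_mem.
    rewrite (_ : (fun k => _) = cst 0); first exact: cvg_cst.
    by apply/funext => m; apply: cut0; move: xO; rewrite notin_setE.
have : \int[mu]_(x in D) (g x * \1_(obox a b) x) = 0.
  move: Hc; rewrite (_ : (fun m => _) = cst 0).
    by move/cvg_lim => <-//; rewrite lim_cst.
  by apply/funext => m; exact: H.
move=> <-; rewrite -[in LHS](setIidr cbD) Rintegral_mkcondr.
apply: eq_Rintegral => x _; rewrite patchE indicE.
by case: ifP => _; rewrite ?mulr1 ?mulr0.
Qed.

(** On a cube whose closure lies in [D], the integrals of [g] over all smaller boxes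
    vanish, so that [g] vanishes almost everywhere there; countably many such cubes
    cover [D]. *)
Lemma fundamental_lemma (g : 'rV[R]_n -> R) : inL2 D g ->
  (forall phi, test_fun D phi -> \int[mu]_(x in D) (g x * phi x) = 0) ->
  {ae mu, forall x, D x -> g x = 0}.
Proof.
move=> Lg H.
pose ccube (p : 'rV[rat]_n * nat) := cbox (\row_i (ratr (p.1 ord0 i) - p.2.+1%:R^-1))
   (\row_i (ratr (p.1 ord0 i) + p.2.+1%:R^-1) : 'rV[R]_n).
have Hp p : ccube p `<=` D -> {ae mu, forall x, (cube p : set 'rV[R]_n) x -> g x = 0}.
  move=> pD; have mc := @measurable_cube R n p.
  have cD : (cube p : set 'rV[R]_n) `<=` D.
    rewrite cube_obox => z Hz; apply: pD => i.
    by have /andP[/ltW -> /ltW ->] := Hz i.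
  have : {ae mu, forall x, (g \_ (cube p)) x = 0}.
    apply: ae0_of_boxes.
      rewrite -restrict_EFin; apply/(integrable_mkcond _ _).1 => //.
      exact: integrableS (integrable_inL2 Lg).
    move=> a b; rewrite -Rintegral_mkcondr cube_obox oboxI.
    apply: integral_obox0 => //; apply: subset_trans pD => z Hz i.
    have := Hz i; rewrite !mxE ge_max le_min.
    by move=> /andP[/andP[_ ->] /andP[_ ->]].
  by apply: filterS => x + xp; rewrite patchE ifT// inE.
(* the cubes are enumerated by the natural numbers to use countable subadditivity *)
have : {ae mu, forall x, forall k : nat,
    forall p, unpickle k = Some p -> ccube p `<=` D -> (cube p : set 'rV[R]_n) x -> g x = 0}.
  apply/ae_foralln => k; case Ek : (unpickle k) => [p|]; last exact: nearW.
  have [pD|npD] := pselect (ccube p `<=` D); last first.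
    by apply: nearW => x q [<-] /npD.
  by apply: filterS (Hp _ pD) => x Hx q [<-] _.
apply: filterS => x Hx Dx; have [p [xp pD]] := open_cube oD Dx.
apply: (Hx (pickle p) p) => //; first exact: pickleK.
apply: subset_trans pD => z Hz i; have := Hz i.
by rewrite !mxE -ler_distl.
Qed.

End fundamental_lemma.

(** * Integration by parts on space-time strips *)

Lemma pderiv_indep (R : realType) n (f : 'rV[R]_n -> R) j :
  (forall (h : R) z, f (h *: unit_rV R j + z) = f z) -> pderiv j f = cst 0.
Proof.
move=> H; apply/funext => z; rewrite /pderiv.
have := @derive_comp_affine R _ _ f id z (unit_rV R j) 0.
by rewrite derive0; apply => h; rewrite H scaler0 add0r.
Qed.

Section strips.
Context (R : realType) (d : nat).
Local Notation mu := (lebesgue_rV R d.+1).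
Implicit Types (z : 'rV[R]_d.+1).

Definition sp z : 'rV[R]_d := (rV_unrcons z).1.
Definition tm z : R := z ord0 ord_max.

Lemma continuous_sp : continuous sp.
Proof.
apply: continuous_rowP => i.
rewrite (_ : (fun _ => _) = (fun z => z ord0 (lift ord_max i))).
  by move=> z; exact: coord_continuous.
by apply/funext => z; rewrite mxE.
Qed.

Lemma continuous_tm : continuous tm.
Proof. by move=> z; exact: coord_continuous. Qed.

Lemma sp_xdir (h : R) i z : sp (h *: unit_rV R (xdir i) + z) = h *: unit_rV R i + sp z.
Proof.
by apply/rowP => j; rewrite !mxE/= (inj_eq (@lift_inj _ _)).
Qed.

Lemma sp_tdir (h : R) z : sp (h *: unit_rV R (tdir d) + z) = sp z.
Proof.
by apply/rowP => j; rewrite !mxE/= [_ == _]eq_sym (negbTE (neq_lift _ _)) mulr0 add0r.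
Qed.

Lemma tm_xdir (h : R) i z : tm (h *: unit_rV R (xdir i) + z) = tm z.
Proof. by rewrite /tm !mxE/= (negbTE (neq_lift _ _)) mulr0 add0r. Qed.

Lemma sp_rcons x t : sp (rV_rcons (x, t)) = x.
Proof. by rewrite /sp rV_rconsK. Qed.

Lemma tm_rcons x t : tm (rV_rcons (x, t)) = t.
Proof. by rewrite /tm mxE unlift_none. Qed.

Lemma sp_tshift c z : sp (tshift c z) = sp z.
Proof.
by apply/rowP => j; rewrite !mxE/= [_ == _]eq_sym (negbTE (neq_lift _ _)) mulr0 subr0.
Qed.

Lemma tm_tshift c z : tm (tshift c z) = tm z - c.
Proof. by rewrite /tm !mxE/= eqxx mulr1. Qed.

Variable (Omega : set 'rV[R]_d).
Hypothesis oO : open Omega.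
Hypothesis bO : bounded_set Omega.

Definition strip (a b : R) : set 'rV[R]_d.+1 := spacetime Omega `]a, b[.

Lemma stripE a b z : strip a b z <-> Omega (sp z) /\ a < tm z < b.
Proof. by rewrite /strip /spacetime /= in_itv. Qed.

Lemma open_strip a b : open (strip a b).
Proof.
rewrite (_ : strip a b = (sp @^-1` Omega) `&` (tm @^-1` `]a, b[%classic)) //.
apply: openI; apply: open_comp => //.
- by move=> z _; exact: continuous_sp.
- by move=> z _; exact: continuous_tm.
Qed.

Lemma bounded_coord (A : set 'rV[R]_d.+1) (M : R) :
  (forall z i, A z -> `|z ord0 i| <= M) -> bounded_set A.
Proof.
move=> H; exists (`|M|); split; first exact: num_real.
move=> N MN z Az; apply: ltW; apply: rV_norm_lt.
  exact: le_lt_trans MN.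
move=> i; apply: le_lt_trans (H _ _ Az) _; apply: le_lt_trans MN; exact: ler_norm.
Qed.

Lemma bounded_spacetime a b (A : set 'rV[R]_d) : bounded_set A ->
  bounded_set [set z | A (sp z) /\ a <= tm z <= b].
Proof.
move=> [M [_ /(_ (M + 1))]]; rewrite ltrDl => /(_ ltr01) HM.
apply: (@bounded_coord _ (Num.max (M + 1) (Num.max `|a| `|b|))).
move=> z i [Az tz]; rewrite !le_max; case: (unliftP ord_max i) => [j ->|->].
  have := le_trans (rV_coord_le (sp z) j) (HM _ Az).
  by rewrite mxE => ->.
apply/orP; right; rewrite -le_max -/(tm z).
move: tz => /andP[az zb]; rewrite ler_norml le_max; apply/andP; split.
  by rewrite lerNl le_max -normrN (le_trans _ (ler_norm _)) ?lerN2.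
by rewrite (le_trans zb (ler_norm _)) orbT.
Qed.

Lemma bounded_strip a b : bounded_set (strip a b).
Proof.
have [M [Mr HM]] := bounded_spacetime a b bO.
exists M; split => // N MN z /stripE[Oz /andP[/ltW ? /ltW ?]].
by apply: HM MN _ _; split => //; apply/andP.
Qed.

Lemma measurable_strip a b : measurable (strip a b).
Proof. by apply: open_measurable_rV; exact: open_strip. Qed.

Definition tbump (a b : R) z : R :=
  expinv 0 (1 * z ord0 ord_max + - a) * expinv 0 (- 1 * z ord0 ord_max + b).

Lemma smooth_tbump a' b' : smooth (tbump a' b').
Proof.
move=> k; apply: (@CkM _ _ _ (fun z => expinv 0 (1 * z ord0 ord_max + - a'))).
  exact: Ck_expinv_coord.
exact: Ck_expinv_coord.
Qed.

Lemma tbump_ge0 a' b' z : 0 <= tbump a' b' z.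
Proof. by rewrite mulr_ge0// expinv_ge0. Qed.

Lemma tbump_gt0 a' b' z : a' < tm z < b' -> 0 < tbump a' b' z.
Proof.
move=> /andP[az zb]; rewrite mulr_gt0// expinv_gt0//.
  by rewrite mul1r subr_gt0.
by rewrite mulN1r addrC subr_gt0.
Qed.

Lemma tbump_out a' b' z : ~~ (a' < tm z < b') -> tbump a' b' z = 0.
Proof.
rewrite negb_and -!leNgt /tbump mul1r mulN1r => /orP[|] H.
  by rewrite expinv_le0 ?mul0r// subr_le0.
by rewrite [X in _ * X]expinv_le0 ?mulr0// addrC subr_le0.
Qed.

(** A weak identity tested with each [c k] passes to the pointwise limit [b]; both
    limits of cutoffs in [ibp_strip] have this form. *)
Lemma ibp_limit (D : set 'rV[R]_d.+1) (mD : measurable D)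
    (F G : 'rV[R]_d.+1 -> R) (c : nat -> 'rV[R]_d.+1 -> R) b :
  mu.-integrable D (EFin \o F) -> mu.-integrable D (EFin \o G) ->
  (forall k, measurable_fun setT (c k)) -> measurable_fun setT b ->
  (forall k x, D x -> `|c k x| <= 1) ->
  (forall x, D x -> c k x @[k --> \oo] --> (b x : R)) ->
  (forall k, \int[mu]_(x in D) (F x * c k x) = - \int[mu]_(x in D) (G x * c k x)) ->
  \int[mu]_(x in D) (F x * b x) = - \int[mu]_(x in D) (G x * b x).
Proof.
move=> iF iG mc mb c1 cb H.
have HF := @bounded_cvg_integral R _ D mD F c b 1 iF (fun k => measurable_funTS (mc k))
  (measurable_funTS mb) c1 cb.
have HG := @bounded_cvg_integral R _ D mD G c b 1 iG (fun k => measurable_funTS (mc k))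
  (measurable_funTS mb) c1 cb.
move: HF; under eq_fun do rewrite H.
move=> /cvg_lim <-//; apply/cvg_lim => //; exact: cvgN.
Qed.

Lemma tbump_xdir a' b' i (h : R) z :
  tbump a' b' (h *: unit_rV R (xdir i) + z) = tbump a' b' z.
Proof. by rewrite /tbump -!/(tm _) tm_xdir. Qed.

Section lateral_cutoff.
Variables (a b a' b' : R) (zeta : 'rV[R]_d.+1 -> R) (k : nat).
Hypotheses (aa' : a < a') (bb' : b' < b) (sz : smooth zeta).
Hypothesis zlat : forall z, boundary Omega (sp z) -> a < tm z < b ->
  \forall w \near z, zeta w = 0.

(** Localisation of [zeta] to a test function: a cutoff in time that vanishes
    outside [(a', b')], and restriction to [Omega] in space.  The restriction
    creates no singularity because [zeta] vanishes near the lateral boundary. *)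
Definition lateral_cutoff z : R :=
  if `[< Omega (sp z) >] then cutoff (tbump a' b') k z * zeta z else 0.

Let cut0 z : ~~ (a' < tm z < b') -> cutoff (tbump a' b') k z = 0.
Proof. by move=> H; rewrite cutoff0// tbump_out. Qed.

Let inside z : Omega (sp z) ->
  \forall w \near z, lateral_cutoff w = (cutoff (tbump a' b') k * zeta) w.
Proof.
move=> Oz; have : nbhs z (sp @^-1` Omega).
  by apply: continuous_sp; exact: open_nbhs_nbhs.
by apply: filterS => w Ow; rewrite /lateral_cutoff ifT//; exact/asboolP.
Qed.

Let smc : smooth (cutoff (tbump a' b') k).
Proof. by apply: smooth_cutoff; [exact: tbump_ge0|exact: smooth_tbump]. Qed.

(** The support is contained in the compact set of the points over the closure of
    [Omega], at times from [a'] to [b'], near which [zeta] is not identically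
    zero; this set avoids the lateral boundary. *)
Lemma test_lateral_cutoff : test_fun (strip a b) lateral_cutoff.
Proof.
split.
  move=> m; apply: Ck_local => z; have [Oz|nOz] := pselect (Omega (sp z)).
    by exists (cutoff (tbump a' b') k * zeta); split; [exact: smoothM|exact: inside].
  exists (cst 0); split; first exact: Ck_cst.
  have [bz|nbz] := pselect (boundary Omega (sp z)); last first.
    have cz : (~` closure Omega) (sp z).
      by move=> cz; apply: nbz; exact: closure_open_boundary.
    have : nbhs z (sp @^-1` (~` closure Omega)).
      apply: continuous_sp; apply: open_nbhs_nbhs; split => //.
      by apply: closed_openC; exact: closed_closure.
    apply: filterS => w Hw; rewrite /lateral_cutoff ifF//.
    by apply/asboolP => Ow; apply: Hw; exact: subset_closure.
  have [abz|] := boolP (a < tm z < b).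
    by apply: filterS (zlat bz abz) => w w0; rewrite /lateral_cutoff w0 mulr0; case: ifP.
  rewrite negb_and -!leNgt => /orP[za|bz'].
    have : nbhs z (tm @^-1` [set t | t < a']).
      apply: continuous_tm; apply: open_nbhs_nbhs; split; first exact: open_lt.
      exact: le_lt_trans aa'.
    apply: filterS => w /= wa; rewrite /lateral_cutoff cut0 ?mul0r; first by case: ifP.
    by rewrite negb_and -!leNgt (ltW wa).
  have : nbhs z (tm @^-1` [set t | b' < t]).
    apply: continuous_tm; apply: open_nbhs_nbhs; split; first exact: open_gt.
    exact: lt_le_trans bb' _.
  apply: filterS => w /= wa; rewrite /lateral_cutoff cut0 ?mul0r; first by case: ifP.
  by rewrite negb_and -!leNgt (ltW wa) orbT.
exists ([set z | closure Omega (sp z) /\ a' <= tm z <= b'] `&`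
        ~` [set z | \forall w \near z, zeta w = 0]).
split.
- apply: bounded_closed_compact.
    have [N [Nr HN]] := bounded_spacetime a' b' (bounded_closure bO).
    by exists N; split => // P NP z [Kz _]; exact: HN NP _ Kz.
  apply: closedI.
    rewrite (_ : mkset _ = (sp @^-1` closure Omega) `&` (tm @^-1` `[a', b']%classic)); last first.
      by apply/seteqP; split => z /=; rewrite in_itv.
    apply: closedI; apply: closed_comp.
    - by move=> z _; exact: continuous_sp.
    - exact: closed_closure.
    - by move=> z _; exact: continuous_tm.
    - exact: interval_closed.
  apply: open_closedC; exact: (@open_interior _ [set z | zeta z = 0]).
- move=> z [[cz /andP[az zb]] nz]; apply/stripE.
  have abz : a < tm z < b by rewrite (lt_le_trans aa')// (le_lt_trans zb).
  split => //; apply: contrapT => nOz; apply: nz; apply: zlat => //.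
  exact: closure_open_boundary.
- move=> z nK; rewrite /lateral_cutoff; case: asboolP => // Oz.
  have [abz|/cut0 ->] := boolP (a' < tm z < b'); last by rewrite mul0r.
  have [n0|n0] := pselect (\forall w \near z, zeta w = 0).
    by rewrite (nbhs_singleton n0) mulr0.
  exfalso; apply: nK; split => //; split; first exact: subset_closure.
  by have /andP[/ltW -> /ltW ->] := abz.
Qed.

Lemma lateral_cutoffE z : Omega (sp z) ->
  lateral_cutoff z = zeta z * cutoff (tbump a' b') k z.
Proof. by move=> Oz; rewrite /lateral_cutoff ifT 1?mulrC//; exact/asboolP. Qed.

(** The time cutoff does not depend on the space variables, hence behaves as a
    constant factor; no such identity holds for the time derivative. *)
Lemma pderiv_lateral_cutoff i z : Omega (sp z) ->
  pderiv (xdir i) lateral_cutoff z =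
  pderiv (xdir i) zeta z * cutoff (tbump a' b') k z.
Proof.
move=> Oz; have -> : pderiv (xdir i) lateral_cutoff z =
    pderiv (xdir i) (cutoff (tbump a' b') k * zeta) z.
  by apply: near_eq_derive; exact: inside.
rewrite pderivM; [|by move=> x; exact: smooth_derivable..].
have -> : pderiv (xdir i) (cutoff (tbump a' b') k) = cst 0.
  by apply: pderiv_indep => h w; rewrite /cutoff tbump_xdir.
by rewrite mulr0 addr0 mulrC.
Qed.
End lateral_cutoff.

Definition slab (a b : R) : set 'rV[R]_d.+1 := [set z | a < tm z < b].

Lemma measurable_slab a b : measurable (slab a b).
Proof.
rewrite (_ : slab a b = tm @^-1` `]a, b[%classic); last first.
  by apply/seteqP; split => z /=; rewrite in_itv.
rewrite -[X in measurable X]setTI; apply: measurable_rV_coord => //.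
Qed.

Lemma Rintegral_slab T a b (F : 'rV[R]_d.+1 -> R) : 0 <= a -> b <= T ->
  \int[mu]_(z in strip 0 T) (F z * \1_(slab a b) z) = \int[mu]_(z in strip a b) F z.
Proof.
move=> a0 bT; rewrite (_ : strip a b = strip 0 T `&` slab a b); last first.
  apply/seteqP; split => z.
    move=> /stripE[Oz /andP[az zb]]; split; last by rewrite /slab/= az zb.
    by apply/stripE; split => //; rewrite (le_lt_trans a0)// (lt_le_trans zb).
  by move=> [/stripE[Oz _] abz]; apply/stripE.
rewrite [in RHS]Rintegral_mkcondr; apply: eq_Rintegral => x _; rewrite patchE indicE.
by case: ifP => _; rewrite ?mulr1 ?mulr0.
Qed.

Lemma inL2_smooth (D : set 'rV[R]_d.+1) (u v : 'rV[R]_d.+1 -> R) : open D -> bounded_set D ->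
  inL2 D u -> continuous v -> inL2 D (fun x => v x * u x).
Proof.
move=> oD bD Lu cv; have mD := open_measurable_rV oD.
have [M HM] := continuous_bounded_on bD cv.
apply: (@inL2_Mbounded _ _ _ mD _ _ M) => //.
  by apply: measurable_funTS; exact: continuous_measurable_rV.
by move=> x Dx; apply: HM; exact: subset_closure.
Qed.

(** No condition is imposed on [zeta] at the times [a] and [b], because only spatial
    derivatives occur.  Two limits are taken: first the smooth cutoffs in time tend
    to the indicator function of a smaller interval, then that interval grows to
    [(a, b)].  The intermediate interval is needed because the support of a test
    function must stay away from the times [a] and [b]. *)
Lemma ibp_strip T a b (y : 'rV[R]_d.+1 -> 'rV[R]_d) g zeta : 0 <= a -> b <= T ->
  (forall i, inL2 (strip 0 T) (fun z => y z ord0 i)) -> is_divx Omega T y g ->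
  smooth zeta ->
  (forall z, boundary Omega (sp z) -> a < tm z < b -> \forall w \near z, zeta w = 0) ->
  \int[mu]_(z in strip a b) (\sum_(i < d) y z ord0 i * pderiv (xdir i) zeta z) =
  - \int[mu]_(z in strip a b) (g z * zeta z).
Proof.
move=> a0 bT Ly [Lg Hdiv] sz zlat; pose Q := strip 0 T.
have oQ : open Q by exact: open_strip.
have bQ : bounded_set Q by exact: bounded_strip.
have mQ : measurable Q by exact: measurable_strip.
pose F z := \sum_(i < d) y z ord0 i * pderiv (xdir i) zeta z.
pose G z := g z * zeta z.
have LF : inL2 Q F.
  apply: inL2_sum => // i.
  rewrite (_ : (fun _ => _) = fun x => pderiv (xdir i) zeta x * y x ord0 i); last first.
    by apply/funext => x; rewrite mulrC.
  by apply: inL2_smooth => //; apply: smooth_cont; exact: smooth_pderiv.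
have LG : inL2 Q G.
  rewrite /G (_ : (fun _ => _) = fun x => zeta x * g x); last first.
    by apply/funext => x; rewrite mulrC.
  by apply: inL2_smooth => //; exact: smooth_cont.
have iF := integrable_inL2 oQ bQ LF; have iG := integrable_inL2 oQ bQ LG.
pose a_ (m : nat) := a + m.+1%:R^-1; pose b_ (m : nat) := b - m.+1%:R^-1.
have am m : a < a_ m by rewrite ltrDl invr_gt0.
have bm m : b_ m < b by rewrite ltrBlDr ltrDl invr_gt0.
have Hmk m k : \int[mu]_(x in Q) (F x * cutoff (tbump (a_ m) (b_ m)) k x) =
             - \int[mu]_(x in Q) (G x * cutoff (tbump (a_ m) (b_ m)) k x).
  have [sphi [K [cK KS K0]]] := test_lateral_cutoff k (am m) (bm m) sz zlat.
  have tphi : test_fun Q (lateral_cutoff (a_ m) (b_ m) zeta k).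
    split => //; exists K; split => // z /KS /stripE[Oz /andP[az zb]].
    by apply/stripE; split => //; rewrite (le_lt_trans a0)// (lt_le_trans zb).
  have := Hdiv _ tphi; rewrite -/Q => Hd.
  transitivity (\int[mu]_(z in Q) (\sum_(i < d) y z ord0 i *
      pderiv (xdir i) (lateral_cutoff (a_ m) (b_ m) zeta k) z)).
    apply: eq_Rintegral => z; rewrite inE => /stripE[Oz _].
    rewrite /F mulr_suml; apply: eq_bigr => i _.
    by rewrite pderiv_lateral_cutoff// mulrA.
  rewrite Hd; congr (- _); apply: eq_Rintegral => z; rewrite inE => /stripE[Oz _].
  by rewrite lateral_cutoffE// mulrA.
have Hm m : \int[mu]_(x in Q) (F x * \1_(slab (a_ m) (b_ m)) x) =
             - \int[mu]_(x in Q) (G x * \1_(slab (a_ m) (b_ m)) x).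
  apply: (ibp_limit mQ iF iG (c := cutoff (tbump (a_ m) (b_ m)))) => //.
  - move=> k; apply: continuous_measurable_rV; apply: smooth_cont.
    by apply: smooth_cutoff; [exact: tbump_ge0|exact: smooth_tbump].
  - apply: measurable_indic; exact: measurable_slab.
  - by move=> k x _; rewrite ger0_norm ?cutoff_le1 ?cutoff_ge0//; exact: tbump_ge0.
  - move=> x _; rewrite indicE; have [xO|xO] := boolP (x \in slab (a_ m) (b_ m)).
      by apply: cutoff_cvg; [exact: tbump_ge0|apply: tbump_gt0; exact: set_mem xO].
    rewrite (_ : (fun k => _) = cst 0); first exact: cvg_cst.
    apply/funext => k; apply: cutoff0; apply: tbump_out; apply/negP.
    by move: xO; rewrite notin_setE.
rewrite -(Rintegral_slab F a0 bT) -(Rintegral_slab G a0 bT).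
apply: (ibp_limit mQ iF iG (c := fun m => \1_(slab (a_ m) (b_ m)))) => //.
- by move=> k; apply: measurable_indic; exact: measurable_slab.
- apply: measurable_indic; exact: measurable_slab.
- by move=> k x _; rewrite indicE; case: (_ \in _); rewrite ?normr1 ?normr0.
- move=> x _; rewrite [\1_(slab a b) x]indicE; have [xO|xO] := boolP (x \in slab a b).
    apply: cvg_near_cst; have /andP[ax xb] : a < tm x < b by exact: set_mem xO.
    have e0 : 0 < Num.min (tm x - a) (b - tm x) by rewrite lt_min !subr_gt0 ax xb.
    have := near_infty_natSinv_lt (PosNum e0); apply: filterS => k /=.
    rewrite lt_min => /andP[k1 k2]; rewrite indicE mem_set// /slab/= /a_ /b_.
    by rewrite -ltrBrDl k1/= ltrBrDr addrC -ltrBrDr.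
  rewrite (_ : (fun k => _) = cst 0); first exact: cvg_cst.
  apply/funext => k; rewrite indicE memNset// => xk; move: xO; rewrite notin_setE; apply.
  by move: xk => /andP[k1 k2]; rewrite /slab/= (lt_trans (am k))// (lt_trans k2).
Qed.
End strips.

(** * Translation in time *)

Section translation.
Context (R : realType) (d : nat).
Local Notation mu := (lebesgue_rV R d.+1).
Variables (Omega : set 'rV[R]_d) (oO : open Omega) (T : R).
Local Notation strip := (@strip R d Omega).
Local Notation Q := (strip 0 T).
Implicit Types (u v : 'rV[R]_d.+1 -> R).

Let mQ : measurable Q. Proof. exact: measurable_strip. Qed.

(** Extension by zero makes [tau] a semigroup of contractions of L^2(Q).  It creates
    no jump at the bottom for functions that vanish there, which are the only ones
    differentiated in time. *)
Definition tau (c : R) u : 'rV[R]_d.+1 -> R := fun z => (u \_ Q) (tshift c z).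

Lemma tau_in c u z : Q (tshift c z) -> tau c u z = u (tshift c z).
Proof. by move=> H; rewrite /tau patchE ifT// inE. Qed.

Lemma tau_out c u z : ~ Q (tshift c z) -> tau c u z = 0.
Proof. by move=> H; rewrite /tau patchE ifF//; apply/negP => /set_mem. Qed.

Lemma tauB c u v z : tau c (fun x => u x - v x) z = tau c u z - tau c v z.
Proof. by rewrite /tau !patchE; case: ifP => // _; rewrite subr0. Qed.

Lemma measurable_tau c u : inL2 Q u -> measurable_fun setT (tau c u).
Proof.
move=> /(inL2P mQ)[mu' _]; apply: (measurableT_comp (f := u \_ Q)).
  exact/(measurable_restrictT _ mQ).
exact: measurable_tshift.
Qed.

Lemma integral_tau c u : 0 <= c -> inL2 Q u ->
  (\int[mu]_(z in Q) (tau c u z ^+ 2)%:E =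
   \int[mu]_(z in strip 0 (T - c)%R) (u z ^+ 2)%:E)%E.
Proof.
move=> c0 Lu; have mtc : measurable (strip 0 (T - c)) by exact: measurable_strip.
have sub : strip 0 (T - c) `<=` Q.
  move=> z /stripE[Oz /andP[z0 zT]]; apply/stripE; split => //.
  by rewrite z0 (lt_le_trans zT)// gerBl.
pose H := (fun z => (u z ^+ 2)%:E) \_ (strip 0 (T - c)).
have mH : measurable_fun setT H.
  apply/(measurable_restrictT _ mtc); apply/measurable_EFinP/measurable_funX.
  by apply: measurable_funS sub _ => //; exact: inL2_measurable Lu.
have -> : (\int[mu]_(z in strip 0 (T - c)%R) (u z ^+ 2)%:E = \int[mu]_z H z)%E.
  by rewrite [LHS]integral_mkcond.
rewrite [RHS](ge0_integral_mpres (@measurable_tshift R d c)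
  (@lebesgue_rV_tshift R d c))//; last first.
  by move=> z _; rewrite /H patchE; case: ifP => // _; rewrite lee_fin sqr_ge0.
rewrite [LHS]integral_mkcond preimage_setT.
apply: eq_integral => z _; rewrite [LHS]patchE.
have [Qz|Qz] := boolP (z \in Q).
  move/set_mem : Qz => /stripE[Oz /andP[z0 zT]].
  have [Qsz|Qsz] := pselect (Q (tshift c z)).
    rewrite tau_in// /H patchE ifT// inE; apply/stripE.
    move: Qsz => /stripE[? /andP[-> _]]; split => //=.
    by rewrite tm_tshift ltrD2r.
  rewrite tau_out// expr0n/= /H patchE ifF//; apply/negP => /set_mem /sub.
  exact: Qsz.
rewrite /H patchE ifF//; apply/negP => /set_mem /stripE[Osz /andP[sz0 szT]].
move/negP : Qz; apply; rewrite inE; apply/stripE; move: Osz sz0 szT.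
rewrite sp_tshift tm_tshift => Oz; rewrite subr_gt0 ltrD2r => cz zT.
by split => //; rewrite (le_lt_trans c0 cz) zT.
Qed.

Lemma inL2_tau c u : 0 <= c -> inL2 Q u -> inL2 Q (tau c u).
Proof.
move=> c0 Lu; apply/inL2P => //; split.
  by apply: measurable_funTS; exact: measurable_tau.
apply/integrableP; split.
  by apply/measurable_EFinP/measurable_funX/measurable_funTS; exact: measurable_tau.
under eq_integral do rewrite gee0_abs ?lee_fin ?sqr_ge0//.
rewrite integral_tau//; have sub : strip 0 (T - c) `<=` Q.
  move=> z /stripE[Oz /andP[z0 zT]]; apply/stripE; split => //.
  by rewrite z0 (lt_le_trans zT)// gerBl.
have mtc : measurable (strip 0 (T - c)) by exact: measurable_strip.
have /(inL2P mtc)[_ /integrable_lty] : inL2 (strip 0 (T - c)) u by exact: inL2_S Lu.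
exact.
Qed.

Lemma ip_tau c u : 0 <= c -> inL2 Q u ->
  ip Q (tau c u) (tau c u) = ip (strip 0 (T - c)) u u.
Proof.
move=> c0 Lu; rewrite /ip /Rintegral; congr fine.
under eq_integral do rewrite -expr2.
by rewrite integral_tau//; apply: eq_integral => x _; rewrite expr2.
Qed.

(** What the translation loses is the mass that leaves [Q] through the final time;
    this is where the trace at time [T] comes from. *)
Lemma ip_strip_split c u : 0 <= c <= T -> inL2 Q u ->
  ip (strip (T - c) T) u u <= ip Q u u - ip Q (tau c u) (tau c u).
Proof.
move=> /andP[c0 cT] Lu; rewrite ip_tau// lerBrDr.
have Tc0 : 0 <= T - c by rewrite subr_ge0.
have TcT : T - c <= T by rewrite gerBl.
rewrite /ip -(Rintegral_slab (T := T) Omega (fun z => u z * u z) Tc0 (lexx T)).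
rewrite -(Rintegral_slab (T := T) Omega (fun z => u z * u z) (lexx 0) TcT).
have iu := inL2_integrable mQ Lu Lu.
have iI a b : mu.-integrable Q (EFin \o (fun z => u z * u z * \1_(slab a b) z)).
  apply: (le_integrable mQ _ _ iu).
    apply/measurable_EFinP; apply: measurable_funM.
      by apply: measurable_funM; exact: inL2_measurable Lu.
    by apply: measurable_funTS; apply: measurable_indic; exact: measurable_slab.
  move=> z _; rewrite /= lee_fin normrM ler_piMr//.
  by rewrite indicE; case: (_ \in _); rewrite ?normr1 ?normr0.
rewrite -RintegralD//; apply: le_Rintegral => //.
  rewrite (_ : EFin \o _ = (fun z => (u z * u z * \1_(slab (T - c) T) z)%:E +
      (u z * u z * \1_(slab 0 (T - c)) z)%:E)%E)//.
  exact: (integrableD mQ (iI _ _) (iI _ _)).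
move=> z _; rewrite -mulrDr ler_piMr// -?expr2 ?sqr_ge0// !indicE.
have [z1|_] := boolP (z \in slab (T - c) T); last by case: (_ \in _); rewrite add0r.
rewrite memNset ?addr0// => /andP[_ zT].
by move/set_mem : z1 => /andP[+ _]; rewrite ltNge (ltW zT).
Qed.

Lemma L2norm_tau c u : 0 <= c <= T -> inL2 Q u -> L2norm Q (tau c u) <= L2norm Q u.
Proof.
move=> cT Lu; have /andP[c0 _] := cT; have Lt := inL2_tau c0 Lu.
rewrite !L2normE// ler_wsqrtr// -subr_ge0.
by apply: le_trans (ip_strip_split cT Lu); exact: ip_ge0.
Qed.

(** Only for nonnegative shifts: a point moved out of [Q] backwards in time does not
    come back. *)
Lemma tau_tau a c u z : 0 <= a -> 0 <= c -> Q z -> tau a (tau c u) z = tau (a + c) u z.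
Proof.
move=> a0 c0 /stripE[Oz /andP[z0 zT]].
have tt : tshift c (tshift a z) = tshift (a + c) z.
  by rewrite /tshift scalerDl opprD addrA.
have [Qa|nQa] := pselect (Q (tshift a z)).
  by rewrite tau_in// /tau tt.
rewrite tau_out// tau_out// => /stripE[_ /andP[+ _]].
rewrite tm_tshift subr_gt0 => acz; apply: nQa; apply/stripE.
rewrite sp_tshift tm_tshift subr_gt0; split => //.
by rewrite (le_lt_trans _ acz) ?lerDl//= (le_lt_trans _ zT)// gerBl.
Qed.

(** Subadditivity: the difference over [m + 1] steps is the difference over one step
    plus a translate of the difference over [m] steps. *)
Lemma L2norm_tau_mul m c u : 0 <= c -> m%:R * c <= T -> inL2 Q u ->
  L2norm Q (fun z => u z - tau (m%:R * c) u z) <= m%:R * L2norm Q (fun z => u z - tau c u z).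
Proof.
move=> c0 + Lu; elim: m => [|m IH] mcT.
  rewrite !mul0r (eq_L2norm (v := fun z => 0 * u z)).
    by rewrite L2normZ// normr0 mul0r.
  move=> z Qz; rewrite tau_in /tshift !scale0r !subr0// mul0r ?subrr//.
have mc0 : 0 <= m%:R * c by rewrite mulr_ge0.
have mcT' : m%:R * c <= T by apply: le_trans mcT; rewrite ler_wpM2r// ler_nat.
have cT : c <= T.
  by apply: le_trans mcT; rewrite ler_peMl// ler1n.
have Lc := inL2_tau c0 Lu; have Lmc := inL2_tau mc0 Lu.
have L1 := inL2B mQ Lu Lc; have L2 := inL2B mQ Lu Lmc.
have LT2 := inL2_tau c0 L2.
rewrite (eq_L2norm (v := fun z => (u z - tau c u z) +
    tau c (fun z => u z - tau (m%:R * c) u z) z)).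
  apply: le_trans (L2norm_triangle mQ L1 LT2) _.
  rewrite -natr1 mulrDl mul1r addrC lerD2r.
  by apply: le_trans (IH mcT'); apply: L2norm_tau => //; rewrite c0 cT.
move=> z Qz; rewrite tauB tau_tau// addrA subrK -natr1 mulrDl mul1r.
by rewrite (addrC c).
Qed.
End translation.

(** * Backward difference quotients *)

Section difference_quotient.
Context (R : realType) (d : nat).
Local Notation mu := (lebesgue_rV R d.+1).
Variables (Omega : set 'rV[R]_d) (oO : open Omega) (bO : bounded_set Omega).
Variable T : R.
Local Notation strip := (@strip R d Omega).
Local Notation Q := (strip 0 T).
Local Notation tau := (@tau R d Omega T).
Implicit Types (u v psi : 'rV[R]_d.+1 -> R).

Let oQ : open Q. Proof. exact: open_strip. Qed.
Let bQ : bounded_set Q. Proof. exact: bounded_strip. Qed.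
Let mQ : measurable Q. Proof. exact: measurable_strip. Qed.

Local Notation dtp := (pderiv (tdir d)).

(** The mean value theorem on the time segment from [tshift s z] to [z]. *)
Lemma tshift_le psi (M s : R) z : smooth psi -> 0 <= s ->
  (forall r, 0 < r < s -> `|dtp psi (tshift r z)| <= M) ->
  `|psi z - psi (tshift s z)| <= M * s.
Proof.
rewrite le_eqVlt => spsi /predU1P[<- _|s0 HM].
  by rewrite /tshift scale0r subr0 subrr normr0 mulr0.
pose e := unit_rV R (tdir d); pose L (r : R) := r *: e + tshift s z.
have df (r : R) : is_derive r (1 : R) (psi \o L) (dtp psi (L r)).
  have HL (h : R) : L (h *: 1 + r) = h *: e + L r.
    by rewrite /L [h *: _]mulr1 scalerDl -addrA.
  apply: DeriveDef.
    refine (derivable_comp_affine (V := R) (W := 'rV[R]_d.+1) HL (smooth_derivable spsi)).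
  by rewrite (derive_comp_affine (W := 'rV[R]_d.+1) HL).
have cf : continuous (psi \o L).
  move=> r; apply: differentiable_continuous; apply/derivable1_diffP.
  by have := df r.
have [c] := @MVT R (psi \o L) (fun r => dtp psi (L r)) 0 s s0 (fun r _ => df r)
  (continuous_subspaceT cf).
rewrite in_itv/= => /andP[c0 cs]; rewrite /L subr0 scale0r add0r.
have Lr r : r *: e + tshift s z = tshift (s - r) z.
  by rewrite /tshift scalerBl opprB addrCA.
rewrite !Lr subrr {1}/tshift scale0r subr0 => ->.
rewrite normrM (gtr0_norm s0) ler_pM2r// HM// subr_gt0 cs/= gtrBl//.
Qed.

Definition dq (h : R) u : 'rV[R]_d.+1 -> R := fun z => h^-1 * (u z - tau h u z).

Lemma inL2_dq h u : 0 <= h -> inL2 Q u -> inL2 Q (dq h u).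
Proof.
by move=> h0 Lu; apply: inL2Z => //; apply: inL2B => //; exact: inL2_tau.
Qed.

Lemma dqB h u v z : dq h (fun x => u x - v x) z = dq h u z - dq h v z.
Proof. by rewrite /dq tauB; ring. Qed.

Lemma dq_le2 h u : 0 < h <= T -> inL2 Q u ->
  L2norm Q (dq h u) <= h^-1 * 2 * L2norm Q u.
Proof.
move=> /andP[h0 hT] Lu; have Lt := inL2_tau oO (ltW h0) Lu.
rewrite /dq L2normZ//; last exact: inL2B.
rewrite ger0_norm ?invr_ge0 ?(ltW h0)// -mulrA ler_pM2l ?invr_gt0//.
have LN : inL2 Q (fun x => (-1) * tau h u x) by exact: inL2Z.
rewrite (eq_L2norm (v := fun x => u x + (-1) * tau h u x)); last first.
  by move=> x _; rewrite mulN1r.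
apply: le_trans (L2norm_triangle mQ Lu LN) _.
rewrite L2normZ// normrN1 mul1r mulr_natl mulr2n lerD2l.
by apply: L2norm_tau => //; rewrite (ltW h0).
Qed.

Section smooth_dq.
Variables (psi : 'rV[R]_d.+1 -> R).
Hypotheses (spsi : smooth psi) (psi0 : forall z, Omega (sp z) -> tm z = 0 -> psi z = 0).

Let Lpsi : inL2 Q psi. Proof. exact: inL2_continuous (smooth_cont spsi). Qed.
Let Ldpsi : inL2 Q (dtp psi).
Proof. by apply: inL2_continuous => //; apply: smooth_cont; exact: smooth_pderiv. Qed.

(** For [h] larger than the time of [z], the value subtracted is zero, which is also
    the value of [psi] at the bottom point below [z]; the mean value theorem then
    applies on the segment from there. *)
Lemma dq_bounded (M h : R) z : (forall x, Q x -> `|dtp psi x| <= M) -> 0 < h ->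
  Q z -> `|dq h psi z| <= M.
Proof.
move=> HM h0 Qz; have M0 : 0 <= M := le_trans (normr_ge0 _) (HM _ Qz).
have /stripE[Oz /andP[z0 zT]] := Qz.
have Qr r s : s <= tm z -> 0 < r < s -> Q (tshift r z).
  move=> sz /andP[r0 rs]; apply/stripE; rewrite sp_tshift tm_tshift subr_gt0; split => //.
  by rewrite (lt_le_trans rs)//= (lt_trans _ zT)// gtrBl.
rewrite /dq normrM ger0_norm ?invr_ge0 ?(ltW h0)// ler_pdivrMl// mulrC.
have [hz|zh] := ltP h (tm z).
  rewrite tau_in; last first.
    apply/stripE; rewrite sp_tshift tm_tshift subr_gt0 hz; split => //=.
    by rewrite (lt_trans _ zT)// gtrBl.
  by apply: tshift_le => //; [exact: ltW|move=> r Hr; apply/HM/(Qr _ h) => //; exact: ltW].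
rewrite tau_out; last first.
  by move=> /stripE[_ /andP[+ _]]; rewrite tm_tshift subr_gt0 ltNge zh.
have -> : 0 = psi (tshift (tm z) z).
  by rewrite psi0// ?sp_tshift// tm_tshift subrr.
apply: (@le_trans _ _ (M * tm z)); last by rewrite ler_wpM2l.
by apply: tshift_le => //; [exact: ltW|move=> r Hr; apply/HM/(Qr _ (tm z))].
Qed.

Lemma dq_cvg (h : nat -> R) z : (forall k, 0 < h k) -> h k @[k --> \oo] --> (0 : R) ->
  Q z -> dq (h k) psi z @[k --> \oo] --> dtp psi z.
Proof.
move=> h0 hc Qz; have /stripE[Oz /andP[z0 zT]] := Qz.
pose e := unit_rV R (tdir d).
have H : (- h k)^-1 *: ((psi \o shift z) (- h k *: e) - psi z) @[k --> \oo] --> dtp psi z.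
  have H : h^-1 *: ((psi \o shift z) (h *: e) - psi z) @[h --> 0^'] --> dtp psi z.
    exact: (smooth_derivable spsi).
  apply: (cvgr_dnbhsP _ _ _).1 H _ _; split.
    by move=> k; rewrite oppr_eq0 gt_eqF.
  by rewrite -oppr0; exact: cvgN.
apply: cvg_trans H; apply: near_eq_cvg; near=> k.
rewrite /dq tau_in.
  rewrite /shift/= /tshift invrN !scaleNr -/e [- _ + z]addrC.
  by rewrite /GRing.scale/= -mulrN opprB.
apply/stripE; rewrite sp_tshift tm_tshift subr_gt0; split => //.
have -> : h k < tm z by near: k; exact: cvgr_lt hc _ z0.
by rewrite (lt_trans _ zT)// gtrBl.
Unshelve. all: by end_near. Qed.

(** Dominated convergence: the quotients converge pointwise and have the same bound as
    the time derivative. *)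
Lemma dq_L2cvg (h : nat -> R) : (forall k, 0 < h k) -> h k @[k --> \oo] --> (0 : R) ->
  L2norm Q (fun z => dq (h k) psi z - dtp psi z) @[k --> \oo] --> (0 : R).
Proof.
move=> h0 hc.
have Ldq k : inL2 Q (dq (h k) psi) by apply: inL2_dq => //; exact: ltW.
have LB k : inL2 Q (fun z => dq (h k) psi z - dtp psi z) by exact: inL2B.
have [M HM] := continuous_bounded_on bQ (smooth_cont (smooth_pderiv (tdir d) spsi)).
have {}HM x : Q x -> `|dtp psi x| <= M by move=> Qx; apply: HM; exact: subset_closure.
pose a k z := (dq (h k) psi z - dtp psi z) ^+ 2.
have Ha : \int[mu]_(z in Q) (1 * a k z) @[k --> \oo] --> \int[mu]_(z in Q) (1 * (cst 0 : 'rV[R]_d.+1 -> R) z).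
  apply: (@bounded_cvg_integral _ _ _ mQ (cst 1) a (cst 0) ((2 * M) ^+ 2)).
  - by apply: integrable_inL2 => //; apply: inL2_continuous => //; exact: cst_continuous.
  - by move=> k; apply: measurable_funX; exact: inL2_measurable (LB k).
  - exact: measurable_cst.
  - move=> k x Qx; have M0 : 0 <= M := le_trans (normr_ge0 _) (HM _ Qx).
    rewrite /a normrX ler_pXn2r ?nnegrE ?mulr_ge0//.
    apply: le_trans (ler_normB _ _) _; rewrite mulr_natl mulr2n lerD ?HM//.
    exact: dq_bounded.
  - move=> x Qx; rewrite /a /= -[X in _ --> X](expr0n R 2) -(subrr (dtp psi x)).
    rewrite expr2; under eq_fun do rewrite expr2.
    by apply: cvgM; (apply: cvgB; [exact: dq_cvg|exact: cvg_cst]).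
have {Ha} : ip Q (fun z => dq (h k) psi z - dtp psi z) (fun z => dq (h k) psi z - dtp psi z)
    @[k --> \oo] --> (0 : R).
  move: Ha; rewrite (_ : \int[mu]_(z in Q) (1 * (cst 0 : 'rV[R]_d.+1 -> R) z) = 0).
    apply: cvg_trans; apply: near_eq_cvg; apply: nearW => k.
    by apply: eq_Rintegral => z _; rewrite mul1r /a expr2.
  rewrite (eq_Rintegral _ (g := cst 0)); last by move=> x _; rewrite mulr0.
  by rewrite Rintegral_cst// mul0r.
move=> Ha; rewrite -[X in _ --> X](sqrtr0 R).
under eq_fun do rewrite (L2normE mQ (LB _)).
by apply: (continuous_cvg _ (@sqrt_continuous R 0)); exact: Ha.
Qed.

(** By subadditivity, the norm of the quotient of step [h] is at most that of the
    quotient of step [h / k], and the latter tends to the norm of the derivative. *)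
Lemma dq_norm_le (h : R) : 0 < h <= T -> L2norm Q (dq h psi) <= L2norm Q (dtp psi).
Proof.
move=> /andP[h0 hT].
have hk0 k : 0 < h / k.+1%:R by rewrite divr_gt0.
have H k : L2norm Q (dq h psi) <= L2norm Q (dq (h / k.+1%:R) psi).
  have Lt c : 0 <= c -> inL2 Q (fun z => psi z - tau c psi z).
    by move=> c0; apply: inL2B => //; exact: inL2_tau.
  rewrite /dq (L2normZ mQ _ (Lt _ (ltW h0))) (L2normZ mQ _ (Lt _ (ltW (hk0 k)))).
  rewrite !ger0_norm ?invr_ge0 ?(ltW h0) ?(ltW (hk0 k))//.
  have kh : k.+1%:R * (h / k.+1%:R) = h by rewrite mulrC divfK// pnatr_eq0.
  have := L2norm_tau_mul oO (m := k.+1) (T := T) (ltW (hk0 k)) _ Lpsi.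
  rewrite kh => /(_ hT); rewrite invf_div -[_ / h]mulrC -mulrA ler_pM2l ?invr_gt0//.
have hc : h / k.+1%:R @[k --> \oo] --> (0 : R).
  rewrite -(mulr0 h); apply: cvgM; first exact: cvg_cst.
  exact: cvg_harmonic.
have C := dq_L2cvg hk0 hc.
have H2 k : L2norm Q (dq h psi) <=
    L2norm Q (fun z => dq (h / k.+1%:R) psi z - dtp psi z) + L2norm Q (dtp psi).
  apply: le_trans (H k) _.
  have LA : inL2 Q (dq (h / k.+1%:R) psi) by apply: inL2_dq => //; exact: ltW.
  rewrite (eq_L2norm (v := fun z => (dq (h / k.+1%:R) psi z - dtp psi z) + dtp psi z)).
    by apply: L2norm_triangle => //; exact: inL2B.
  by move=> z _; rewrite subrK.
have C2 : L2norm Q (fun z => dq (h / k.+1%:R) psi z - dtp psi z) + L2norm Q (dtp psi)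
    @[k --> \oo] --> L2norm Q (dtp psi).
  by rewrite -[X in _ --> X]add0r; apply: cvgD => //; exact: cvg_cst.
apply: (cvgr_to_ge C2); exact: nearW.
Qed.
End smooth_dq.

(** The bound [dq_norm_le], applied to differences of the approximants, holds
    uniformly in [h] and passes to the limit [e]; convergence is then inherited from
    the approximants by an argument with three small terms. *)
Lemma diffquot_cvg (psi : nat -> 'rV[R]_d.+1 -> R) (e et : 'rV[R]_d.+1 -> R) (h : nat -> R) :
  (forall j, smooth (psi j)) ->
  (forall j z, Omega (sp z) -> tm z = 0 -> psi j z = 0) ->
  inL2 Q e -> inL2 Q et ->
  L2norm Q (fun z => psi j z - e z) @[j --> \oo] --> (0 : R) ->
  L2norm Q (fun z => dtp (psi j) z - et z) @[j --> \oo] --> (0 : R) ->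
  (forall k, 0 < h k <= T) -> h k @[k --> \oo] --> (0 : R) ->
  L2norm Q (fun z => dq (h k) e z - et z) @[k --> \oo] --> (0 : R).
Proof.
move=> spsi psi0 Le Let c0 c1 hT hc.
have h0 k : 0 < h k by have /andP[] := hT k.
have Lpsi j : inL2 Q (psi j) by exact: inL2_continuous (smooth_cont (spsi j)).
have Ldpsi j : inL2 Q (dtp (psi j)).
  by apply: inL2_continuous => //; apply: smooth_cont; exact: smooth_pderiv.
have Ldq k u : inL2 Q u -> inL2 Q (dq (h k) u).
  by move=> Lu; apply: inL2_dq => //; exact: ltW.
have Hij k i j : L2norm Q (fun z => dq (h k) (psi i) z - dq (h k) (psi j) z) <=
    L2norm Q (fun z => dtp (psi i) z - dtp (psi j) z).
  have s12 : smooth (fun z => psi i z - psi j z) by exact: smoothB.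
  have z12 z : Omega (sp z) -> tm z = 0 -> psi i z - psi j z = 0.
    by move=> Oz tz; rewrite !psi0// subrr.
  have := dq_norm_le s12 z12 (hT k).
  rewrite (eq_L2norm (v := fun z => dq (h k) (psi i) z - dq (h k) (psi j) z)); last first.
    by move=> z _; rewrite dqB.
  rewrite [leRHS](eq_L2norm (v := fun z => dtp (psi i) z - dtp (psi j) z))//.
  move=> z _; rewrite (_ : (fun z => psi i z - psi j z) = psi i - psi j)//.
  by rewrite pderivB//; move=> x; exact: smooth_derivable.
(* the bound for e minus an approximant: a second index i tends to infinity, and
   for fixed h the quotient is continuous in L^2 *)
have Hj k j : L2norm Q (fun z => dq (h k) e z - dq (h k) (psi j) z) <=
    L2norm Q (fun z => dtp (psi j) z - et z).
  have B i : L2norm Q (fun z => dq (h k) e z - dq (h k) (psi j) z) <=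
      (h k)^-1 * 2 * L2norm Q (fun z => psi i z - e z) +
      (L2norm Q (fun z => dtp (psi i) z - et z) + L2norm Q (fun z => dtp (psi j) z - et z)).
    apply: le_trans (L2norm_le_dist mQ (w := dq (h k) (psi i)) _ _ _) _; [exact: Ldq..|].
    apply: lerD.
      rewrite (L2norm_dist mQ); [|exact: Ldq..].
      rewrite (eq_L2norm (v := dq (h k) (fun x => psi i x - e x))).
        by apply: dq_le2 => //; exact: inL2B.
      by move=> z _; rewrite dqB.
    apply: le_trans (Hij k i j) _.
    apply: le_trans (L2norm_le_dist mQ (w := et) _ _ _) _ => //.
    by rewrite [X in _ + X <= _](L2norm_dist mQ).
  have C : (h k)^-1 * 2 * L2norm Q (fun z => psi i z - e z) +
      (L2norm Q (fun z => dtp (psi i) z - et z) + L2norm Q (fun z => dtp (psi j) z - et z))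
      @[i --> \oo] --> L2norm Q (fun z => dtp (psi j) z - et z).
    rewrite -[X in _ --> X]add0r -[X in _ --> X + _](mulr0 ((h k)^-1 * 2)).
    apply: cvgD; first by apply: cvgM => //; exact: cvg_cst.
    by rewrite -[X in _ --> X]add0r; apply: cvgD => //; exact: cvg_cst.
  by apply: (cvgr_to_ge C); exact: nearW.
apply/cvgr0Pnorm_le => eps eps0.
have e3 : 0 < eps / 3 by rewrite divr_gt0.
have [j Hj3] : exists j, L2norm Q (fun z => dtp (psi j) z - et z) <= eps / 3.
  have [j _ /(_ j (leqnn j)) /= Hj3] := cvgr0_norm_le _ c1 _ e3.
  by exists j; apply: le_trans Hj3; exact: ler_norm.
have C := dq_L2cvg (spsi j) (psi0 j) h0 hc.
near=> k; rewrite ger0_norm ?L2norm_ge0//.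
apply: le_trans (L2norm_le_dist mQ (w := dq (h k) (psi j)) _ _ _) _; [exact: Ldq|by []|exact: Ldq|].
have -> : eps = eps / 3 + (eps / 3 + eps / 3) by field.
apply: lerD; first exact: le_trans (Hj k j) Hj3.
apply: le_trans (L2norm_le_dist mQ (w := dtp (psi j)) _ _ _) _ => //; first exact: Ldq.
apply: lerD => //; apply: le_trans (ler_norm _) _; near: k.
exact: cvgr0_norm_le _ C _ e3.
Unshelve. all: by end_near. Qed.
End difference_quotient.

(** * Integration over time slices *)

Section slices.
Context (R : realType) (d : nat).
Local Notation mu := (lebesgue_rV R d.+1).
Local Notation muO := (lebesgue_rV R d).
Local Notation leb := (@lebesgue_measure R).

Lemma integrable_slices (F : 'rV[R]_d.+1 -> \bar R) : mu.-integrable setT F ->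
  leb.-integrable setT (fun t => \int[muO]_x F (rV_rcons (x, t)))%E.
Proof.
move=> iF.
have iG : (muO \x leb)%E.-integrable setT (F \o @rV_rcons R d).
  by apply: (integrable_mpres (@measurable_rV_rcons R d) _ measurableT iF).
have mG := measurable_int _ iG.
apply/integrableP; split; first exact: (measurable_fubini_G iG).
apply: le_lt_trans ((integrable21ltyP _ _ mG).1 iG).
apply: ge0_le_integral => //.
- by apply: measurableT_comp => //; exact: (measurable_fubini_G iG).
- by apply: (measurable_fun_fubini_tonelli_G (abse \o (F \o @rV_rcons R d))) => //=;
    exact: measurableT_comp.
- move=> t _; apply: le_abse_integral => //.
  by apply: (measurableT_comp mG); exact: pair2_measurable.
Qed.

Variables (Omega : set 'rV[R]_d) (oO : open Omega) (bO : bounded_set Omega).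
Local Notation strip := (@strip R d Omega).

(** The almost everywhere form is essential, since the values on the slices are only
    known for almost every time. *)
Lemma fubini_strip_bound (F : 'rV[R]_d.+1 -> R) (a b c eps : R) : a < b -> 0 <= eps ->
  mu.-integrable (strip a b) (EFin \o F) ->
  {ae leb, forall t : R, a < t < b ->
    (`|\int[muO]_(x in Omega) (F (rV_rcons (x, t)))%:E - c%:E| <= eps%:E)%E} ->
  `|\int[mu]_(z in strip a b) F z - c * (b - a)| <= eps * (b - a).
Proof.
move=> ab eps0 iF H.
have mS : measurable (strip a b) by exact: measurable_strip.
have mO : measurable Omega by exact: open_measurable_rV.
pose F0 := (EFin \o F) \_ (strip a b).
have iF0 : mu.-integrable setT F0 by exact/(integrable_mkcond _ mS).
pose g t := (\int[muO]_x F0 (rV_rcons (x, t)))%E.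
have ig : leb.-integrable setT g by exact: integrable_slices.
have mI : measurable (`]a, b[%classic : set (measurableTypeR R)) by exact: measurable_itv.
have igI : leb.-integrable `]a, b[%classic g by exact: integrableS ig.
have gE t : a < t < b -> g t = (\int[muO]_(x in Omega) (F (rV_rcons (x, t)))%:E)%E.
  move=> tab; rewrite /g [RHS]integral_mkcond; apply: eq_integral => x _.
  rewrite /F0 !patchE; have [xO|xO] := boolP (x \in Omega).
    by rewrite ifT// inE; apply/stripE; rewrite sp_rcons tm_rcons; split => //; exact: set_mem.
  rewrite ifF//; apply/negP => /set_mem /stripE; rewrite sp_rcons => -[Ox _].
  by move/negP : xO; apply; rewrite inE.
have g0 t : ~~ (a < t < b) -> g t = 0%E.
  move=> tab; rewrite /g integral0_eq// => x _; rewrite /F0 patchE ifF//.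
  apply/negP => /set_mem /stripE; rewrite tm_rcons => -[_].
  by apply/negP.
have EI : (\int[mu]_(z in strip a b) (F z)%:E = \int[leb]_(t in `]a, b[%classic) g t)%E.
  rewrite [LHS]integral_mkcond fubini_rV// [RHS]integral_mkcond.
  apply: eq_integral => t _; rewrite patchE; case: ifPn => //.
  move=> /negP nt; apply: g0; apply/negP => tab; apply: nt.
  by rewrite inE/= in_itv.
have ic : leb.-integrable `]a, b[%classic (cst c%:E).
  apply/integrableP; split; first exact: measurable_cst.
  rewrite integral_cst//= lebesgue_measure_itv/= lte_fin ab -EFinD.
  by rewrite -EFinM ltry.
have lI : leb `]a, b[%classic = (b - a)%:E.
  by rewrite lebesgue_measure_itv/= lte_fin ab.
have Hgc : (`|\int[leb]_(t in `]a, b[%classic) (g t - c%:E)| <= (eps * (b - a))%:E)%E.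
  apply: le_trans.
    apply: le_abse_integral => //; apply: emeasurable_funB; first exact: measurable_int igI.
    exact: measurable_cst.
  apply: (@le_trans _ _ (\int[leb]_(t in `]a, b[%classic) eps%:E)%E); last first.
    by rewrite integral_cst// [X in (_ * X)%E]lI EFinM.
  apply: ae_ge0_le_integral => //.
  - apply: measurableT_comp => //; apply: emeasurable_funB; first exact: measurable_int igI.
    exact: measurable_cst.
  - apply: (@filterS _ _ (ae_filter_ringOfSetsType leb) _ _ _ H) => t Ht; rewrite /= in_itv/= => tab.
    by rewrite gE//; exact: Ht.
move: Hgc; rewrite integralB// integral_cst// [X in (_ * X)%E]lI -EFinM.
rewrite -EI -(fineK (integrable_fin_num mS iF)) -EFinB /= lee_fin.
by [].
Qed.
End slices.

(** * Traces at the final time *)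

Section interior_test.
Context (R : realType) (d : nat).
Variables (Omega : set 'rV[R]_d) (oO : open Omega) (bO : bounded_set Omega).
Variables (psi : 'rV[R]_d -> R).
Hypotheses (spsi : smooth psi)
  (psi0 : exists U, [/\ open U, boundary Omega `<=` U & forall x, U x -> psi x = 0]).

Definition extend0 x := if `[< Omega x >] then psi x else 0.

Let inside x : Omega x -> \forall z \near x, extend0 z = psi z.
Proof.
move=> Ox; have : nbhs x Omega by exact: open_nbhs_nbhs.
by apply: filterS => w Ow; rewrite /extend0 ifT//; exact/asboolP.
Qed.

(** Near the boundary [psi] vanishes already, so that setting it to zero outside
    [Omega] creates no singularity, and the support stays away from the boundary. *)
Lemma test_extend0 : test_fun Omega extend0.
Proof.
have [U [oU bU U0]] := psi0.
split.
  move=> m; apply: Ck_local => z; have [Oz|nOz] := pselect (Omega z).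
    by exists psi; split; [exact: spsi|exact: inside].
  exists (cst 0); split; first exact: Ck_cst.
  have [bz|nbz] := pselect (boundary Omega z).
    have : nbhs z U by apply: open_nbhs_nbhs; split => //; exact: bU.
    by apply: filterS => w /U0 w0; rewrite /extend0 w0; case: ifP.
  have cz : (~` closure Omega) z.
    by move=> cz; apply: nbz; exact: closure_open_boundary.
  have : nbhs z (~` closure Omega).
    by apply: open_nbhs_nbhs; split => //; apply: closed_openC; exact: closed_closure.
  apply: filterS => w Hw; rewrite /extend0 ifF//.
  by apply/asboolP => Ow; apply: Hw; exact: subset_closure.
exists (closure Omega `&` ~` U); split.
- apply: bounded_closed_compact.
    have [M [Mr HM]] := bounded_closure bO.
    by exists M; split => // N MN x [cx _]; exact: HM MN _ cx.
  by apply: closedI; [exact: closed_closure|exact: open_closedC].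
- move=> z [cz nU]; apply: contrapT => nOz; apply: nU; apply: bU.
  exact: closure_open_boundary.
- move=> z nK; rewrite /extend0; case: asboolP => // Oz.
  apply: U0; apply: contrapT => nU; apply: nK; split => //; exact: subset_closure.
Qed.

Lemma extend0E x : Omega x -> extend0 x = psi x.
Proof. by move=> Ox; rewrite /extend0 ifT//; exact/asboolP. Qed.

Lemma pderiv_extend0 i x : Omega x -> pderiv i extend0 x = pderiv i psi x.
Proof. by move=> Ox; apply: near_eq_derive; exact: inside. Qed.
End interior_test.

Section trace.
Context (R : realType) (d : nat).
Local Notation mu := (lebesgue_rV R d.+1).
Local Notation muO := (lebesgue_rV R d).
Local Notation leb := (@lebesgue_measure R).
Variables (Omega : set 'rV[R]_d) (oO : open Omega) (bO : bounded_set Omega).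
Variables (T : R) (T0 : 0 < T).
Local Notation strip := (@strip R d Omega).
Local Notation Q := (strip 0 T).
Local Notation tau := (@tau R d Omega T).
Local Notation dq := (@dq R d Omega T).

Let oQ : open Q. Proof. exact: open_strip. Qed.
Let bQ : bounded_set Q. Proof. exact: bounded_strip. Qed.
Let mQ : measurable Q. Proof. exact: measurable_strip. Qed.
Let mO : measurable Omega. Proof. exact: open_measurable_rV. Qed.

Lemma measurable_slice (F : 'rV[R]_d.+1 -> R) (t : R) : 0 < t < T ->
  measurable_fun Q F -> measurable_fun Omega (fun x => F (rV_rcons (x, t))).
Proof.
move=> tT mF.
have m1 : measurable_fun setT (fun x => (F \_ Q) (rV_rcons (x, t))).
  apply: (measurableT_comp (f := F \_ Q)); first exact/(measurable_restrictT _ mQ).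
  apply: (measurableT_comp (@measurable_rV_rcons R d)).
  exact: pair2_measurable.
apply: (eq_measurable_fun (fun x => (F \_ Q) (rV_rcons (x, t)))).
  move=> x /set_mem Ox; rewrite patchE ifT// inE; apply/stripE.
  by rewrite sp_rcons tm_rcons.
exact: measurable_funTS.
Qed.

Lemma strip_sub h : 0 < h <= T -> strip (T - h) T `<=` Q.
Proof.
move=> /andP[h0 hT] z /stripE[Oz /andP[zh zT]]; apply/stripE; split => //.
by rewrite zT andbT (le_lt_trans _ zh)// subr_ge0.
Qed.

(** For almost every time the slice of [e] is [W t], which is L^2-close to [W T] for
    [t] close to [T]; average over those times. *)
Lemma trace_avg (e : 'rV[R]_d.+1 -> R) (W : R -> 'rV[R]_d -> R)
    (phi : 'rV[R]_d -> R) (h : nat -> R) :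
  inL2 Q e -> H10_continuous_rep Omega T e W -> continuous phi ->
  (forall k, 0 < h k <= T) -> h k @[k --> \oo] --> (0 : R) ->
  (h k)^-1 * (\int[mu]_(z in strip (T - h k) T) (e z * phi (sp z))) @[k --> \oo]
    --> ip Omega (W T) phi.
Proof.
move=> Le [WH Wc Wae] cphi hT hc.
have LW t : 0 <= t <= T -> inL2 Omega (W t).
  by move=> tT; have [[]] := WH t tT.
have Lphi : inL2 Omega phi by exact: inL2_continuous.
have TT : 0 <= T <= T by rewrite (ltW T0) lexx.
pose N := L2norm Omega phi; have N0 : 0 <= N by exact: L2norm_ge0.
apply/cvgrPdist_le => eps eps0.
(* N + 1 in place of N, which may be zero *)
have N1 : 0 < N + 1 by rewrite ltr_wpDl.
have e1 : 0 < eps / (N + 1) by rewrite divr_gt0.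
have [delta d0 Hd] : exists2 delta, 0 < delta & forall t, 0 <= t <= T -> T - delta < t ->
    L2norm Omega (fun x => W t x - W T x) <= eps / (N + 1).
  have [+ _] := Wc T TT.
  move=> /(_ [set u | (u < (eps / (N + 1))%:E)%E]) H.
  have /H : nbhs 0%E [set u | (u < (eps / (N + 1))%:E)%E].
    by apply: open_ereal_lt'; rewrite lte_fin.
  rewrite /= /within /= => /nbhs_ballP[delta /= d0 Hdelta].
  exists delta => // t tT Tt.
  have := Hdelta t; rewrite -ball_normE/= => /(_ _ tT) Hlt.
  have {}Hlt : (L2norme Omega (W t \- W T)%R < (eps / (N + 1))%:E)%E.
    apply: Hlt; have /andP[_ tT'] := tT.
    by rewrite ger0_norm ?subr_ge0// ltrBlDr -ltrBlDl.
  rewrite /L2norm -lee_fin fineK; first exact: ltW.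
  rewrite ge0_fin_numE ?Lnorm_ge0//.
  exact: lt_trans Hlt (ltry _).
near=> k.
have /andP[h0 hT'] := hT k.
have hd : h k < delta by near: k; exact: (cvgr_lt _ hc _ d0).
have LF : inL2 (strip (T - h k) T) (fun z => e z * phi (sp z)).
  apply: (inL2_S mQ) (strip_sub (hT k)) _; first exact: measurable_strip.
  rewrite (_ : (fun _ => _) = fun z => (phi \o @sp R d) z * e z); last first.
    by apply/funext => z; rewrite mulrC.
  apply: inL2_smooth => //.
  by move=> z; apply: continuous_comp; [exact: continuous_sp|exact: cphi].
have iF := integrable_inL2 (@open_strip R d Omega oO (T - h k) T)
  (@bounded_strip R d Omega bO (T - h k) T) LF.
have TkT : T - h k < T by rewrite gtrBl.
have := @fubini_strip_bound R d Omega oO _ (T - h k) T (ip Omega (W T) phi) eps TkT (ltW eps0) iF.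
rewrite opprB addrCA subrr addr0.
have Hae : {ae leb, forall t : R, T - h k < t < T ->
    (`|\int[muO]_(x in Omega) (e (rV_rcons (x, t)) * phi (sp (rV_rcons (x, t))))%:E -
     (ip Omega (W T) phi)%:E| <= eps%:E)%E}.
  apply: (@filterS _ _ (ae_filter_ringOfSetsType leb) _ _ _ Wae) => t Ht /andP[t1 t2].
  have t0 : 0 < t by rewrite (le_lt_trans _ t1)// subr_ge0.
  have tT : 0 < t < T by rewrite t0.
  have tT' : 0 <= t <= T by rewrite !ltW.
  have {}Ht := Ht tT.
  have iWt := inL2_integrable mO (LW t tT') Lphi.
  have -> : (\int[muO]_(x in Omega) (e (rV_rcons (x, t)) * phi (sp (rV_rcons (x, t))))%:E =
      \int[muO]_(x in Omega) (W t x * phi x)%:E)%E.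
    apply: ae_eq_integral => //.
    - apply/measurable_EFinP; apply: measurable_funM.
        by apply: measurable_slice => //; exact: inL2_measurable Le.
      rewrite (_ : (fun _ => _) = phi); last by apply/funext => x; rewrite sp_rcons.
      exact: inL2_measurable Lphi.
    - exact: measurable_int iWt.
    - by apply: filterS Ht => x Hx Ox; rewrite sp_rcons Hx.
  rewrite -(fineK (integrable_fin_num mO iWt)) -EFinB /= lee_fin.
  rewrite -[fine _]/(ip Omega (W t) phi) -(ipBl mO Lphi (LW t tT') (LW T TT)).
  have LB := inL2B mO (LW t tT') (LW T TT).
  apply: le_trans (ip_CS mO LB Lphi) _.
  apply: (@le_trans _ _ (eps / (N + 1) * N)).
    apply: ler_wpM2r => //; apply: Hd => //.
    by apply: lt_trans t1; rewrite ltrD2l ltrN2.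
  rewrite -mulrA ler_piMr ?(ltW eps0)// mulrC ler_pdivrMr// mul1r lerDl//.
move=> /(_ Hae) Hb.
rewrite -(ler_pM2r h0); apply: le_trans Hb.
rewrite -[X in _ * X](gtr0_norm h0) -normrM distrC.
by rewrite le_eqVlt; apply/orP; left; apply/eqP; congr (`| _ |); field; rewrite gt_eqF.
Unshelve. all: by end_near. Qed.

Lemma continuous_comp_sp (phi : 'rV[R]_d -> R) : continuous phi -> continuous (phi \o @sp R d).
Proof. by move=> cphi z; apply: continuous_comp; [exact: continuous_sp|exact: cphi]. Qed.

Lemma strip_sq (phi : 'rV[R]_d -> R) a b : a < b -> continuous phi ->
  ip (strip a b) (phi \o @sp R d) (phi \o @sp R d) = (b - a) * ip Omega phi phi.
Proof.
move=> ab cphi; have Lphi : inL2 Omega phi by exact: inL2_continuous.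
have Lsp : inL2 (strip a b) (phi \o @sp R d).
  by apply: inL2_continuous; [exact: measurable_strip|exact: bounded_strip|exact: continuous_comp_sp].
have ms : measurable (strip a b) by exact: measurable_strip.
have := fubini_strip_bound oO (c := ip Omega phi phi) ab (lexx 0) (inL2_integrable ms Lsp Lsp).
rewrite mul0r => H; apply/eqP; rewrite -subr_eq0 -normr_le0 [(b - a) * _]mulrC; apply: H.
apply: nearW => t _ /=.
have iphi := inL2_integrable mO Lphi Lphi.
under eq_integral do rewrite sp_rcons.
rewrite -(fineK (integrable_fin_num mO iphi)) -EFinB /= -[fine _]/(ip Omega phi phi).
by rewrite subrr normr0.
Qed.

(** Two squares are nonnegative: that of [w - tau h w] gives
    [<w, w - tau h w> >= (|w|^2 - |tau h w|^2) / 2], which is at least half of the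
    mass of [w] near time [T] by [ip_strip_split], and that of [w - phi] makes the
    bound linear in [w].  Linearity is what lets it pass to the limit of averages. *)
Lemma dq_energy_ge (w : 'rV[R]_d.+1 -> R) (phi : 'rV[R]_d -> R) h :
  inL2 Q w -> continuous phi -> 0 < h <= T ->
  h^-1 * (\int[mu]_(z in strip (T - h) T) (w z * phi (sp z))) - 2^-1 * ip Omega phi phi
  <= ip Q w (dq h w).
Proof.
move=> Lw cphi hT; have /andP[h0 hT'] := hT.
have h0' := ltW h0; have Lt := inL2_tau oO h0' Lw.
have ms : measurable (strip (T - h) T) by exact: measurable_strip.
have Lws : inL2 (strip (T - h) T) w by apply: (inL2_S mQ ms) Lw; exact: strip_sub.
have Lsp : inL2 (strip (T - h) T) (phi \o @sp R d).
  by apply: inL2_continuous; [exact: measurable_strip|exact: bounded_strip|exact: continuous_comp_sp].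
have E1 : ip Q w (dq h w) = h^-1 * (ip Q w w - ip Q w (tau h w)).
  by rewrite ipZr//; [rewrite ipBr|exact: inL2B].
have I1 : 0 <= ip Q w w - 2 * ip Q w (tau h w) + ip Q (tau h w) (tau h w).
  have := ip_ge0 Q (fun x => w x - tau h w x); have LB := inL2B mQ Lw Lt.
  by rewrite ipBl// !ipBr// (ipC Q (tau h w) w) => H; apply: le_trans H _; lra.
have hhT : 0 <= h <= T by rewrite h0'.
have I2 := ip_strip_split oO hhT Lw.
have I3 : 0 <= ip (strip (T - h) T) w w -
    2 * ip (strip (T - h) T) w (phi \o @sp R d) + h * ip Omega phi phi.
  have := ip_ge0 (strip (T - h) T) (fun x => w x - (phi \o @sp R d) x).
  have LB := inL2B ms Lws Lsp.
  rewrite ipBl// !ipBr// (ipC _ (phi \o @sp R d) w) strip_sq ?gtrBl//.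
  by rewrite subKr => H; apply: le_trans H _; lra.
rewrite E1 -(ler_pM2l h0) mulrBr !mulrA mulfV ?gt_eqF// !mul1r.
rewrite -[X in X - _]/(ip (strip (T - h) T) w (phi \o @sp R d)).
lra.
Qed.

Lemma tau_slab u h z : 0 <= h -> Q z -> tau h u z = u (tshift h z) * \1_(slab h T) z.
Proof.
move=> h0 /stripE[Oz /andP[z0 zT]].
rewrite indicE; have [hz|zh] := ltP h (tm z).
  rewrite mem_set ?mulr1; last by rewrite /slab/= hz.
  rewrite tau_in//; apply/stripE; rewrite sp_tshift tm_tshift subr_gt0 hz; split => //.
  by rewrite (le_lt_trans _ zT)// gerBl.
rewrite memNset ?mulr0; last by rewrite /slab/= ltNge zh.
rewrite tau_out// => /stripE[_ /andP[+ _]].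
by rewrite tm_tshift subr_gt0 ltNge zh.
Qed.

Lemma ip_tauE F u h : 0 <= h ->
  ip Q F (tau h u) = \int[mu]_(z in strip h T) (F z * u (tshift h z)).
Proof.
move=> h0; rewrite -(Rintegral_slab Omega _ h0 (lexx T)).
by apply: eq_Rintegral => z /set_mem Qz; rewrite tau_slab// mulrA.
Qed.

Lemma tau_cvg (phi : nat -> 'rV[R]_d.+1 -> R) w h : 0 <= h <= T ->
  (forall j, inL2 Q (phi j)) -> inL2 Q w ->
  L2norm Q (fun z => phi j z - w z) @[j --> \oo] --> (0 : R) ->
  L2norm Q (fun z => tau h (phi j) z - tau h w z) @[j --> \oo] --> (0 : R).
Proof.
move=> hT Lphi Lw; apply: squeeze_cvgr; last exact: cvg_cst.
apply: nearW => j; rewrite L2norm_ge0/=.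
rewrite (eq_L2norm (v := tau h (fun z => phi j z - w z))).
  by apply: L2norm_tau => //; exact: inL2B.
by move=> z _; rewrite tauB.
Qed.

(** For a smooth [phi] vanishing near the lateral boundary, [tau h phi] is smooth in
    space, and its jump at time [h] does not matter: it is enough to integrate by
    parts on the strip of times between [h] and [T].  Then pass to the limit in the
    approximants. *)
Lemma ibp_tau (y : 'rV[R]_d.+1 -> 'rV[R]_d) g (phi : nat -> 'rV[R]_d.+1 -> R)
    w (wx : 'I_d -> 'rV[R]_d.+1 -> R) h : 0 <= h <= T ->
  (forall i, inL2 Q (fun z => y z ord0 i)) -> is_divx Omega T y g ->
  (forall j, smooth (phi j)) ->
  (forall j, exists U, [/\ open U, lateral Omega T `<=` U & forall x, U x -> phi j x = 0]) ->
  inL2 Q w -> (forall i, inL2 Q (wx i)) ->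
  L2norm Q (fun z => phi j z - w z) @[j --> \oo] --> (0 : R) ->
  (forall i, L2norm Q (fun z => pderiv (xdir i) (phi j) z - wx i z) @[j --> \oo] --> (0 : R)) ->
  \sum_(i < d) ip Q (fun z => y z ord0 i) (tau h (wx i)) = - ip Q g (tau h w).
Proof.
move=> hT Ly dy sphi phi0 Lw Lwx cw cwx; have /andP[h0 hT'] := hT.
have Lg : inL2 Q g by case: dy.
have Lphi j : inL2 Q (phi j) by exact: inL2_continuous (smooth_cont (sphi j)).
have Ldphi j i : inL2 Q (pderiv (xdir i) (phi j)).
  by apply: inL2_continuous => //; apply: smooth_cont; exact: smooth_pderiv.
have HL i (r : R) (z : 'rV[R]_d.+1) : tshift h (r *: unit_rV R i + z) = r *: unit_rV R i + tshift h z.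
  by rewrite /tshift addrA.
have Hj j : \sum_(i < d) ip Q (fun z => y z ord0 i) (tau h (pderiv (xdir i) (phi j))) =
    - ip Q g (tau h (phi j)).
  have szeta : smooth (phi j \o tshift h).
    move=> k; apply: Ck_comp; [exact: continuous_tshift| |exact: sphi].
    by move=> i; left; exists i => r z; exact: HL.
  have zlat z : boundary Omega (sp z) -> h < tm z < T ->
      \forall w \near z, (phi j \o tshift h) w = 0.
    move=> bz /andP[hz zT]; have [U [oU latU U0]] := phi0 j.
    have : nbhs z (tshift h @^-1` U).
      apply: continuous_tshift; apply: open_nbhs_nbhs; split => //; apply: latU.
      rewrite /lateral /spacetime/=; split.
        by have := bz; rewrite -(sp_tshift h).
      rewrite -/(tm (tshift h z)) in_itv/= tm_tshift subr_gt0 hz/=.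
      by rewrite (le_lt_trans _ zT)// gerBl.
    by apply: filterS => x /= /U0.
  have := @ibp_strip R d Omega oO bO T h T y g (phi j \o tshift h) h0 (lexx T) Ly dy szeta zlat.
  rewrite -(ip_tauE _ _ h0) => <-.
  rewrite -(Rintegral_slab Omega _ h0 (lexx T)).
  rewrite -(@Rintegral_sum _ _ _ _ _ mQ _ _ (fun i z => y z ord0 i * tau h (pderiv (xdir i) (phi j)) z)).
    apply: eq_Rintegral => z /set_mem Qz; rewrite mulr_suml; apply: eq_bigr => i _.
    rewrite tau_slab// mulrA; congr (_ * _ * _).
    by rewrite (pderiv_comp _ (HL (xdir i))).
  by move=> i; apply: inL2_integrable => //; exact: inL2_tau.
have CL : (fun j => \sum_(i < d) ip Q (fun z => y z ord0 i) (tau h (pderiv (xdir i) (phi j)))) @ \oo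
    --> \sum_(i < d) ip Q (fun z => y z ord0 i) (tau h (wx i)).
  apply: cvg_sumr => i; under eq_fun do rewrite ipC; rewrite ipC.
  apply: ip_cvg => //; [|exact: inL2_tau|exact: tau_cvg].
  by move=> j; exact: inL2_tau.
have CR : (fun j => - ip Q g (tau h (phi j))) @ \oo --> - ip Q g (tau h w).
  apply: cvgN; under eq_fun do rewrite ipC; rewrite ipC.
  apply: ip_cvg => //; [|exact: inL2_tau|exact: tau_cvg].
  by move=> j; exact: inL2_tau.
move: CL; under eq_fun do rewrite Hj.
by move=> /cvg_lim <-//; apply/cvg_lim.
Qed.

(** A weak derivative in a spatial direction is the divergence of a field with a
    single component, so that [ibp_strip] applies to both. *)
Lemma is_wderiv_divx e i g : is_wderiv Q (xdir i) e g ->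
  is_divx Omega T (fun z => e z *: unit_rV R i) g.
Proof.
move=> [Lg H]; split => // phi tphi; rewrite -H//; apply: eq_Rintegral => z _.
rewrite (bigD1 i)//= !mxE/= eqxx mulr1 big1 ?addr0// => j ji.
by rewrite !mxE/= (negbTE ji) mulr0 mul0r.
Qed.

Lemma pderiv_vanish (psi : 'rV[R]_d -> R) i :
  (exists U, [/\ open U, boundary Omega `<=` U & forall x, U x -> psi x = 0]) ->
  exists U, [/\ open U, boundary Omega `<=` U & forall x, U x -> pderiv i psi x = 0].
Proof.
move=> [U [oU bU U0]]; exists U; split => // x Ux.
rewrite /pderiv (near_eq_derive (g := cst 0)) ?derive_cst//.
have : nbhs x U by exact: open_nbhs_nbhs.
by apply: filterS => y /U0.
Qed.

(** The trace of a spatial derivative of [e] is the derivative of the trace: move the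
    derivative to [psi] by [ibp_strip] on the strip of the last times, apply
    [trace_avg], and move it back on [Omega]. *)
Lemma grad_trace (e : 'rV[R]_d.+1 -> R) (W : R -> 'rV[R]_d -> R) i g G
    (psi : 'rV[R]_d -> R) (h : nat -> R) :
  inL2 Q e -> H10_continuous_rep Omega T e W ->
  is_wderiv Q (xdir i) e g -> is_wderiv Omega i (W T) G ->
  smooth psi ->
  (exists U, [/\ open U, boundary Omega `<=` U & forall x, U x -> psi x = 0]) ->
  (forall k, 0 < h k <= T) -> h k @[k --> \oo] --> (0 : R) ->
  (h k)^-1 * (\int[mu]_(z in strip (T - h k) T) (g z * psi (sp z))) @[k --> \oo]
    --> ip Omega G psi.
Proof.
move=> Le HW Hg HG spsi psi0 hT hc.
have sdpsi := smooth_pderiv i spsi.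
have := trace_avg Le HW (smooth_cont sdpsi) hT hc => /cvgN.
have -> : - ip Omega (W T) (pderiv i psi) = ip Omega G psi.
  have [_ /(_ _ (test_extend0 oO bO spsi psi0))] := HG.
  rewrite (eq_Rintegral _ (g := fun x => W T x * pderiv i psi x)); last first.
    by move=> x /set_mem Ox; rewrite pderiv_extend0.
  rewrite /ip => ->; rewrite opprK; apply: eq_Rintegral => x /set_mem Ox.
  by rewrite extend0E.
apply: cvg_trans; apply: near_eq_cvg; apply: nearW => k /=.
rewrite -mulrN; congr (_ * _).
have /andP[h0 hT'] := hT k.
have Ly j : inL2 Q (fun z => (e z *: unit_rV R i) ord0 j).
  rewrite (_ : (fun _ => _) = fun z => (i == j)%:R * e z); first exact: inL2Z.
  by apply/funext => z; rewrite !mxE/= mulrC eq_sym.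
have Tk0 : 0 <= T - h k by rewrite subr_ge0.
have szeta : smooth (psi \o @sp R d).
  move=> m; apply: Ck_comp; [exact: continuous_sp| |exact: spsi].
  move=> j; case: (unliftP ord_max j) => [l ->|->].
    by left; exists l => r z; exact: sp_xdir.
  by right => r z; exact: sp_tdir.
have zlat z : boundary Omega (sp z) -> T - h k < tm z < T ->
    \forall w \near z, (psi \o @sp R d) w = 0.
  move=> bz _; have [U [oU bU U0]] := psi0.
  have : nbhs z (@sp R d @^-1` U).
    by apply: continuous_sp; apply: open_nbhs_nbhs; split => //; exact: bU.
  by apply: filterS => x /= /U0.
have := @ibp_strip R d Omega oO bO T (T - h k) T _ g (psi \o @sp R d) Tk0 (lexx T) Ly
  (is_wderiv_divx Hg) szeta zlat.
move=> /(congr1 -%R); rewrite opprK => <-; congr (- _).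
apply: eq_Rintegral => z _.
rewrite (bigD1 i)//= !mxE/= eqxx mulr1 big1 ?addr0; last first.
  by move=> j ji; rewrite !mxE/= (negbTE ji) mulr0 mul0r.
by rewrite (pderiv_comp _ (fun r z => sp_xdir r i z)).
Qed.

Let hs (k : nat) : R := T / k.+1%:R.
Let hsT k : 0 < hs k <= T.
Proof.
rewrite divr_gt0//= ler_pdivrMr// ler_peMr ?(ltW T0)// ler1n//.
Qed.
Let hsc : hs k @[k --> \oo] --> (0 : R).
Proof.
by rewrite -(mulr0 T); apply: cvgM; [exact: cvg_cst|exact: cvg_harmonic].
Qed.

Variables (e et : 'rV[R]_d.+1 -> R) (W : R -> 'rV[R]_d -> R).
Hypotheses (Le : inL2 Q e) (Let_ : inL2 Q et).
Hypothesis HW : H10_continuous_rep Omega T e W.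
Hypothesis Hdq : forall h : nat -> R, (forall k, 0 < h k <= T) ->
  h k @[k --> \oo] --> (0 : R) ->
  L2norm Q (fun z => dq (h k) e z - et z) @[k --> \oo] --> (0 : R).

Let LW : inL2 Omega (W T).
Proof.
have [H _ _] := HW; have TT : 0 <= T <= T by rewrite (ltW T0) lexx.
by have [[]] := H T TT.
Qed.

Let Ldq k : inL2 Q (dq (hs k) e).
Proof. by apply: inL2_dq => //; have /andP[/ltW] := hsT k. Qed.

Lemma ip_dq_cvg w : inL2 Q w -> ip Q w (dq (hs k) e) @[k --> \oo] --> ip Q w et.
Proof.
move=> Lw; under eq_fun do rewrite ipC; rewrite ipC.
by apply: ip_cvg => //; exact: Hdq.
Qed.

(** The lower bound [<W T, phi> - |phi|^2 / 2] becomes [|W T|^2 / 2] as [phi] tends to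
    [W T]. *)
Lemma energy_trace (phi : nat -> 'rV[R]_d -> R) :
  (forall j, smooth (phi j)) ->
  L2norm Omega (fun x => phi j x - W T x) @[j --> \oo] --> (0 : R) ->
  2^-1 * ip Omega (W T) (W T) <= ip Q e et.
Proof.
move=> sphi cphi.
have Lphi j : inL2 Omega (phi j) by exact: inL2_continuous (smooth_cont (sphi j)).
have H j : ip Omega (W T) (phi j) - 2^-1 * ip Omega (phi j) (phi j) <= ip Q e et.
  have C1 := trace_avg Le HW (smooth_cont (sphi j)) hsT hsc.
  have C2 : (hs k)^-1 * (\int[mu]_(z in strip (T - hs k) T) (e z * phi j (sp z))) -
      2^-1 * ip Omega (phi j) (phi j) @[k --> \oo] -->
      ip Omega (W T) (phi j) - 2^-1 * ip Omega (phi j) (phi j).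
    by apply: cvgB; [exact: C1|exact: cvg_cst].
  apply: (ler_cvg_to C2 (ip_dq_cvg Le)); apply: nearW => k.
  by apply: dq_energy_ge => //; exact: smooth_cont.
have C : ip Omega (W T) (phi j) - 2^-1 * ip Omega (phi j) (phi j) @[j --> \oo] -->
    ip Omega (W T) (W T) - 2^-1 * ip Omega (W T) (W T).
  apply: cvgB; first by under eq_fun do rewrite ipC; exact: ip_cvg.
  by apply: cvgM; [exact: cvg_cst|exact: ipxx_cvg].
have -> : 2^-1 * ip Omega (W T) (W T) = ip Omega (W T) (W T) - 2^-1 * ip Omega (W T) (W T).
  by field.
by apply: (cvgr_to_le C); exact: nearW.
Qed.

(** [ibp_tau] at the shifts 0 and [h]. *)
Lemma ibp_dq (y : 'rV[R]_d.+1 -> 'rV[R]_d) g (phi : nat -> 'rV[R]_d.+1 -> R)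
    w (wx : 'I_d -> 'rV[R]_d.+1 -> R) h : 0 < h <= T ->
  (forall i, inL2 Q (fun z => y z ord0 i)) -> is_divx Omega T y g ->
  (forall j, smooth (phi j)) ->
  (forall j, exists U, [/\ open U, lateral Omega T `<=` U & forall x, U x -> phi j x = 0]) ->
  inL2 Q w -> (forall i, inL2 Q (wx i)) ->
  L2norm Q (fun z => phi j z - w z) @[j --> \oo] --> (0 : R) ->
  (forall i, L2norm Q (fun z => pderiv (xdir i) (phi j) z - wx i z) @[j --> \oo] --> (0 : R)) ->
  \sum_(i < d) ip Q (fun z => y z ord0 i) (wx i) = - ip Q g w /\
  \sum_(i < d) ip Q (fun z => y z ord0 i) (dq h (wx i)) = - ip Q g (dq h w).
Proof.
move=> /andP[h0 hT] Ly dy sphi phi0 Lw Lwx cw cwx; have [Lg _] := dy.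
have h01 : 0 <= h <= T by rewrite (ltW h0).
have zz : (0 : R) <= 0 <= T by apply/andP; split => //; exact: ltW.
have t0 u z : Q z -> tau 0 u z = u z.
  move=> Qz; rewrite tau_in /tshift ?scale0r ?subr0//.
have H0 := ibp_tau zz Ly dy sphi phi0 Lw Lwx cw cwx.
have Hh := ibp_tau h01 Ly dy sphi phi0 Lw Lwx cw cwx.
have {}H0 : \sum_(i < d) ip Q (fun z => y z ord0 i) (wx i) = - ip Q g w.
  rewrite ipC -(eq_ip _ (fun z Qz => t0 w z Qz)) ipC -H0.
  by apply: eq_bigr => i _; rewrite ipC -(eq_ip _ (fun z Qz => t0 (wx i) z Qz)) ipC.
split => //.
have hh := ltW h0.
have Ew v u : inL2 Q v -> inL2 Q u -> ip Q v (dq h u) = h^-1 * (ip Q v u - ip Q v (tau h u)).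
  by move=> Lv Lu; have Lt := inL2_tau oO hh Lu; rewrite ipZr//; [rewrite ipBr|exact: inL2B].
under eq_bigr do rewrite Ew//.
by rewrite -mulr_sumr sumrB H0 Hh Ew//; ring.
Qed.

(** The argument of [energy_trace], for each spatial derivative.  The approximants
    [psi j] of [W T] vanish near the boundary; this is what [grad_trace] requires of
    their derivatives, which play the part of [phi]. *)
Lemma energy_grad_trace (phiL : nat -> 'rV[R]_d.+1 -> R) (psi : nat -> 'rV[R]_d -> R)
    (y : 'rV[R]_d.+1 -> 'rV[R]_d) l (G : 'I_d -> 'rV[R]_d -> R) :
  (forall i, is_wderiv Q (xdir i) e (fun z => y z ord0 i)) ->
  is_divx Omega T y l ->
  (forall j, smooth (phiL j)) ->
  (forall j, exists U, [/\ open U, lateral Omega T `<=` U & forall x, U x -> phiL j x = 0]) ->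
  L2norm Q (fun z => phiL j z - e z) @[j --> \oo] --> (0 : R) ->
  (forall i, L2norm Q (fun z => pderiv (xdir i) (phiL j) z - y z ord0 i) @[j --> \oo] --> (0 : R)) ->
  (forall i, is_wderiv Omega i (W T) (G i)) ->
  (forall j, smooth (psi j)) ->
  (forall j, exists U, [/\ open U, boundary Omega `<=` U & forall x, U x -> psi j x = 0]) ->
  (forall i, L2norm Omega (fun x => pderiv i (psi j) x - G i x) @[j --> \oo] --> (0 : R)) ->
  2^-1 * \sum_(i < d) ip Omega (G i) (G i) <= - ip Q l et.
Proof.
move=> Hy dy sphi phi0 ce cy HG spsi psi0 cpsi; have [Ll _] := dy.
have Ly i : inL2 Q (fun z => y z ord0 i) by case: (Hy i).
have LG i : inL2 Omega (G i) by case: (HG i).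
have Ldpsi j i : inL2 Omega (pderiv i (psi j)).
  by apply: inL2_continuous => //; apply: smooth_cont; exact: smooth_pderiv.
have H j : \sum_(i < d) (ip Omega (G i) (pderiv i (psi j)) -
    2^-1 * ip Omega (pderiv i (psi j)) (pderiv i (psi j))) <= - ip Q l et.
  have C1 : \sum_(i < d) ((hs k)^-1 *
        (\int[mu]_(z in strip (T - hs k) T) (y z ord0 i * pderiv i (psi j) (sp z))) -
      2^-1 * ip Omega (pderiv i (psi j)) (pderiv i (psi j))) @[k --> \oo] -->
      \sum_(i < d) (ip Omega (G i) (pderiv i (psi j)) -
        2^-1 * ip Omega (pderiv i (psi j)) (pderiv i (psi j))).
    apply: cvg_sumr => i; apply: cvgB; last exact: cvg_cst.
    apply: (grad_trace Le HW (Hy i) (HG i)) => //; first exact: smooth_pderiv.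
    exact: pderiv_vanish.
  have C2 : - ip Q l (dq (hs k) e) @[k --> \oo] --> - ip Q l et.
    by apply: cvgN; exact: ip_dq_cvg.
  apply: (ler_cvg_to C1 C2); apply: nearW => k /=.
  have [_ <-] := ibp_dq (hsT k) Ly dy sphi phi0 Le Ly ce cy.
  apply: ler_sum => i _; apply: dq_energy_ge => //.
  by apply: smooth_cont; exact: smooth_pderiv.
have C : \sum_(i < d) (ip Omega (G i) (pderiv i (psi j)) -
      2^-1 * ip Omega (pderiv i (psi j)) (pderiv i (psi j))) @[j --> \oo] -->
    \sum_(i < d) (ip Omega (G i) (G i) - 2^-1 * ip Omega (G i) (G i)).
  apply: cvg_sumr => i; apply: cvgB.
    by under eq_fun do rewrite ipC; exact: ip_cvg.
  by apply: cvgM; [exact: cvg_cst|exact: ipxx_cvg].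
have -> : 2^-1 * \sum_(i < d) ip Omega (G i) (G i) =
    \sum_(i < d) (ip Omega (G i) (G i) - 2^-1 * ip Omega (G i) (G i)).
  by rewrite mulr_sumr; apply: eq_bigr => i _; field.
apply: (cvgr_to_le C); apply: nearW => j /=.
exact: H.
Qed.
End trace.

(** * Uniqueness of weak derivatives and divergences *)

Section weak_derivatives.
Context (R : realType) (n : nat) (D : set 'rV[R]_n).
Hypotheses (oD : open D) (bD : bounded_set D).
Local Notation mu := (lebesgue_rV R n).
Let mD := open_measurable_rV oD.
Implicit Types (u v g : 'rV[R]_n -> R).

Lemma wderiv_spec i u : (exists g, is_wderiv D i u g) -> is_wderiv D i u (wderiv D i u).
Proof. by move=> [g Hg]; exact: (xgetPex (cst 0) (ex_intro _ g Hg)). Qed.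

Lemma test_inL2 phi : test_fun D phi -> inL2 D phi.
Proof. by move=> [sphi _]; apply: inL2_continuous => //; exact: smooth_cont. Qed.

Lemma test_pderiv_inL2 i phi : test_fun D phi -> inL2 D (pderiv i phi).
Proof.
by move=> [sphi _]; apply: inL2_continuous => //; apply: smooth_cont; exact: smooth_pderiv.
Qed.

Lemma ae_eq_test g1 g2 : inL2 D g1 -> inL2 D g2 ->
  (forall phi, test_fun D phi -> ip D g1 phi = ip D g2 phi) ->
  {ae mu, forall x, D x -> g1 x = g2 x}.
Proof.
move=> L1 L2 H; have LB := inL2B mD L1 L2.
have : {ae mu, forall x, D x -> g1 x - g2 x = 0}.
  apply: (fundamental_lemma oD bD LB) => phi tphi.
  rewrite -[LHS]/(ip D (fun x => g1 x - g2 x) phi) ipBl ?H ?subrr//.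
  exact: test_inL2.
by apply: filterS => x Hx /Hx /eqP; rewrite subr_eq0 => /eqP.
Qed.

Lemma wderiv_uniq i u g1 g2 : is_wderiv D i u g1 -> is_wderiv D i u g2 ->
  {ae mu, forall x, D x -> g1 x = g2 x}.
Proof.
move=> [L1 H1] [L2 H2]; apply: ae_eq_test => // phi tphi.
by apply: oppr_inj; rewrite -[LHS]H1// -[RHS]H2.
Qed.

Lemma is_wderivB i u v g1 g2 : inL2 D u -> inL2 D v ->
  is_wderiv D i u g1 -> is_wderiv D i v g2 ->
  is_wderiv D i (fun x => u x - v x) (fun x => g1 x - g2 x).
Proof.
move=> Lu Lv [L1 H1] [L2 H2]; split; first exact: inL2B.
move=> phi tphi; have Lphi := test_inL2 tphi; have Ldphi := test_pderiv_inL2 i tphi.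
rewrite -[LHS]/(ip D (fun x => u x - v x) (pderiv i phi)).
rewrite -[X in - X]/(ip D (fun x => g1 x - g2 x) phi) !ipBl//.
by rewrite /ip H1// H2//; ring.
Qed.
(** The gradients are those of the chosen representatives for [u] and [v]
    separately: the limit is the difference of the two, without reference to the
    representative chosen for [u - v]. *)
Lemma zero_onB Gamma u v :
  sobolev D setT u -> sobolev D setT v ->
  zero_on D setT Gamma u -> zero_on D setT Gamma v ->
  exists phi : nat -> 'rV[R]_n -> R, [/\ forall j, smooth (phi j),
    forall j, exists U, [/\ open U, Gamma `<=` U & forall x, U x -> phi j x = 0],
    L2norm D (fun x => phi j x - (u x - v x)) @[j --> \oo] --> (0 : R) &
    forall i, L2norm D (fun x => pderiv i (phi j) x - (wderiv D i u x - wderiv D i v x))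
      @[j --> \oo] --> (0 : R)].
Proof.
move=> [Lu Hu] [Lv Hv] [p [sp p0 cp cdp]] [q [sq q0 cq cdq]].
have Ls f : smooth f -> inL2 D f by move=> sf; exact: inL2_continuous (smooth_cont sf).
have Lwu i : inL2 D (wderiv D i u) by case: (wderiv_spec (Hu i I)).
have Lwv i : inL2 D (wderiv D i v) by case: (wderiv_spec (Hv i I)).
exists (fun j x => p j x - q j x); split.
- by move=> j; exact: smoothB.
- move=> j; have [U [oU GU U0]] := p0 j; have [V [oV GV V0]] := q0 j.
  exists (U `&` V); split; first exact: openI.
    by move=> x Gx; split; [exact: GU|exact: GV].
  by move=> x [Ux Vx]; rewrite U0// V0// subrr.
- apply: L2norm_cvgB => //; [by move=> j; exact: Ls..| |].
    exact: L2norm_cvg.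
  exact: L2norm_cvg.
- move=> i.
  have Lp j : inL2 D (pderiv i (p j)) by apply: Ls; exact: smooth_pderiv.
  have Lq j : inL2 D (pderiv i (q j)) by apply: Ls; exact: smooth_pderiv.
  have := L2norm_cvgB mD Lp Lq (Lwu i) (Lwv i) (L2norm_cvg (cdp i I))
    (L2norm_cvg (cdq i I)).
  apply: cvg_trans; apply: near_eq_cvg; apply: nearW => j.
  apply: eq_L2norm => x _; congr (_ - _).
  rewrite (_ : (fun x => p j x - q j x) = p j - q j)//.
  by rewrite pderivB//; move=> z; exact: smooth_derivable.
Qed.
End weak_derivatives.

Section divergence.
Context (R : realType) (d : nat) (Omega : set 'rV[R]_d) (T : R).
Hypotheses (oO : open Omega) (bO : bounded_set Omega).
Local Notation mu := (lebesgue_rV R d.+1).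
Local Notation Q := (strip Omega 0 T).
Let oQ : open Q. Proof. exact: open_strip. Qed.
Let bQ : bounded_set Q. Proof. exact: bounded_strip. Qed.
Let mQ : measurable Q. Proof. exact: measurable_strip. Qed.
Implicit Types (y : 'rV[R]_d.+1 -> 'rV[R]_d) (g : 'rV[R]_d.+1 -> R).

Lemma divx_spec y : (exists g, is_divx Omega T y g) -> is_divx Omega T y (divx Omega T y).
Proof. by move=> [g Hg]; exact: (xgetPex (cst 0) (ex_intro _ g Hg)). Qed.

Lemma divx_uniq y g1 g2 : is_divx Omega T y g1 -> is_divx Omega T y g2 ->
  {ae mu, forall z, Q z -> g1 z = g2 z}.
Proof.
move=> [L1 H1] [L2 H2]; apply: (ae_eq_test oQ bQ) => // phi tphi.
by apply: oppr_inj; rewrite -[LHS]H1// -[RHS]H2.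
Qed.

Lemma is_divxB y y' g g' :
  (forall i, inL2 Q (fun z => y z ord0 i)) -> (forall i, inL2 Q (fun z => y' z ord0 i)) ->
  is_divx Omega T y g -> is_divx Omega T y' g' ->
  is_divx Omega T (fun z => y z - y' z) (fun z => g z - g' z).
Proof.
move=> Ly Ly' [L1 H1] [L2 H2]; split; first exact: inL2B.
move=> phi tphi.
have Lphi := test_inL2 oQ bQ tphi; have Ldphi i := test_pderiv_inL2 oQ bQ i tphi.
rewrite -[X in - X]/(ip Q (fun x => g x - g' x) phi) !ipBl// opprB addrC.
have E1 : - ip Q g phi = \int[mu]_(z in Q) (\sum_(i < d) y z ord0 i * pderiv (xdir i) phi z).
  exact: esym (H1 _ tphi).
have E2 : ip Q g' phi = - \int[mu]_(z in Q) (\sum_(i < d) y' z ord0 i * pderiv (xdir i) phi z).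
  by apply: oppr_inj; rewrite opprK; exact: esym (H2 _ tphi).
rewrite E1 E2.
have iS (w : 'rV[R]_d.+1 -> 'rV[R]_d) : (forall i, inL2 Q (fun z => w z ord0 i)) ->
    \int[mu]_(z in Q) (\sum_(i < d) w z ord0 i * pderiv (xdir i) phi z) =
    \sum_(i < d) ip Q (fun z => w z ord0 i) (pderiv (xdir i) phi).
  move=> Lw; rewrite (@Rintegral_sum _ _ _ _ _ mQ _ _
    (fun i z => w z ord0 i * pderiv (xdir i) phi z))//.
  by move=> i; exact: inL2_integrable.
have LB i : inL2 Q (fun z => (y z - y' z) ord0 i).
  rewrite (_ : (fun _ => _) = fun z => y z ord0 i - y' z ord0 i); first exact: inL2B.
  by apply/funext => z; rewrite !mxE.
rewrite !iS// -sumrB; apply: eq_bigr => i _.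
rewrite -ipBl//; apply: eq_ip => z _; by rewrite !mxE.
Qed.
End divergence.

(** * Young's inequality and optimal weights *)

Section algebra.
Context (R : realType).
Implicit Types (x y s a gamma : R).

(** The gap is [gamma (x + y - s / gamma)^2 + gamma (a x - y)^2 / a]. *)
Lemma young_split x y s a gamma : 0 < a -> 0 < gamma ->
  2 * ((x + y) * s) <= gamma^-1 * s ^+ 2 + gamma * ((1 + a) * x ^+ 2 + (1 + a^-1) * y ^+ 2).
Proof.
move=> a0 g0; rewrite -subr_ge0.
have -> : gamma^-1 * s ^+ 2 + gamma * ((1 + a) * x ^+ 2 + (1 + a^-1) * y ^+ 2) - 2 * ((x + y) * s) =
   gamma * (x + y - s / gamma) ^+ 2 + gamma * ((a * x - y) ^+ 2 / a).
  by field; rewrite !gt_eqF.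
have gp := ltW g0; have ai : 0 <= a^-1 by rewrite invr_ge0 ltW.
apply: addr_ge0; apply: mulr_ge0 => //; first exact: sqr_ge0.
by apply: mulr_ge0 => //; exact: sqr_ge0.
Qed.

(** [g], [t], [ET], [GT], [ne] stand for the norms of [grad e] and [dt e], the squared
    norms of [E T] and of its gradient, and the norm of [e].  The two energy
    inequalities are doubled, the second one multiplied by [delta], and Young's
    inequality is applied to both right-hand sides. *)
Lemma majorant_of_energies (CF delta nd ndiv neq g t ET GT ne a1 a2 gamma : R) :
  0 < delta -> 0 <= neq -> ne <= CF * g -> 0 < a1 -> 0 < a2 -> 2^-1 <= gamma ->
  2^-1 * ET + g ^+ 2 <= neq * ne + nd * g ->
  2^-1 * GT + t ^+ 2 <= neq * t + ndiv * t ->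
  (2 - gamma^-1) * (g ^+ 2 + delta * t ^+ 2) + delta * GT + ET <=
  gamma * majorant CF delta nd ndiv neq a1 a2.
Proof.
move=> d0 neq0 neg a10 a20 g2 H1 H2.
have g0 : 0 < gamma by apply: lt_le_trans g2; rewrite invr_gt0.
have Y1 := young_split nd (CF * neq) g a10 g0.
have Y2 := young_split ndiv neq t a20 g0.
have H1' := le_trans H1 (lerD (ler_wpM2l neq0 neg) (lexx _)).
have {}Y2 := ler_wpM2l (ltW d0) Y2.
have {}H2 := ler_wpM2l (ltW d0) H2.
rewrite /majorant exprMn in Y1 *.
move: Y1 Y2 H1' H2; move: (gamma^-1) (a1^-1) (a2^-1) => ig i1 i2; lra.
Qed.

(** Linear combination of the error equation tested with [e] ([ete], [le], [re] and
    [dre] being the products of its terms with [e]), Green's formulas for [l] and for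
    [r_d], the trace inequality and Cauchy-Schwarz. *)
Lemma first_energy (g nd neq ne ET ete le re dre rdg : R) :
  ete - le = re - dre -> g ^+ 2 = - le -> rdg = - dre ->
  2^-1 * ET <= ete -> re <= neq * ne -> rdg <= nd * g ->
  2^-1 * ET + g ^+ 2 <= neq * ne + nd * g.
Proof. by move=> *; lra. Qed.

(** The same with the time derivative of [e] as test function. *)
Lemma second_energy (t ndiv neq GT ett lt rt drt : R) :
  ett - lt = rt - drt -> t ^+ 2 = ett ->
  2^-1 * GT <= - lt -> rt <= neq * t -> - drt <= ndiv * t ->
  2^-1 * GT + t ^+ 2 <= neq * t + ndiv * t.
Proof. by move=> *; lra. Qed.

Lemma residual_identity (dv lv dy du lu fz : R) : du - lu = fz ->
  (du - dv) - (lu - lv) = (fz - dv + dy) - (dy - lv).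
Proof. by move=> <-; ring. Qed.

(** The excess over the value at [B / A] is [k (b A - B)^2 / b], a weighted square
    that vanishes only there. *)
Lemma balanced_weight_minimal (A B c k : R) (m : R -> R) : 0 < k -> 0 < A -> 0 < B / A ->
  (forall a, 0 < a -> m a = c + k * (a * A ^+ 2 + B ^+ 2 / a)) -> forall a, 0 < a ->
  (forall b, 0 < b -> m a <= m b) <-> a = B / A.
Proof.
move=> k0 A0 BA0 Hm a a0.
have E b : 0 < b -> m b - m (B / A) = k * ((b * A - B) ^+ 2 / b).
  move=> b0; rewrite !Hm//; have B0 : 0 < B by rewrite -(divfK (lt0r_neq0 A0) B) mulr_gt0.
  by field; rewrite !gt_eqF.
split => [H|-> b b0].
  have := H _ BA0; rewrite -subr_le0 E// pmulr_rle0// pmulr_lle0 ?invr_gt0//.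
  move=> h; have : (a * A - B) ^+ 2 == 0 by rewrite eq_le h sqr_ge0.
  rewrite sqrf_eq0 subr_eq0 => /eqP <-.
  by rewrite mulfK// gt_eqF.
rewrite -subr_ge0 E//; apply: mulr_ge0; first exact: ltW.
by rewrite divr_ge0 ?sqr_ge0// ltW.
Qed.

End algebra.

(** * The error majorant *)

Section energy_estimate.
Context (R : realType) (d : nat) (Omega : set 'rV[R]_d) (T CF : R).
Local Notation mu := (lebesgue_rV R d.+1).
Local Notation Q := (cylinder Omega T).
Hypotheses (oO : open Omega) (bO : bounded_set Omega) (T0 : 0 < T).
Hypothesis HF : friedrichs Omega T CF.
Variables (f u v : 'rV[R]_d.+1 -> R) (y : 'rV[R]_d.+1 -> 'rV[R]_d).
Variable (E : R -> 'rV[R]_d -> R).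
Hypotheses (Lf : inL2 Q f) (Hu : heat_solution Omega T f u) (Vv : in_V Omega T v)
  (Hy : in_Hdivx Omega T y) (HE : H10_continuous_rep Omega T (u \- v) E).

Let e := u \- v.
Let r_eq := (f \- dt Omega T v) \+ divx Omega T y.
Let r_d := fun z => y z - gradx Omega T v z.

Let oQ : open Q. Proof. exact: (@open_strip R d Omega oO 0 T). Qed.
Let bQ : bounded_set Q. Proof. exact: (@bounded_strip R d Omega bO 0 T). Qed.
Let mQ : measurable Q. Proof. exact: open_measurable_rV. Qed.
Let mO : measurable Omega. Proof. exact: open_measurable_rV. Qed.

Let Vu : in_V Omega T u. Proof. by case: Hu. Qed.
Let Su : sobolev Q setT u. Proof. by case: Vu => -[]. Qed.
Let Sv : sobolev Q setT v. Proof. by case: Vv => -[]. Qed.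
Let Lu : inL2 Q u. Proof. by case: Su. Qed.
Let Lv : inL2 Q v. Proof. by case: Sv. Qed.
Let Le : inL2 Q e. Proof. exact: (inL2B mQ Lu Lv). Qed.
Let Du k : is_wderiv Q k u (wderiv Q k u).
Proof. by apply: wderiv_spec; case: Su => _; exact. Qed.
Let Dv k : is_wderiv Q k v (wderiv Q k v).
Proof. by apply: wderiv_spec; case: Sv => _; exact. Qed.
Let Ldu k : inL2 Q (wderiv Q k u). Proof. by case: (Du k). Qed.
Let Ldv k : inL2 Q (wderiv Q k v). Proof. by case: (Dv k). Qed.

(** The derivatives of the error are represented by differences of the chosen ones
    of [u] and [v]; these agree almost everywhere with those chosen for [e] itself,
    and satisfy the error equation. *)
Let de k z := wderiv Q k u z - wderiv Q k v z.
Let Lde k : inL2 Q (de k). Proof. exact: (inL2B mQ (Ldu k) (Ldv k)). Qed.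
Let De k : is_wderiv Q k e (de k). Proof. exact: (is_wderivB oQ bQ Lu Lv (Du k) (Dv k)). Qed.
Let De' k : is_wderiv Q k e (wderiv Q k e).
Proof. by apply: wderiv_spec; exists (de k). Qed.
Let Lde' k : inL2 Q (wderiv Q k e). Proof. by case: (De' k). Qed.
Let ae_de k : {ae mu, forall z, Q z -> wderiv Q k e z = de k z}.
Proof. exact: (wderiv_uniq oQ bQ (De' k) (De k)). Qed.

Let ge z : 'rV[R]_d := \row_i de (xdir i) z.
Let geE i : (fun z => ge z ord0 i) = de (xdir i).
Proof. by apply/funext => z; rewrite mxE. Qed.
Let gvE (w : 'rV[R]_d.+1 -> R) i :
  (fun z => gradx Omega T w z ord0 i) = wderiv Q (xdir i) w.
Proof. by apply/funext => z; rewrite mxE. Qed.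
Let Lge i : inL2 Q (fun z => ge z ord0 i). Proof. by rewrite geE. Qed.
Let Lgv i : inL2 Q (fun z => gradx Omega T v z ord0 i). Proof. by rewrite gvE. Qed.
Let Lgu i : inL2 Q (fun z => gradx Omega T u z ord0 i). Proof. by rewrite gvE. Qed.
Let Ly i : inL2 Q (fun z => y z ord0 i). Proof. by case: Hy. Qed.

Let lap_u : is_divx Omega T (gradx Omega T u) (lapx Omega T u).
Proof. by apply: divx_spec; case: Vu. Qed.
Let lap_v : is_divx Omega T (gradx Omega T v) (lapx Omega T v).
Proof. by apply: divx_spec; case: Vv. Qed.
Let div_y : is_divx Omega T y (divx Omega T y).
Proof. by apply: divx_spec; case: Hy. Qed.
Let l z := lapx Omega T u z - lapx Omega T v z.
Let dr z := divx Omega T y z - lapx Omega T v z.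
Let div_ge : is_divx Omega T ge l.
Proof.
rewrite (_ : ge = fun z => gradx Omega T u z - gradx Omega T v z); first exact: (is_divxB oO bO Lgu Lgv lap_u lap_v).
by apply/funext => z; apply/rowP => i; rewrite !mxE.
Qed.
Let div_rd : is_divx Omega T r_d dr.
Proof. exact: (is_divxB oO bO Ly Lgv div_y lap_v). Qed.
Let Ll : inL2 Q l. Proof. by case: div_ge. Qed.
Let Ldr : inL2 Q dr. Proof. by case: div_rd. Qed.
Let Ldy : inL2 Q (divx Omega T y). Proof. by case: div_y. Qed.
Let Lrd i : inL2 Q (fun z => r_d z ord0 i).
Proof.
rewrite (_ : (fun _ => _) = fun z => y z ord0 i - gradx Omega T v z ord0 i).
  exact: (inL2B mQ (Ly i) (Lgv i)).
by apply/funext => z; rewrite !mxE.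
Qed.
Let Lreq : inL2 Q r_eq. Proof. exact: (inL2D mQ (inL2B mQ Lf (Ldv (tdir d))) Ldy). Qed.

Let et := de (tdir d).

Let norm_grad : L2normv Q (gradx Omega T e) = L2normv Q ge.
Proof.
have Lgn i : inL2 Q (fun z => gradx Omega T e z ord0 i) by rewrite gvE; exact: Lde'.
apply: (eq_ae_L2normv mQ Lgn Lge) => i.
by apply: filterS (ae_de (xdir i)) => z Hz /Hz; rewrite !mxE.
Qed.
Let norm_dt : L2norm Q (dt Omega T e) = L2norm Q et.
Proof. exact: (ae_L2norm mQ (Lde' _) (Lde _) (ae_de _)). Qed.
Let norm_divr : L2norm Q (divx Omega T r_d) = L2norm Q dr.
Proof.
have D : is_divx Omega T r_d (divx Omega T r_d) by apply: divx_spec; exists dr.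
exact: (ae_L2norm mQ D.1 Ldr (divx_uniq oO bO D div_rd)).
Qed.

(** The approximants of [e] come from [zero_onB], whose limits are the differences
    [de i]; the boundary condition in the Friedrichs inequality is about the
    derivatives chosen for [e], which agree with them almost everywhere. *)
Let friedrichs_e : L2norm Q e <= CF * L2normv Q ge.
Proof.
rewrite -norm_grad; apply: HF.
  by split; [exact: Le|move=> i _; exists (de i); exact: De].
have [[_ zu] _ _] := Vu.
have [[_ zv] _ _] := Vv.
have [phi [sphi phi0 c0 c1]] := zero_onB oQ bQ Su Sv zu zv.
have Lphi j : inL2 Q (phi j) by exact: inL2_continuous (smooth_cont (sphi j)).
have Ldphi i j : inL2 Q (pderiv i (phi j)).
  by apply: inL2_continuous => //; apply: smooth_cont; exact: smooth_pderiv.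
exists phi; split => //.
  rewrite (_ : (fun k => _) = fun k => (L2norm Q (fun x => phi k x - (u x - v x)))%:E).
    by apply: cvg_EFin; [exact: nearW|exact: c0].
  by apply/funext => k; exact: (L2norme_fine mQ (inL2B mQ (Lphi k) Le)).
move=> i _.
rewrite (_ : (fun k => _) = fun k => (L2norm Q (fun x => pderiv i (phi k) x - de i x))%:E).
  by apply: cvg_EFin; [exact: nearW|exact: c1].
apply/funext => k.
have L1 := inL2B mQ (Ldphi i k) (Lde' i); have L2 := inL2B mQ (Ldphi i k) (Lde i).
apply: (etrans (L2norme_fine mQ L1)); congr EFin; apply: (ae_L2norm mQ L1 L2).
by apply: filterS (ae_de i) => z Hz /Hz /= ->.
Qed.

Let dq_e_cvg (h : nat -> R) : (forall k, 0 < h k <= T) -> h k @[k --> \oo] --> (0 : R) ->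
  L2norm Q (fun z => dq Omega T (h k) e z - et z) @[k --> \oo] --> (0 : R).
Proof.
have [_ _ zu] := Vu; have [_ _ zv] := Vv.
have [phi [sphi phi0 c0 c1]] := zero_onB oQ bQ Su Sv zu zv.
have b0 j z : Omega (sp z) -> tm z = 0 -> phi j z = 0.
  move=> Oz tz; have [U [_ bU U0]] := phi0 j; apply: U0; apply: bU.
  by split.
exact: (diffquot_cvg oO bO sphi b0 Le (Lde (tdir d)) c0 (c1 (tdir d))).
Qed.

Let LET : inL2 Omega (E T) /\ forall i, exists g, is_wderiv Omega i (E T) g.
Proof.
have [H _ _] := HE; have TT : 0 <= T <= T by rewrite (ltW T0) lexx.
by have [[LE DE] _] := H T TT; split => // i; exact: DE.
Qed.
Let DET i : is_wderiv Omega i (E T) (wderiv Omega i (E T)).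
Proof. by apply: wderiv_spec; case: LET. Qed.
Let LDET i : inL2 Omega (wderiv Omega i (E T)). Proof. by case: (DET i). Qed.

Let trace_bounds :
  2^-1 * L2norm Omega (E T) ^+ 2 <= ip Q e et /\
  2^-1 * L2normv Omega (grad Omega (E T)) ^+ 2 <= - ip Q l et.
Proof.
have [H _ _] := HE; have TT : 0 <= T <= T by rewrite (ltW T0) lexx.
have [_ [psi [spsi psi0 c0 c1]]] := H T TT.
have [LE _] := LET.
split.
  rewrite L2norm_sqr//; apply: (energy_trace oO bO T0 Le (Lde _) HE dq_e_cvg spsi).
  exact: L2norm_cvg.
have [[_ zu] _ _] := Vu.
have [[_ zv] _ _] := Vv.
have [phi [sphi phi0 d0 d1]] := zero_onB oQ bQ Su Sv zu zv.
have GE i : (fun x => grad Omega (E T) x ord0 i) = wderiv Omega i (E T).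
  by apply/funext => x; rewrite mxE.
have Hy' i : is_wderiv Q (xdir i) e (fun z => ge z ord0 i).
  by rewrite geE; exact: De.
have d1' i : L2norm Q (fun z => pderiv (xdir i) (phi j) z - ge z ord0 i) @[j --> \oo] --> (0 : R).
  have := d1 (xdir i); apply: cvg_trans; apply: near_eq_cvg; apply: nearW => j.
  by apply: eq_L2norm => z _; rewrite mxE.
have c1' i : L2norm Omega (fun x => pderiv i (psi j) x - wderiv Omega i (E T) x)
    @[j --> \oo] --> (0 : R).
  exact: L2norm_cvg (c1 i I).
rewrite (L2normv_sqr mO); last by move=> i; rewrite GE; exact: LDET.
under eq_bigr do rewrite GE.
exact: (energy_grad_trace oO bO T0 Le (Lde (tdir d)) HE dq_e_cvg Hy' div_ge sphi phi0 d0 d1' DET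
  spsi psi0 c1').
Qed.

Let ibp_e (w : 'rV[R]_d.+1 -> 'rV[R]_d) g : (forall i, inL2 Q (fun z => w z ord0 i)) ->
  is_divx Omega T w g ->
  \sum_(i < d) ip Q (fun z => w z ord0 i) (fun z => ge z ord0 i) = - ip Q g e.
Proof.
move=> Lw dw.
have [[_ zu] _ _] := Vu.
have [[_ zv] _ _] := Vv.
have [phi [sphi phi0 d0 d1]] := zero_onB oQ bQ Su Sv zu zv.
have TT : 0 < T <= T by rewrite T0 lexx.
have [|<- _] := ibp_dq oO bO T0 TT Lw dw sphi phi0 Le (fun i => Lde (xdir i)) d0.
  by move=> i; exact: d1.
by apply: eq_bigr => i _; rewrite geE.
Qed.

(** The heat equation of [u] minus the definition of the residuals. *)
Let error_eq w : inL2 Q w -> ip Q et w - ip Q l w = ip Q r_eq w - ip Q dr w.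
Proof.
move=> Lw.
have E1 := ipBl mQ Lw (Lde (tdir d)) Ll.
have E2 := ipBl mQ Lw Lreq Ldr.
have E3 := ae_ip mQ (inL2B mQ (Lde (tdir d)) Ll) (inL2B mQ Lreq Ldr) Lw.
apply: (etrans (esym E1)).
apply: (etrans _ E2).
apply: E3.
have [_ Hae] := Hu.
apply: (@filterS _ _ (ae_filter_ringOfSetsType mu) _ _ _ Hae).
move=> z Hz Qz.
have Ez : dt Omega T u z - lapx Omega T u z = f z by exact: Hz.
exact: (residual_identity (dt Omega T v z) (lapx Omega T v z) (divx Omega T y z) Ez).
Qed.

(** The two energy identities at work: [error_eq] is used with [e] and with its time
    derivative, and [ibp_e] with the gradient of [e] and with [r_d]. *)
Lemma error_majorant delta gamma a1 a2 : 0 < delta -> 2^-1 <= gamma -> 0 < a1 -> 0 < a2 ->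
  (2 - gamma^-1) * (L2normv Q (gradx Omega T e) ^+ 2 +
                    delta * L2norm Q (dt Omega T e) ^+ 2) +
  delta * L2normv Omega (grad Omega (E T)) ^+ 2 + L2norm Omega (E T) ^+ 2
  <= gamma * majorant CF delta (L2normv Q r_d) (L2norm Q (divx Omega T r_d))
                      (L2norm Q r_eq) a1 a2.
Proof.
move=> d0 g2 a10 a20; rewrite norm_grad norm_dt norm_divr.
have [B1 B2] := trace_bounds.
apply: (majorant_of_energies d0 (L2norm_ge0 _ _) friedrichs_e a10 a20 g2).
  rewrite (ipC _ e) in B1.
  apply: (first_energy (error_eq Le) _ (ibp_e Lrd div_rd) B1
    (le_trans (ler_norm _) (ip_CS mQ Lreq Le)) (sum_ip_CS mQ Lrd Lge)).
  exact: (etrans (L2normv_sqr mQ Lge) (ibp_e Lge div_ge)).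
have C3 := ler_norm (- ip Q dr (de (tdir d))).
rewrite normrN in C3.
exact: (second_energy (error_eq (Lde (tdir d))) (L2norm_sqr mQ (Lde (tdir d))) B2
    (le_trans (ler_norm _) (ip_CS mQ Lreq (Lde (tdir d))))
    (le_trans C3 (ip_CS mQ Ldr (Lde (tdir d))))).
Qed.
End energy_estimate.

Theorem corollary1 (R : realType) (d : nat) (Omega : set 'rV[R]_d)
    (T CF theta h : R) (f u v : 'rV[R]_d.+1 -> R)
    (y : 'rV[R]_d.+1 -> 'rV[R]_d) (E : R -> 'rV[R]_d -> R) :
  let Q := cylinder Omega T in
  let delta := theta * h in
  let e := u \- v in
  let r_eq := (f \- dt Omega T v) \+ divx Omega T y in
  let r_d := fun z => y z - gradx Omega T v z in
  let norm_d := L2normv Q r_d in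
  let norm_div := L2norm Q (divx Omega T r_d) in
  let norm_eq := L2norm Q r_eq in
  let maj := majorant CF delta norm_d norm_div norm_eq in
  let alpha1 := CF * norm_eq / norm_d in
  let alpha2 := norm_eq / norm_div in
  (1 <= d <= 3)%N -> lipschitz_domain Omega -> 0 < T ->
  0 < CF -> friedrichs Omega T CF ->
  0 < theta -> 0 < h ->
  inL2 Q f -> heat_solution Omega T f u ->
  in_V Omega T v -> in_Hdivx Omega T y ->
  H10_continuous_rep Omega T e E ->
  [/\ forall gamma a1 a2 : R, 2^-1 <= gamma -> 0 < a1 -> 0 < a2 ->
        (2 - gamma^-1) * (L2normv Q (gradx Omega T e) ^+ 2 +
                          delta * L2norm Q (dt Omega T e) ^+ 2) +
        delta * L2normv Omega (grad Omega (E T)) ^+ 2 +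
        L2norm Omega (E T) ^+ 2
        <= gamma * maj a1 a2,
      forall a1 a2 : R, 0 < a1 -> 0 < a2 ->
        L2normv Q (gradx Omega T e) ^+ 2 +
        delta * L2norm Q (dt Omega T e) ^+ 2 +
        L2norm Omega (E T) ^+ 2 +
        delta * L2normv Omega (grad Omega (E T)) ^+ 2
        <= maj a1 a2,
      norm_d != 0 -> 0 < alpha1 ->
        forall a1 a2 : R, 0 < a1 -> 0 < a2 ->
          (forall b1 : R, 0 < b1 -> maj a1 a2 <= maj b1 a2) <-> a1 = alpha1,
      norm_div != 0 -> 0 < alpha2 ->
        forall a1 a2 : R, 0 < a1 -> 0 < a2 ->
          (forall b2 : R, 0 < b2 -> maj a1 a2 <= maj a1 b2) <-> a2 = alpha2 &
      norm_d != 0 -> 0 < alpha1 -> norm_div != 0 -> 0 < alpha2 ->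
        forall a1 a2 : R, 0 < a1 -> 0 < a2 ->
          (forall b1 b2 : R, 0 < b1 -> 0 < b2 -> maj a1 a2 <= maj b1 b2) <->
          a1 = alpha1 /\ a2 = alpha2].

Proof.
move=> Q delta e r_eq r_d norm_d norm_div norm_eq maj alpha1 alpha2 _ [oO _ _ bO _].
move=> T0 CF0 HF th0 h0 Lf Hu Vv Hy HE.
have d0 : 0 < delta by exact: mulr_gt0.
have est gamma a1 a2 := @error_majorant R d Omega T CF oO bO T0 HF f u v y E
  Lf Hu Vv Hy HE delta gamma a1 a2 d0.
have nd0 : 0 <= norm_d := L2normv_ge0 _ _.
have ndiv0 : 0 <= norm_div := L2norm_ge0 _ _.
have min1 : norm_d != 0 -> 0 < alpha1 -> forall a1 a2 : R, 0 < a1 -> 0 < a2 ->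
    (forall b1 : R, 0 < b1 -> maj a1 a2 <= maj b1 a2) <-> a1 = alpha1.
  move=> ndn0 al0 a1 a2 a10 a20.
  apply: (@balanced_weight_minimal _ norm_d (CF * norm_eq)
    (norm_d ^+ 2 + (CF * norm_eq) ^+ 2 + delta * ((1 + a2) * norm_div ^+ 2 + (1 + a2^-1) * norm_eq ^+ 2))
    1 (fun a => maj a a2)) => //.
    by rewrite lt_def ndn0.
  by move=> a _; rewrite /maj /majorant; ring.
have min2 : norm_div != 0 -> 0 < alpha2 -> forall a1 a2 : R, 0 < a1 -> 0 < a2 ->
    (forall b2 : R, 0 < b2 -> maj a1 a2 <= maj a1 b2) <-> a2 = alpha2.
  move=> ndn0 al0 a1 a2 a10 a20.
  apply: (@balanced_weight_minimal _ norm_div norm_eq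
    ((1 + a1) * norm_d ^+ 2 + (1 + a1^-1) * CF ^+ 2 * norm_eq ^+ 2 + delta * (norm_div ^+ 2 + norm_eq ^+ 2))
    delta (maj a1)) => //.
    by rewrite lt_def ndn0.
  by move=> a _; rewrite /maj /majorant; ring.
split; [exact: est| |exact: min1|exact: min2|].
- move=> a1 a2 a10 a20; have := est 1 a1 a2 _ a10 a20.
  rewrite invf_le1// ler1n => /(_ isT); rewrite invr1 mul1r.
  by move=> H; apply: le_trans H; rewrite le_eqVlt; apply/orP; left; apply/eqP; ring.
- move=> nd al1 ndiv al2 a1 a2 a10 a20; split.
    move=> H; split; first by apply/(min1 nd al1 a1 a2) => // b1 b10; exact: H.
    by apply/(min2 ndiv al2 a1 a2) => // b2 b20; exact: H.
  move=> [-> ->] b1 b2 b10 b20.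
  apply: (@le_trans _ _ (maj b1 alpha2)).
    by apply: (iffRL (min1 nd al1 alpha1 alpha2 al1 al2)).
  by apply: (iffRL (min2 ndiv al2 b1 alpha2 b10 al2)).
Qed.
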